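(* Let $d\ge1$, $T>0$, $a_1,\dots,a_d>0$, $\Omega_0=\prod_{i=1}^d(0,a_i)$ and $\Omega=\Omega_0\times(0,T)\subset\mathbb R^{d+1}$. Let $W$, $\mathcal V$, $\mathcal V^*$, $V$, $V^*$ be the spaces associated with the first order wave operator on $\Omega$ as defined in the context. Then $\mathcal V^*$ is dense in $V^*$ and $\mathcal V$ is dense in $V$ (with respect to the norm $\|\cdot\|_W$).
   Context: All functions are real-valued; points of $\Omega$ are written $(x,t)$; $c>0$ is a constant. $(\cdot,\cdot)$ and $\|\cdot\|$ are the inner product and norm of $L^2(\Omega)^{d+1}$. Vector functions $u$ with $d+1$ components are partitioned as $u=(u_q,u_\mu)$, with $u_q$ having $d$ components and $u_\mu$ scalar. $\mathcal D(\bar\Omega)$ denotes the functions on $\bar\Omega$ that are smooth up to the boundary (restrictions of smooth compactly supported functions on $\mathbb R^{d+1}$). The wave operator is the distributional operator $$Au=\begin{pmatrix}\partial_t u_q-c\,\nabla_x u_\mu\\ \partial_t u_\mu-c\,\mathrm{div}_x u_q\end{pmatrix},\qquad u\in L^2(\Omega)^{d+1}.$$ $W=\{u\in L^2(\Omega)^{d+1}: Au\in L^2(\Omega)^{d+1}\}$, with graph norm $\|u\|_W=(\|u\|^2+\|Au\|^2)^{1/2}$ (a Hilbert space). $D:W\to W'$ is defined by $\langle Du,v\rangle_W=(Au,v)+(u,Av)$ for $u,v\in W$, where $W'$ is the dual of $W$. With $\Gamma_0=\Omega_0\times\{0\}$, $\Gamma_T=\Omega_0\times\{T\}$, $\Gamma_b=\partial\Omega_0\times[0,T]$,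 put $$\mathcal V=\{u\in\mathcal D(\bar\Omega)^{d+1}: u|_{\Gamma_0}=0,\ u_\mu|_{\Gamma_b}=0\},\qquad \mathcal V^*=\{v\in\mathcal D(\bar\Omega)^{d+1}: v|_{\Gamma_T}=0,\ v_\mu|_{\Gamma_b}=0\}.$$ $V=\{u\in W:\langle Du,v\rangle_W=0\ \text{for all } v\in\mathcal V^*\}$, with the topology of $W$. Regard $A$ as an unbounded operator in $L^2(\Omega)^{d+1}$ with domain $\mathrm{dom}(A)=V$; it is densely defined, and its Hilbert space adjoint $A^*$ acts as the distributional operator $-A$ on $\mathrm{dom}(A^* )=\{\tilde w\in L^2(\Omega)^{d+1}:\exists\,\ell\in L^2(\Omega)^{d+1}\text{ with }(Au,\tilde w)=(u,\ell)\ \forall u\in\mathrm{dom}(A)\}\subset W$. $V^*$ denotes $\mathrm{dom}(A^* )$ with the topology of $W$; equivalently $V^*=\{w\in W:\langle Du,w\rangle_W=0\ \text{for all } u\in V\}$. One has $\mathcal V\subset V$ and $\mathcal V^*\subset V^*$. *)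

(* Defs.v *)
From HB Require Import structures.
From mathcomp Require Import all_boot all_order all_algebra.
From mathcomp Require Import all_classical all_reals all_analysis.

Set Implicit Arguments.
Unset Strict Implicit.
Unset Printing Implicit Defensive.

Import Order.TTheory GRing.Theory Num.Theory.
Import numFieldNormedType.Exports.

Local Open Scope classical_set_scope.
Local Open Scope ring_scope.

(* The sigma-algebra on R^n generated by the coordinate functions
   (equivalently, the Borel sigma-algebra). *)
Section rV_measurable.
Context (R : realType) (n : nat).

Let coord (i : 'I_n) (x : 'rV[R]_n) : measurableTypeR R := x ord0 i.

Let rV_set0 : g_sigma_preimage coord set0.
Proof. exact: sigma_algebra0. Qed.

Let rV_setC A : g_sigma_preimage coord A -> g_sigma_preimage coord (~` A).
Proof. exact: sigma_algebraC. Qed.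

Let rV_bigcup (F : _^nat) : (forall i, g_sigma_preimage coord (F i)) ->
  g_sigma_preimage coord (\bigcup_i (F i)).
Proof. exact: sigma_algebra_bigcup. Qed.

HB.instance Definition _ := @isMeasurable.Build default_measure_display
  'rV[R]_n (g_sigma_preimage coord) rV_set0 rV_setC rV_bigcup.

Lemma measurable_coord (i : 'I_n) :
  measurable_fun [set: 'rV[R]_n] (fun x => x ord0 i : measurableTypeR R).
Proof.
move=> _ Y mY; rewrite setTI; apply: sub_sigma_algebra => /=.
rewrite -bigcup_seq/=; exists i => /=; first by rewrite mem_index_enum.
by exists Y => //; rewrite setTI.
Qed.

Lemma measurable_fun_coordP d (T : measurableType d) (f : T -> 'rV[R]_n) :
  (forall i, measurable_fun [set: T] (fun x => f x ord0 i : measurableTypeR R))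
  -> measurable_fun [set: T] f.
Proof.
move=> mf _ A mA; rewrite setTI.
have pre : g_sigma_preimage (fun i => coord i \o f) `<=` measurable.
  apply: smallest_sub; first exact: sigma_algebra_measurable.
  rewrite -bigcup_seq/=; apply: bigcup_sub => i _ _ [B mB <-].
  exact: mf.
apply: pre; rewrite g_sigma_preimage_comp.
by exists A => //; rewrite setTI.
Qed.

End rV_measurable.

Lemma sigma_finite_prod d1 d2 (T1 : measurableType d1) (T2 : measurableType d2)
    (R : realType) (m1 : {sigma_finite_measure set T1 -> \bar R})
    (m2 : {sigma_finite_measure set T2 -> \bar R}) :
  sigma_finite setT (m1 \x m2)%E.
Proof.
have /sigma_finiteP[F [TF ndF Foo]] := sigma_finiteT m1.
have /sigma_finiteP[G [TG ndG Goo]] := sigma_finiteT m2.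
exists (fun n => F n `*` G n).
  rewrite -setXTT TF TG predeqE => -[x y]; split.
    move=> [/= [n _ Fnx] [k _ Gky]]; exists (maxn n k) => //; split.
    - by move: x Fnx; exact/subsetPset/ndF/leq_maxl.
    - by move: y Gky; exact/subsetPset/ndG/leq_maxr.
  by move=> [n _ []/= ? ?]; split; exists n.
move=> k; have [? ?] := Foo k; have [? ?] := Goo k.
split; first exact: measurableX.
by rewrite product_measure1E// lte_mul_pinfty// ge0_fin_numE.
Qed.

Section lebesgue_rV.
Context (R : realType).

Definition rV_cons n (p : measurableTypeR R * 'rV[R]_n) : 'rV[R]_n.+1 :=
  \row_i oapp (p.2 ord0) p.1 (unlift ord0 i).

Lemma measurable_rV_cons n : measurable_fun [set: _] (@rV_cons n).
Proof.
apply: measurable_fun_coordP => i.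
under [X in measurable_fun _ X]eq_fun do rewrite mxE.
case: (unliftP ord0 i) => [j|] _ /=; last exact: measurable_fst.
exact: (measurableT_comp (@measurable_coord _ _ j)).
Qed.

Section step.
Context n (mu : {sigma_finite_measure set 'rV[R]_n -> \bar R}).

Let leb : {sigma_finite_measure set (measurableTypeR R) -> \bar R} :=
  @lebesgue_measure R.

Definition lebesgue_rV_step : set 'rV[R]_n.+1 -> \bar R :=
  pushforward (leb \x mu)%E (@rV_cons n).

Let step0 : lebesgue_rV_step set0 = 0%E.
Proof. by rewrite /lebesgue_rV_step /pushforward preimage_set0 measure0. Qed.

Let step_ge0 A : (0 <= lebesgue_rV_step A)%E.
Proof. by rewrite /lebesgue_rV_step /pushforward measure_ge0. Qed.

Let step_sigma_additive : semi_sigma_additive lebesgue_rV_step.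
Proof.
move=> F mF tF mUF; rewrite /lebesgue_rV_step /pushforward preimage_bigcup.
apply: measure_semi_sigma_additive.
- by move=> k; rewrite -[X in measurable X]setTI; exact: measurable_rV_cons.
- apply/trivIsetP => /= i j _ _ ij; rewrite -preimage_setI.
  by move/trivIsetP : tF => /(_ _ _ _ _ ij) ->//; rewrite preimage_set0.
- rewrite -preimage_bigcup -[X in measurable X]setTI.
  exact: measurable_rV_cons.
Qed.

HB.instance Definition _ := isMeasure.Build _ _ _
  lebesgue_rV_step step0 step_ge0 step_sigma_additive.

Let rV_uncons (x : 'rV[R]_n.+1) : measurableTypeR R * 'rV[R]_n :=
  (x ord0 ord0, \row_j x ord0 (lift ord0 j)).

Let rV_consK : cancel (@rV_cons n) rV_uncons.
Proof.
case=> t x; congr pair; first by rewrite mxE unlift_none.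
by apply/rowP => j; rewrite !mxE liftK.
Qed.

Let measurable_rV_uncons : measurable_fun [set: _] rV_uncons.
Proof.
apply/measurable_fun_pair; first exact: measurable_coord.
apply: measurable_fun_coordP => i.
under [X in measurable_fun _ X]eq_fun do rewrite mxE.
exact: measurable_coord.
Qed.

Let step_sigma_finite : sigma_finite setT lebesgue_rV_step.
Proof.
have [F TF Foo] := sigma_finite_prod leb mu.
exists (fun k => rV_uncons @^-1` F k).
  by rewrite -preimage_bigcup -TF preimage_setT.
move=> k; have [mF Fk] := Foo k; split.
  by rewrite -[X in measurable X]setTI; exact: measurable_rV_uncons.
rewrite /lebesgue_rV_step /pushforward -comp_preimage.
by rewrite (_ : rV_uncons \o _ = id) //; exact/funext/rV_consK.
Qed.

HB.instance Definition _ := Measure_isSigmaFinite.Build _ _ _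
  lebesgue_rV_step step_sigma_finite.

End step.

(* Lebesgue measure on R^n, as the n-fold product of Lebesgue measure on R *)
Fixpoint lebesgue_rV n : {sigma_finite_measure set 'rV[R]_n -> \bar R} :=
  if n is n'.+1 then lebesgue_rV_step (lebesgue_rV n')
  else \d_(0 : 'rV[R]_0).

Lemma measurable_rV_box n (A : 'I_n -> set (measurableTypeR R)) :
  (forall i, measurable (A i)) ->
  measurable [set x : 'rV[R]_n | forall i, A i (x ord0 i)].
Proof.
move=> mA; rewrite (_ : mkset _ =
    \big[setI/setT]_i ((fun x : 'rV[R]_n => x ord0 i) @^-1` A i)).
  apply: bigsetI_measurable => i _.
  by rewrite -[X in measurable X]setTI; exact: measurable_coord.
apply/seteqP; split=> x /=; rewrite -bigcap_seq/=; first by move=> Ax i _.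
by move=> Ax i; apply: (Ax i); rewrite /= mem_index_enum.
Qed.

Lemma lebesgue_rV_box n (A : 'I_n -> set (measurableTypeR R)) :
  (forall i, measurable (A i)) ->
  lebesgue_rV n [set x | forall i, A i (x ord0 i)] =
  (\prod_(i < n) lebesgue_measure (A i))%E.
Proof.
elim: n A => [|n IHn] A mA.
  by rewrite big_ord0 /= diracE mem_set// => -[].
rewrite big_ord_recl -IHn//.
rewrite -(product_measure1E _ (lebesgue_rV n))//; last first.
  exact: (measurable_rV_box (fun j => mA (lift ord0 j))).
rewrite [LHS]/= /lebesgue_rV_step /pushforward; congr (_ _).
apply/seteqP; split=> -[t x] /= Ax.
  split=> [|j]; first by have := Ax ord0; rewrite mxE unlift_none.
  by have := Ax (lift ord0 j); rewrite mxE liftK.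
move=> i; rewrite mxE; case: unliftP => [j|] -> /=; last exact: Ax.1.
exact: Ax.2.
Qed.

End lebesgue_rV.

Section function_spaces.
Context (R : realType) (n : nat).
Implicit Types (U : set 'rV[R]_n) (f : 'rV[R]_n -> R).

Definition partial (i : 'I_n) f : 'rV[R]_n -> R :=
  fun x => 'D_(delta_mx ord0 i) f x.

Definition iter_partial (s : seq 'I_n) f : 'rV[R]_n -> R := foldr partial f s.

Definition smooth f := forall s : seq 'I_n,
  continuous (iter_partial s f) /\
  forall i x, derivable (iter_partial s f) x (delta_mx ord0 i).

Definition tsupport f : set 'rV[R]_n := closure [set x | f x != 0].

(* C_c^oo(U) *)
Definition test_fun U : set ('rV[R]_n -> R) :=
  [set f : 'rV[R]_n -> R | [/\ smooth f, compact (tsupport f) & tsupport f `<=` U]].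

(* D(closure U): only the values on the closure of U matter *)
Definition smooth_up_to_boundary U : set ('rV[R]_n -> R) :=
  [set f : 'rV[R]_n -> R | exists2 F, test_fun setT F & {in closure U, f =1 F}].

(* Elements of L^2(U) are handled through representatives, whose values
   outside U are irrelevant. *)
Definition L2 U : set ('rV[R]_n -> R) :=
  [set f : 'rV[R]_n -> R | f \_ U \in Lfun (lebesgue_rV R n) 2%:E].

(* Functionals on test functions; only their values on [test_fun U] matter. *)
Definition functional := ('rV[R]_n -> R) -> R.

Definition regular U f : functional :=
  fun phi => \int[lebesgue_rV R n]_(x in U) (f x * phi x).

Definition dpartial (i : 'I_n) (L : functional) : functional :=
  fun phi => - L (partial i phi).

End function_spaces.

(* Points p of R^(d+1) are pairs (x, t) with x_i = p ord0 (lift ord_max i) and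
   t = p ord0 ord_max; likewise u = (u_q, u_mu) with i-th component of u_q
   u p ord0 (lift ord_max i) and u_mu p = u p ord0 ord_max. *)
Definition vfun (R : realType) (d : nat) := 'rV[R]_d.+1 -> 'rV[R]_d.+1.

Section wave_operator.
Context (R : realType) (d : nat) (c : R) (Omega : set 'rV[R]_d.+1).
Implicit Types u v w g : vfun R d.

Definition component u (k : 'I_d.+1) : 'rV[R]_d.+1 -> R := fun p => u p ord0 k.

Definition vL2 : set (vfun R d) :=
  [set u | forall k, L2 Omega (component u k)].

Definition inner u v : R :=
  \int[lebesgue_rV R d.+1]_(p in Omega) \sum_(k < d.+1) u p ord0 k * v p ord0 k.

Definition normL2 u : R := Num.sqrt (inner u u).

Definition wave_distribution u (k : 'I_d.+1) : functional R d.+1 :=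
  fun phi =>
    dpartial ord_max (regular Omega (component u k)) phi -
    c * match unlift ord_max k with
        | Some i => dpartial (lift ord_max i)
                      (regular Omega (component u ord_max)) phi
        | None => \sum_(i < d) dpartial (lift ord_max i)
                      (regular Omega (component u (lift ord_max i))) phi
        end.

(* A u = g as distributions on Omega, with g in L^2 *)
Definition is_wave u g := vL2 g /\
  forall k phi, test_fun Omega phi ->
    wave_distribution u k phi = regular Omega (component g k) phi.

Definition W : set (vfun R d) := [set u | vL2 u /\ exists g, is_wave u g].

(* For u in W, a representative of A u (unique up to equality a.e. in Omega) *)
Definition wave u : vfun R d := xget (fun=> 0) [set g | is_wave u g].

Definition normW u : R := Num.sqrt (normL2 u ^+ 2 + normL2 (wave u) ^+ 2).

(* <D u, v>_W *)
Definition pairingD u v : R := inner (wave u) v + inner u (wave v).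

(* Domain of the adjoint of the unbounded operator u |-> wave u on L^2 with
   domain dom. *)
Definition adjoint_domain (dom : set (vfun R d)) : set (vfun R d) :=
  [set w | vL2 w /\ exists2 l, vL2 l &
    forall u, dom u -> inner (wave u) w = inner u l].

(* S is a dense subset of X for the norm of W *)
Definition denseW (S X : set (vfun R d)) :=
  S `<=` X /\
  forall w, X w -> forall e : R, 0 < e -> exists2 v, S v & normW (w - v) < e.

End wave_operator.

Section box.
Context (R : realType) (d : nat) (c T : R) (a : 'I_d -> R).

Definition Omega0 : set 'rV[R]_d := [set x | forall i, 0 < x ord0 i < a i].

(* X x I as a subset of R^(d+1) *)
Definition cylinder (X : set 'rV[R]_d) (I : set R) : set 'rV[R]_d.+1 :=
  [set p | X (col' ord_max p) /\ I (p ord0 ord_max)].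

Definition Omega : set 'rV[R]_d.+1 := cylinder Omega0 `]0, T[.

Definition Gamma_0 : set 'rV[R]_d.+1 := cylinder Omega0 [set 0].

Definition Gamma_T : set 'rV[R]_d.+1 := cylinder Omega0 [set T].

Definition Gamma_b : set 'rV[R]_d.+1 :=
  cylinder (closure Omega0 `\` interior Omega0) `[0, T].

Definition calV : set (vfun R d) :=
  [set u | [/\ forall k, smooth_up_to_boundary Omega (component u k),
               forall p, Gamma_0 p -> u p = 0 &
               forall p, Gamma_b p -> u p ord0 ord_max = 0]].

Definition calVstar : set (vfun R d) :=
  [set v | [/\ forall k, smooth_up_to_boundary Omega (component v k),
               forall p, Gamma_T p -> v p = 0 &
               forall p, Gamma_b p -> v p ord0 ord_max = 0]].

Definition V : set (vfun R d) :=
  [set u | W c Omega u /\ forall v, calVstar v -> pairingD c Omega u v = 0].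

Definition Vstar : set (vfun R d) := adjoint_domain c Omega V.

End box.

(* Main.v *)
(* The wave operator A satisfies an energy estimate: for smooth F vanishing at
   t = 0 with F_mu = 0 on the lateral boundary, Green's formula applied to F and
   (T - t) F gives ||F|| <= 2 T ||A F||, and similarly backwards in time. So it
   suffices that A(calV) and A(calVstar) are dense in L^2: by duality the
   estimate extends to all weak solutions, and if A v_n -> A u in L^2 then
   v_n -> u in the norm of W. For the density of the range, A preserves the
   finite-dimensional spaces spanned by products of sines and cosines of fixed
   frequencies in x adapted to the boundary conditions, and on such a space a
   right-hand side that is polynomial in t is reached by a Neumann series in
   time whose remainder is O(K^n / n!). That these modes span a dense subspace
   of L^2, and that test functions do (so that A u is well defined), follows
   from one criterion: the bounded functions multiplying a closed subspace into
   itself form an algebra closed under bounded pointwise limits, and if it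
   contains the half-space indicators it contains all bounded measurable
   functions. *)

(* The obstacle is that elements of V and V^* have no traces: their boundary conditions are known
   only through pairings with smooth fields. Hence nothing is built from u itself by cutting off or
   mollifying. The function A u carries no boundary condition, so it can be approximated freely, and
   its approximants are images of explicit fields that satisfy the conditions exactly. V is tested
   with fields vanishing at t = T and V^* with fields vanishing at t = 0, so the range is studied
   for both ends at once, with [t0] equal to 0 or T. The rectangular shape enters through the modes.
   Resonant sines vanish on both opposite faces, and multiplication by cos(pi x_i / a_i) only shifts
   a frequency by pi / a_i, which keeps it resonant. As this cosine is strictly monotone across the
   box, it yields the half-space indicators in x_i; multiplication by t - t0, which raises the
   degree in t, yields those in t. Powers of t - t0 are also what makes the fields vanish at t0. *)
Require Import Defs.
From mathcomp Require Import all_boot all_order all_algebra.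
From mathcomp Require Import all_classical all_reals all_analysis.
From mathcomp Require Import measurable_realfun ring lra.

Set Implicit Arguments.
Unset Strict Implicit.
Unset Printing Implicit Defensive.

Import Order.TTheory GRing.Theory Num.Theory.
Import numFieldNormedType.Exports.

Local Open Scope classical_set_scope.
Local Open Scope ring_scope.

(** * Square-integrable functions and multipliers of closed subspaces *)

Section L2_theory.
Context d (X : measurableType d) (R : realType).
Context (mu : {measure set X -> \bar R}) (D : set X) (mD : measurable D).
Implicit Types f g h : X -> R.

Definition sq_integrable f := measurable_fun D f /\
  mu.-integrable D (EFin \o (fun x => f x ^+ 2)).

Definition ip f g : R := \int[mu]_(x in D) (f x * g x).

Lemma integrable_EFinD f g : mu.-integrable D (EFin \o f) ->
  mu.-integrable D (EFin \o g) ->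
  mu.-integrable D (EFin \o (fun x => f x + g x)).
Proof. by move=> if_ ig; exact: (integrableD mD if_ ig). Qed.

Lemma integrable_EFinZ k f : mu.-integrable D (EFin \o f) ->
  mu.-integrable D (EFin \o (fun x => k * f x)).
Proof. by move=> if_; exact: (integrableZl mD k if_). Qed.

Lemma sq_integrable_le f g : measurable_fun D f -> sq_integrable g ->
  (forall x, D x -> `|f x| <= `|g x|) -> sq_integrable f.
Proof.
move=> mf [mg ig] fg; split => //.
apply: (le_integrable mD _ _ ig).
  by apply/measurable_EFinP; exact: measurable_realfun.measurable_funX.
move=> x Dx /=; rewrite lee_fin !normrX lerXn2r ?nnegrE//; exact: fg.
Qed.

Lemma sq_integrableM f g : sq_integrable f -> sq_integrable g ->
  mu.-integrable D (EFin \o (fun x => f x * g x)).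
Proof.
move=> [mf if_] [mg ig].
apply: (le_integrable mD _ _ (integrableD mD if_ ig)).
  by apply/measurable_EFinP; exact: measurable_funM.
move=> x Dx /=; rewrite lee_fin.
rewrite [leRHS]ger0_norm ?addr_ge0 ?sqr_ge0//.
rewrite ler_norml; apply/andP; split; nra.
Qed.

Lemma sq_integrableD f g : sq_integrable f -> sq_integrable g ->
  sq_integrable (fun x => f x + g x).
Proof.
move=> sf sg; have [mf if_] := sf; have [mg ig] := sg; split.
  exact: measurable_funD.
apply: (le_integrable mD _ _ (integrableD mD (integrableZl mD 2 if_)
   (integrableZl mD 2 ig))).
  apply/measurable_EFinP; apply: measurable_realfun.measurable_funX.
  exact: measurable_funD.
move=> x Dx /=; rewrite lee_fin.
rewrite (ger0_norm (sqr_ge0 _)) ger0_norm.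
  by have := sqr_ge0 (f x - g x); lra.
by rewrite addr_ge0// mulr_ge0// sqr_ge0.
Qed.

Lemma sq_integrableZ k f : sq_integrable f ->
  sq_integrable (fun x => k * f x).
Proof.
move=> [mf if_]; split; first exact: measurable_funM.
apply: (le_integrable mD _ _ (integrableZl mD (k ^+ 2) if_)).
  apply/measurable_EFinP; apply: measurable_realfun.measurable_funX.
  exact: measurable_funM.
by move=> x Dx /=; rewrite exprMn.
Qed.

Lemma sq_integrableB f g : sq_integrable f -> sq_integrable g ->
  sq_integrable (fun x => f x - g x).
Proof.
move=> sf sg; rewrite (_ : (fun x => _) = (fun x => f x + -1 * g x)).
  by apply: sq_integrableD => //; exact: sq_integrableZ.
by apply/funext => x; rewrite mulN1r.
Qed.

Lemma ipC f g : ip f g = ip g f.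
Proof. by apply: eq_Rintegral => x _; rewrite mulrC. Qed.

Lemma ip_ge0 f : 0 <= ip f f.
Proof. by apply: Rintegral_ge0 => x _; rewrite -expr2 sqr_ge0. Qed.

Lemma eq_ip f f' g g' : {in D, f =1 f'} -> {in D, g =1 g'} ->
  ip f g = ip f' g'.
Proof. by move=> ff gg; apply: eq_Rintegral => x Dx; rewrite ff// gg. Qed.

Lemma ipDl f g h : sq_integrable f -> sq_integrable g -> sq_integrable h ->
  ip (fun x => f x + g x) h = ip f h + ip g h.
Proof.
move=> sf sg sh; rewrite /ip -RintegralD//; try exact: sq_integrableM.
by apply: eq_Rintegral => x _; rewrite mulrDl.
Qed.

Lemma ipZl k f h : sq_integrable f -> sq_integrable h ->
  ip (fun x => k * f x) h = k * ip f h.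
Proof.
move=> sf sh; rewrite /ip -RintegralZl//; last exact: sq_integrableM.
by apply: eq_Rintegral => x _; rewrite mulrA.
Qed.

Lemma ipBl f g h : sq_integrable f -> sq_integrable g -> sq_integrable h ->
  ip (fun x => f x - g x) h = ip f h - ip g h.
Proof.
move=> sf sg sh.
rewrite (_ : (fun x => _) = (fun x => f x + -1 * g x)); last first.
  by apply/funext => x; rewrite mulN1r.
by rewrite ipDl// ?ipZl ?mulN1r//; exact: sq_integrableZ.
Qed.

Definition nsq f := ip f f.

Lemma le_nsq f g : sq_integrable f -> sq_integrable g ->
  (forall x, D x -> `|f x| <= `|g x|) -> nsq f <= nsq g.
Proof.
move=> sf sg fg; apply: le_Rintegral => //; try exact: sq_integrableM.
move=> x Dx; rewrite -!expr2 -(real_normK (num_real (f x))).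
rewrite -(real_normK (num_real (g x))) lerXn2r ?nnegrE//; exact: fg.
Qed.

Lemma nsqD_le f g : sq_integrable f -> sq_integrable g ->
  nsq (fun x => f x + g x) <= 2 * nsq f + 2 * nsq g.
Proof.
move=> sf sg; rewrite /nsq /ip.
rewrite -!RintegralZl//; try exact: sq_integrableM.
rewrite -RintegralD//; try by apply: integrable_EFinZ; exact: sq_integrableM.
apply: le_Rintegral => //.
- by apply: sq_integrableM; exact: sq_integrableD.
- by apply: integrable_EFinD; apply: integrable_EFinZ; exact: sq_integrableM.
- by move=> x _; have := sqr_ge0 (f x - g x); lra.
Qed.

Lemma nsqZ k f : sq_integrable f -> nsq (fun x => k * f x) = k ^+ 2 * nsq f.
Proof.
move=> sf; rewrite /nsq ipZl//; last exact: sq_integrableZ.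
by rewrite ipC ipZl// mulrA -expr2.
Qed.

(** Dominated convergence in L^2: the limit inherits the bound by [G], so the squared differences
    are dominated by [4 * G ^+ 2]. *)
Lemma dominated_sq_integrable (f_ : nat -> X -> R) f G :
  (forall n, measurable_fun D (f_ n)) -> sq_integrable G ->
  (forall n x, D x -> `|f_ n x| <= `|G x|) ->
  (forall x, D x -> f_ n x @[n --> \oo] --> f x) ->
  sq_integrable f /\ nsq (fun x => f_ n x - f x) @[n --> \oo] --> 0.
Proof.
move=> mf_ sG fG cf.
have mf : measurable_fun D f by apply: measurable_realfun.measurable_fun_cvg cf.
have fleG x : D x -> `|f x| <= `|G x|.
  move=> Dx; have cn : `|f_ n x| @[n --> \oo] --> `|f x|.
    by apply: cvg_norm; exact: cf.
  rewrite -(cvg_lim _ cn)//; apply: limr_le; first by apply/cvg_ex; exists `|f x|.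
  by near=> n; exact: fG.
have sf : sq_integrable f by exact: sq_integrable_le sG fleG.
have sf_ n : sq_integrable (f_ n) by exact: (sq_integrable_le (mf_ n) sG (fG n)).
split => //.
rewrite /nsq /ip /Rintegral.
(* The limit is written as an integral of the zero function so that the extended-real dominated
   convergence theorem applies. *)
have -> : 0 = fine (\int[mu]_(x in D) (cst 0%E x))%E :> R.
  by rewrite integral0.
apply: fine_cvg; rewrite integral0 -[X in _ --> X](integral0 mu D).
apply: (@dominated_cvg _ _ _ mu D mD _ _ (fun x => (4 * (G x ^+ 2))%:E)).
- move=> n; apply/measurable_EFinP; apply: measurable_funM; exact: measurable_funB.
- move=> x Dx; apply/fine_cvgP; split; first by near=> n.
  rewrite /= -[X in _ --> X](mulr0 (0 : R)).
  have c0 : f_ n x - f x @[n --> \oo] --> (0:R).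
    by rewrite -(subrr (f x)); apply: cvgB; [exact: cf|exact: cvg_cst].
  exact: (cvgM c0 c0).
- by [].
- exact: (integrable_EFinZ 4 sG.2).
- move=> n x Dx; rewrite /= lee_fin.
  have := fG n x Dx; have := fleG x Dx.
  rewrite -[G x ^+ 2](real_normK (num_real (G x))).
  rewrite normrM; have := ler_normB (f_ n x) (f x).
  have := normr_ge0 (f_ n x - f x); have := normr_ge0 (f_ n x).
  have := normr_ge0 (f x); nra.
Unshelve. all: by end_near.
Qed.

End L2_theory.

(** * A polynomial iteration converging to the sign *)

Section sign_iteration.
Context (R : realType).
Implicit Types z : R.

(** Newton-Schulz iteration for the sign: an odd polynomial with fixed points -1, 0, 1 and zero
    derivative at -1 and 1. Being polynomial, it maps multipliers to multipliers. *)
Definition sgn_step z : R := z * (3 - z ^+ 2) / 2.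

Lemma sgn_stepN z : sgn_step (- z) = - sgn_step z.
Proof. by rewrite /sgn_step sqrrN !mulNr. Qed.

Lemma iter_sgn_stepN n z : iter n sgn_step (- z) = - iter n sgn_step z.
Proof. by elim: n => //= n ->; rewrite sgn_stepN. Qed.

(** A step multiplies the distance to 1 by (1 - y)(2 + y) / 2, which is at most 1 - y / 2. The
    iterates increase, so y >= z and the contraction factor is uniform. *)
Lemma iter_sgn_step_bnd n z : 0 < z <= 1 ->
  z <= iter n sgn_step z <= 1 /\ 1 - iter n sgn_step z <= (1 - z / 2) ^+ n.
Proof.
move=> /andP[z0 z1]; elim: n => [|n] /=.
  by rewrite lexx expr0; split => //; lra.
set y := iter n sgn_step z; move=> [/andP[zy y1] IH].
have e1 : 1 - sgn_step y = (1 - y) * ((1 - y) * (2 + y) / 2).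
  by rewrite /sgn_step; field.
have e2 : sgn_step y - y = y * (1 - y) * (1 + y) / 2.
  by rewrite /sgn_step; field.
split.
  apply/andP; split.
    apply: (le_trans zy); rewrite -subr_ge0 e2 divr_ge0// !mulr_ge0//; lra.
  by rewrite -subr_ge0 e1 !mulr_ge0//; lra.
rewrite e1 exprSr; apply: ler_pM => //; first lra.
  by rewrite !mulr_ge0//; lra.
by nra.
Qed.

Lemma cvg_iter_sgn_step z : `|z| <= 1 ->
  iter n sgn_step z @[n --> \oo] --> Num.sg z.
Proof.
wlog z0 : z / 0 <= z => [H zn|].
  have [/H|zlt] := leP 0 z; first exact.
  rewrite -[z]opprK sgrN; under eq_fun do rewrite iter_sgn_stepN.
  by apply: cvgN; apply: H; rewrite ?normrN// oppr_ge0 ltW.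
move=> zn; move: z0; rewrite le_eqVlt => /predU1P[<-|z0].
  rewrite sgr0 (_ : (fun n => _) = cst 0); first exact: cvg_cst.
  by apply/funext; elim=> //= n ->; rewrite /sgn_step !mul0r.
rewrite gtr0_sg//; have zb : 0 < z <= 1 by rewrite z0 (le_trans (ler_norm _)).
have H n := iter_sgn_step_bnd n zb.
apply: (@squeeze_cvgr _ _ _ _ (fun n => 1 - (1 - z / 2) ^+ n) (cst 1)).
- by near=> n; have [/andP[? ?] ?] := H n; apply/andP; split => //; lra.
- rewrite -[X in _ --> X]subr0; apply: cvgB; first exact: cvg_cst.
  apply: cvg_expr; move: zb => /andP[? ?]; rewrite ger0_norm; lra.
- exact: cvg_cst.
Unshelve. all: by end_near.
Qed.

End sign_iteration.

(** * Closure of a subspace and its multipliers *)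

Section L2_closure.
Context d (X : measurableType d) (R : realType).
Context (mu : {measure set X -> \bar R}) (D : set X) (mD : measurable D).
Implicit Types (f g h s : X -> R) (M k : R).

Local Notation sqi := (sq_integrable mu D).
Local Notation nsq := (nsq mu D).

Definition L2closure (S : set (X -> R)) : set (X -> R) :=
  [set f | sqi f /\ forall e, 0 < e ->
     exists2 s, S s & nsq (fun x => f x - s x) < e].

Context (S : set (X -> R)).
Hypothesis S_sqi : S `<=` sqi.
Hypothesis S_add : forall f g, S f -> S g -> S (fun x => f x + g x).
Hypothesis S_scale : forall k f, S f -> S (fun x => k * f x).

Local Notation cl := (L2closure S).

Lemma subset_L2closure : S `<=` cl.
Proof.
move=> s Ss; split; first exact: S_sqi.
move=> e e0; exists s => //; rewrite /nsq /ip /=.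
under eq_Rintegral do rewrite subrr mul0r.
by rewrite Rintegral_cst// mul0r.
Qed.

Lemma L2closure_add f g : cl f -> cl g -> cl (fun x => f x + g x).
Proof.
move=> [sf cf] [sg cg]; split; first exact: sq_integrableD.
(* [nsq] is a squared norm: [nsqD_le] costs a factor 2 on each of the two errors. *)
move=> e e0; have e4 : 0 < e / 4 by lra.
have [s Ss se] := cf _ e4; have [t St te] := cg _ e4.
exists (fun x => s x + t x); first exact: S_add.
have -> : (fun x => f x + g x - (s x + t x)) =
    (fun x => (f x - s x) + (g x - t x)) by apply/funext => x; ring.
have := nsqD_le mD (sq_integrableB mD sf (S_sqi Ss)) (sq_integrableB mD sg
    (S_sqi St)).
by move=> /le_lt_trans; apply; lra.
Qed.

Lemma L2closure_scale k f : cl f -> cl (fun x => k * f x).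
Proof.
move=> [sf cf]; split; first exact: sq_integrableZ.
(* The added 1 allows [k = 0] in the quotient chosen as precision. *)
move=> e e0; have k1 : 0 < k ^+ 2 + 1 by have := sqr_ge0 k; lra.
have [s Ss se] := cf _ (divr_gt0 e0 k1).
exists (fun x => k * s x); first exact: S_scale.
rewrite (_ : (fun x => _) = (fun x => k * (f x - s x))); last first.
  by apply/funext => x; ring.
rewrite nsqZ//; last by apply: sq_integrableB => //; exact: S_sqi.
move: se; rewrite ltr_pdivlMr// => se; apply: le_lt_trans se.
by have := ip_ge0 mu D (fun x => f x - s x); rewrite -/(nsq _); nra.
Qed.

Lemma L2closure_closed f : sqi f ->
  (forall e, 0 < e -> exists2 h, cl h & nsq (fun x => f x - h x) < e) -> cl f.
Proof.
move=> sf H; split => // e e0; have e4 : 0 < e / 4 by lra.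
have [h [sh ch] he] := H _ e4; have [s Ss se] := ch _ e4; exists s => //.
have -> : (fun x => f x - s x) =
    (fun x => (f x - h x) + (h x - s x)) by apply/funext => x; ring.
have := nsqD_le mD (sq_integrableB mD sf sh) (sq_integrableB mD sh (S_sqi Ss)).
by move=> /le_lt_trans; apply; lra.
Qed.

Lemma L2closure_cvg (f_ : nat -> X -> R) f G : (forall n, cl (f_ n)) ->
  sqi G -> (forall n x, D x -> `|f_ n x| <= `|G x|) ->
  (forall x, D x -> f_ n x @[n --> \oo] --> f x) -> cl f.
Proof.
move=> cf sG fG ff.
have [sf nf] := dominated_sq_integrable mD (fun n => (cf n).1.1) sG fG ff.
apply: L2closure_closed => // e e0.
have /cvgr0Pnorm_lt /(_ _ e0)[N _ /(_ N (leqnn N)) He] := nf.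
exists (f_ N); first exact: cf.
rewrite (_ : (fun x => _) = (fun x => -1 * (f_ N x - f x))); last first.
  by apply/funext => x; ring.
rewrite nsqZ//; last by apply: sq_integrableB => //; exact: (cf N).1.
by rewrite sqrrN expr1n mul1r (le_lt_trans (ler_norm _)).
Qed.

Definition multiplier g := [/\ measurable_fun D g,
  exists M : R, forall x, D x -> `|g x| <= M &
  forall h, cl h -> cl (fun x => g x * h x)].

Lemma bounded_sq_integrable g h M : measurable_fun D g ->
  (forall x, D x -> `|g x| <= M) -> sqi h -> sqi (fun x => g x * h x).
Proof.
move=> mg gM sh; apply: (sq_integrable_le mD _ (sq_integrableZ mD M sh)).
  by apply: measurable_funM => //; exact: sh.1.
move=> x Dx; rewrite !normrM ler_wpM2r//; apply: (le_trans (gM x Dx)).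
exact: ler_norm.
Qed.

(** Multiplication by a function bounded by [M] is continuous for the L^2 norm, so stability need
    only be checked on [S]. *)
Lemma multiplier_dense g M : measurable_fun D g ->
  (forall x, D x -> `|g x| <= M) ->
  (forall s, S s -> cl (fun x => g x * s x)) -> multiplier g.
Proof.
move=> mg gM gS; split => //; first by exists M.
move=> h [sh ch]; have sgh := bounded_sq_integrable mg gM sh.
apply: L2closure_closed => // e e0.
have k1 : 0 < M ^+ 2 + 1 by have := sqr_ge0 M; lra.
have [s Ss se] := ch _ (divr_gt0 e0 k1).
exists (fun x => g x * s x); first exact: gS.
rewrite (_ : (fun x => _) = (fun x => g x * (h x - s x))); last first.
  by apply/funext => x; ring.
have sd := sq_integrableB mD sh (S_sqi Ss).
apply: le_lt_trans (_ : M ^+ 2 * nsq (fun x => h x - s x) < e).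
  rewrite -nsqZ//; apply: le_nsq => //.
  - exact: bounded_sq_integrable gM _.
  - exact: sq_integrableZ.
  - move=> x Dx; rewrite !normrM ler_wpM2r//; apply: (le_trans (gM x Dx)).
    exact: ler_norm.
move: se; rewrite ltr_pdivlMr// => se; apply: le_lt_trans se.
by have := ip_ge0 mu D (fun x => h x - s x); rewrite -/(nsq _); nra.
Qed.

Lemma multiplier_cst k : multiplier (cst k).
Proof.
split => //; first by exists `|k|.
by move=> h ch; exact: L2closure_scale.
Qed.

Lemma multiplierD f g : multiplier f -> multiplier g ->
  multiplier (fun x => f x + g x).
Proof.
move=> [mf [M fM] cf] [mg [N gN] cg]; split.
- exact: measurable_funD.
- exists (M + N) => x Dx; apply: (le_trans (ler_normD _ _)).
  by apply: lerD; [exact: fM|exact: gN].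
- move=> h ch; rewrite (_ : (fun x => _) = (fun x => f x * h x + g x * h x)).
    by apply: L2closure_add; [exact: cf|exact: cg].
  by apply/funext => x; ring.
Qed.

Lemma multiplierM f g : multiplier f -> multiplier g ->
  multiplier (fun x => f x * g x).
Proof.
move=> [mf [M fM] cf] [mg [N gN] cg]; split.
- exact: measurable_funM.
- exists (M * N) => x Dx; rewrite normrM.
  by apply: ler_pM => //; [exact: fM|exact: gN].
- move=> h ch; rewrite (_ : (fun x => _) = (fun x => f x * (g x * h x))).
    by apply: cf; exact: cg.
  by apply/funext => x; ring.
Qed.

Lemma multiplierZ k g : multiplier g -> multiplier (fun x => k * g x).
Proof. by move=> mg; exact: (multiplierM (multiplier_cst k) mg). Qed.

(** For [h] in the closure, the products [g_ n * h] are dominated by [M * h] and converge pointwise,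
    hence in L^2. *)
Lemma multiplier_cvg (g_ : nat -> X -> R) g M : (forall n, multiplier (g_ n)) ->
  (forall n x, D x -> `|g_ n x| <= M) ->
  (forall x, D x -> g_ n x @[n --> \oo] --> g x) -> multiplier g.
Proof.
move=> mg gM cg.
have gleM x : D x -> `|g x| <= M.
  move=> Dx; have cn : `|g_ n x| @[n --> \oo] --> `|g x|.
    by apply: cvg_norm; exact: cg.
  rewrite -(cvg_lim _ cn)//; apply: limr_le; first by apply/cvg_ex; exists `|g x|.
  by near=> n; exact: gM.
split.
- apply: (@measurable_realfun.measurable_fun_cvg _ _ _ _ g_) => // n.
  by have [] := mg n.
- by exists M.
- move=> h ch.
  apply: (@L2closure_cvg (fun n x => g_ n x * h x) _ (fun x => M * h x)).
  + by move=> n; have [_ _] := mg n; apply.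
  + by apply: sq_integrableZ => //; exact: ch.1.
  + move=> n x Dx; rewrite !normrM ler_wpM2r//; apply: (le_trans (gM n x Dx)).
    exact: ler_norm.
  + by move=> x Dx; apply: cvgMl; exact: cg.
Unshelve. all: by end_near.
Qed.

(** Twice the indicator is sg g + (sg g)^2, and the sign is a bounded pointwise limit of polynomials
    in g once g is scaled into [-1, 1]. *)
Lemma multiplier_gt0 g : multiplier g -> multiplier \1_[set x | 0 < g x].
Proof.
move=> mg; have [_ [M0 gM0] _] := mg.
pose M : R := `|M0| + 1; have M_gt0 : 0 < M by rewrite ltr_pwDr.
have gM x : D x -> `|M^-1 * g x| <= 1.
  move=> Dx; rewrite normrM gtr0_norm ?invr_gt0// ler_pdivrMl// mulr1.
  by apply: (le_trans (gM0 x Dx)); rewrite (le_trans (ler_norm _))// lerDl.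
have ms : multiplier (fun x => Num.sg (M^-1 * g x)).
  apply: (@multiplier_cvg (fun n x => iter n (@sgn_step R) (M^-1 * g x)) _ 1).
  - elim=> [|n IH] /=; first exact: multiplierZ.
    rewrite (_ : (fun x => _) = (fun x => 2^-1 * (iter n (@sgn_step R) (M^-1 * g
        x) *
       (3 + (-1) * (iter n (@sgn_step R) (M^-1 * g x) *
       iter n (@sgn_step R) (M^-1 * g x)))))); last first.
      by apply/funext => x; rewrite /sgn_step; field.
    apply: multiplierZ; apply: multiplierM => //; apply: multiplierD.
      exact: multiplier_cst.
    by apply: multiplierZ; exact: multiplierM.
  - move=> n x Dx; wlog z0 : g gM Dx {mg gM0} / 0 < M^-1 * g x => [H|].
      have [z0|z0|z0] := ltgtP 0 (M^-1 * g x).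
      + exact: (H g).
      + have := H (fun x => - g x); rewrite mulrN iter_sgn_stepN normrN; apply
          => //.
          by move=> y Dy; rewrite mulrN normrN; exact: gM.
        by rewrite oppr_gt0.
      + rewrite -z0 (_ : iter _ _ _ = 0) ?normr0//.
        by elim: n {H} => //= n ->; rewrite /sgn_step !mul0r.
    have zb : 0 < M^-1 * g x <= 1.
      by rewrite z0 (le_trans (ler_norm _))// gM.
    have [/andP[zi i1] _] := iter_sgn_step_bnd n zb.
    by rewrite ger0_norm// (le_trans (ltW z0)).
  - by move=> x Dx; apply: cvg_iter_sgn_step; exact: gM.
rewrite (_ : \1__ = (fun x => 2^-1 * (Num.sg (M^-1 * g x) +
    Num.sg (M^-1 * g x) * Num.sg (M^-1 * g x)))).
  apply: multiplierZ; apply: multiplierD => //; exact: multiplierM.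
apply/funext => x; rewrite indicE sgrM gtr0_sg ?invr_gt0// mul1r.
have [gx|gx|gx] := sgrP (g x).
- by rewrite memNset/= ?gx ?ltxx//; ring.
- by rewrite mem_set// -[true%:R]/(1 : R); field.
- by rewrite memNset/=; [ring|apply/negP; rewrite -leNgt ltW].
Qed.

End L2_closure.

(** * From indicators to all bounded measurable multipliers *)

Section L2_multiplier_measurable.
Context d (X : measurableType d) (R : realType).
Context (mu : {measure set X -> \bar R}) (D : set X) (mD : measurable D).
Implicit Types (f g h s : X -> R) (M k : R).
Import HBSimple HBNNSimple.

Local Notation sqi := (sq_integrable mu D).
Local Notation nsq := (nsq mu D).

Context (S : set (X -> R)).
Hypothesis S_sqi : S `<=` sqi.
Hypothesis S_add : forall f g, S f -> S g -> S (fun x => f x + g x).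
Hypothesis S_scale : forall k f, S f -> S (fun x => k * f x).

Local Notation cl := (L2closure mu D S).
Local Notation multiplier := (multiplier mu D S).

Let multD := @multiplierD _ X R mu D mD S S_sqi S_add.
Let multM := @multiplierM _ X R mu D S.
Let mult_cst := @multiplier_cst _ X R mu D mD S S_sqi S_scale.
Let multZ := @multiplierZ _ X R mu D mD S S_sqi S_scale.
Let mult_cvg := @multiplier_cvg _ X R mu D mD S S_sqi.

Lemma eq_nsq f g : {in D, f =1 g} -> nsq f = nsq g.
Proof. by move=> fg; exact: eq_ip. Qed.

Lemma eq_sq_integrable f g : {in D, f =1 g} -> sqi f -> sqi g.
Proof.
move=> fg sf; apply: (sq_integrable_le mD _ sf).
  by apply: eq_measurable_fun fg _; exact: sf.1.
by move=> x Dx; rewrite fg ?inE.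
Qed.

Lemma eq_L2closure f g : {in D, f =1 g} -> cl f -> cl g.
Proof.
move=> fg [sf cf]; split; first exact: eq_sq_integrable sf.
move=> e /cf[s Ss se]; exists s => //.
by rewrite (_ : nsq _ = nsq (fun x => f x - s x))//; apply: eq_nsq => x Dx;
    rewrite fg.
Qed.

Lemma eq_multiplier f g : {in D, f =1 g} -> multiplier f -> multiplier g.
Proof.
move=> fg [mf [M fM] cf]; split.
- exact: eq_measurable_fun fg mf.
- by exists M => x Dx; rewrite -fg ?inE//; exact: fM.
- move=> h /cf; apply: eq_L2closure => x Dx; by rewrite fg.
Qed.

(** Complements come from 1 - 1_A. For unions, which need not be disjoint, the finite products of
    the 1 - 1_(F i) tend to the indicator of the complement of the union. *)
Lemma sigma_algebra_multiplier :
  sigma_algebra setT [set E : set X | multiplier \1_E].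
Proof.
split=> /=.
- by rewrite indic0; exact: mult_cst.
- move=> A mA; rewrite (_ : \1__ = (fun x => 1 + (-1) * \1_A x)).
    by apply: multD; [exact: (mult_cst 1)|exact: multZ].
  apply/funext => x; rewrite setTD indicC indicE.
  by case: (x \in A); rewrite /= ?mulr1 ?mulr0 ?addr0 ?subrr.
- move=> F mF.
  pose G n x := \prod_(i < n) (1 + (-1) * \1_(F i) x) : R.
  have G01 n x : 0 <= G n x <= 1.
    elim: n => [|n IH]; first by rewrite /G big_ord0 ler01 lexx.
    rewrite /G big_ord_recr/= -/(G n x); move: IH => /andP[G0 G1].
    rewrite indicE; case: (x \in F n); rewrite /= ?mulr1 ?mulr0 ?addr0 ?subrr.
      by rewrite ?mulr0 lexx ler01.
    by rewrite mulr1 G0.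
  have mG : multiplier \1_(~` \bigcup_k F k).
    apply: (@mult_cvg G _ 1).
    + elim=> [|n IH].
        rewrite (_ : G 0%N = cst 1); first exact: mult_cst.
        by apply/funext => x; rewrite /G big_ord0.
      rewrite (_ : G n.+1 = (fun x => G n x * (1 + (-1) * \1_(F n) x))).
        apply: multM => //; apply: multD; first exact: (mult_cst 1).
        by apply: multZ; exact: mF.
      by apply/funext => x; rewrite /G big_ord_recr.
    + by move=> n x _; have /andP[? ?] := G01 n x; rewrite ger0_norm.
    + move=> x _; have [[k _ Fk]|nF] := pselect ((\bigcup_k F k) x).
        rewrite indicE memNset/=; last by apply; exists k.
        apply: cvg_near_cst; exists k.+1 => // n /= kn.
        by rewrite /G (bigD1 (Ordinal kn))//= indicE mem_set//= mulr1 subrr mul0r.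
      rewrite indicE mem_set//; apply: cvg_near_cst; apply: nearW => n.
      rewrite /G big1// => i _; rewrite indicE memNset/= ?mulr0 ?addr0// => Fi.
      by apply: nF; exists i.
  rewrite (_ : \1__ = (fun x => 1 + (-1) * \1_(~` \bigcup_k F k) x)).
    by apply: multD; [exact: (mult_cst 1)|exact: multZ].
  apply/funext => x; rewrite indicC indicE.
  by case: (x \in _); rewrite /= ?mulr1 ?mulr0 ?addr0 ?subrr.
Qed.

Hypothesis multiplier_indic : forall E, measurable E -> multiplier \1_E.

Lemma multiplier_fimfun (g : {sfun X >-> R}) : multiplier g.
Proof.
rewrite (_ : (g : X -> R) = (fun x => \sum_(y <- finmap.enum_fset (fset_set
    (range g)))
    y * \1_(g @^-1` [set y]) x)); last first.
  by apply/funext => x; rewrite fimfunE fsbig_finite.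
elim: finmap.enum_fset => [|y s IH].
  rewrite (_ : (fun _ => _) = cst 0); first exact: mult_cst.
  by apply/funext => x; rewrite big_nil.
rewrite (_ : (fun _ => _) = (fun x => y * \1_(g @^-1` [set y]) x +
    \sum_(z <- s) z * \1_(g @^-1` [set z]) x)).
  by apply: multD => //; apply: multZ; exact: multiplier_indic.
by apply/funext => x; rewrite big_cons.
Qed.

Lemma multiplier_bounded g M : measurable_fun D g ->
  (forall x, D x -> `|g x| <= M) -> multiplier g.
Proof.
move=> mg gM.
(* The shift makes the function nonnegative, as needed for the increasing approximation by simple
   functions; it is undone by a constant multiplier. *)
pose f x := (g x + M)%:E.
have mf : measurable_fun D f by apply/measurable_EFinP; exact: measurable_funD.
have f0 x : D x -> (0 <= f x)%E.
  by move=> Dx; rewrite lee_fin; have := gM x Dx; rewrite ler_norml => /andP[?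
      ?]; lra.
have [s [nds cs]] := approximation mD mf f0.
have cs' x : D x -> s n x @[n --> \oo] --> g x + M.
  by move=> Dx; have /fine_cvgP[_] := cs x Dx.
have mh : multiplier (fun x => g x + M).
  apply: (@mult_cvg (fun n => s n) _ (2 * M)) => //.
  - by move=> n; exact: multiplier_fimfun.
  - move=> n x Dx; rewrite ger0_norm//.
    have : s n x <= g x + M.
      rewrite -(cvg_lim _ (cs' x Dx))//; apply: nondecreasing_cvgn_le.
        by move=> i j ij; move/lefP : (nds _ _ ij); apply.
      by apply/cvg_ex; exists (g x + M); exact: cs'.
    by have := gM x Dx; rewrite ler_norml => /andP[? ?]; lra.
rewrite (_ : g = (fun x => g x + M + cst (- M) x)).
  by apply: multD => //; exact: mult_cst.
by apply/funext => x /=; rewrite addrK.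
Qed.

(* [w * clamp (h / w)] converges to [h] and is dominated by [h]. *)
Lemma L2closure_full w : cl w -> (forall x, D x -> 0 < w x) ->
  forall h, sqi h -> cl h.
Proof.
move=> cw w0 h sh; have mw := cw.1.1; have mh := sh.1.
(* The quotient h / w truncated to [-n, n]. On [D] the power is the inverse of [w x] (see [wV]), and
   in this form it is measurable because [powR] is. *)
pose b n x : R := Num.max (- n%:R) (Num.min n%:R (h x * w x `^ (-1))).
have bn n x : `|b n x| <= n%:R.
  rewrite ler_norml /b le_max lexx/= ge_max ge_min lexx/= andbT.
  by rewrite -subr_ge0 opprK addr_ge0.
have mb n : measurable_fun D (b n).
  apply: measurable_maxr => //; apply: measurable_minr => //.
  apply: measurable_funM => //.
  by apply: (measurableT_comp (measurable_powR _) mw).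
have wV x : D x -> w x `^ (-1) = (w x)^-1.
  by move=> Dx; rewrite powRN powRr1// ltW// w0.
apply: (@L2closure_cvg _ X R mu D mD S S_sqi (fun n x => b n x * w x) _ h) => //.
- move=> n; have [_ _ H] := multiplier_bounded (mb n) (fun x _ => bn n x).
  exact: H.
- move=> n x Dx; have wx := w0 x Dx.
  rewrite normrM (gtr0_norm wx) -ler_pdivlMr//.
  rewrite -[X in _ / X](gtr0_norm wx) -normf_div /b wV//.
  have := ler0n R n; set q := h x / w x; set N := n%:R => N0.
  rewrite /Num.max /Num.min; case: ifPn; case: ifPn; rewrite -?leNgt => H1 H2;
    by rewrite ler_norml; have := ler_norm q; have := ler_norm (- q);
       rewrite normrN => ? ?; apply/andP; split; lra.
- move=> x Dx; have wx := w0 x Dx.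
  apply: cvg_near_cst; exists (Num.bound `|h x / w x|) => // n /= hn.
  have : `|h x / w x| <= n%:R.
    rewrite ltW// (lt_le_trans (archi_boundP _))//.
    by rewrite ler_nat.
  rewrite ler_norml /b wV// => /andP[? ?].
  by rewrite min_r// max_r// divfK// gt_eqF.
Qed.

End L2_multiplier_measurable.

(** * Smooth functions of product form *)

Section smooth1.
Context (R : realType).
Implicit Types f g h : R -> R.

(* Coinductive formulation: [f] belongs to a class of differentiable functions
   stable under derivation. *)
Definition smooth1 f := exists2 K : set (R -> R), K f &
  forall g, K g -> (forall x, derivable g x 1) /\ K (derive1 g).

(** The ring generated by [G] and the constants. It serves as the class [K] in [smooth1]. *)
Inductive ring_gen (G : set (R -> R)) : set (R -> R) :=
| ring_gen_in g of G g : ring_gen G g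
| ring_gen_cst k : ring_gen G (cst k)
| ring_gen_add f g of ring_gen G f & ring_gen G g :
    ring_gen G (fun x => f x + g x)
| ring_gen_mul f g of ring_gen G f & ring_gen G g :
    ring_gen G (fun x => f x * g x).

Lemma smooth1_derivable f x : smooth1 f -> derivable f x 1.
Proof. by move=> [K Kf /(_ f Kf)[]]. Qed.

Lemma smooth1_derive1 f : smooth1 f -> smooth1 (derive1 f).
Proof. by move=> [K Kf HK]; exists K => //; have [] := HK f Kf. Qed.

(** By the Leibniz rule, the ring is stable under derivation as soon as the derivatives of its
    generators lie in it. *)
Lemma ring_gen_smooth1 (G : set (R -> R)) :
  (forall g, G g -> (forall x, derivable g x 1) /\ ring_gen G (derive1 g)) ->
  ring_gen G `<=` smooth1.
Proof.
move=> HG f Gf; exists (ring_gen G) => // {f Gf} f.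
elim=> {f} [g /HG//|k|f g _ [df Gf'] _ [dg Gg']|f g Gf [df Gf'] Gg [dg Gg']].
- split; first by move=> x; exact: derivable_cst.
  rewrite (_ : derive1 _ = cst (0 : R)); first exact: ring_gen_cst.
  by apply/funext => x; rewrite derive1E derive_cst.
- split; first by move=> x; exact: derivableD.
  rewrite (_ : derive1 _ = (fun x => (derive1 f) x + (derive1 g) x)); first
      exact: ring_gen_add.
  by apply/funext => x; rewrite !derive1E -deriveD.
- split; first by move=> x; exact: derivableM.
  rewrite (_ : derive1 _ = (fun x => f x * (derive1 g) x + g x * (derive1 f) x)).
    by apply: ring_gen_add; exact: ring_gen_mul.
  by apply/funext => x; rewrite !derive1E deriveM.
Qed.

Let ring_gen_smooth1_sub : ring_gen smooth1 `<=` smooth1.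
Proof.
apply: ring_gen_smooth1 => g sg; split; last by apply: ring_gen_in; exact:
    smooth1_derive1.
by move=> x; exact: smooth1_derivable.
Qed.

Lemma smooth1_cst k : smooth1 (cst k).
Proof. by apply: ring_gen_smooth1_sub; exact: ring_gen_cst. Qed.

Lemma smooth1D f g : smooth1 f -> smooth1 g -> smooth1 (fun x => f x + g x).
Proof.
by move=> sf sg; apply: ring_gen_smooth1_sub; apply: ring_gen_add; exact:
    ring_gen_in.
Qed.

Lemma smooth1M f g : smooth1 f -> smooth1 g -> smooth1 (fun x => f x * g x).
Proof.
by move=> sf sg; apply: ring_gen_smooth1_sub; apply: ring_gen_mul; exact:
    ring_gen_in.
Qed.

Lemma smooth1_id : smooth1 id.
Proof.
apply: (@ring_gen_smooth1 [set id]); last exact: ring_gen_in.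
move=> _ ->; split; first by move=> x; exact: derivable_id.
rewrite (_ : derive1 _ = cst (1 : R)); first exact: ring_gen_cst.
by apply/funext => x; rewrite derive1E derive_id.
Qed.

Lemma smooth1_affine a b : smooth1 (fun x => a * x + b).
Proof.
apply: smooth1D; last exact: smooth1_cst.
by apply: smooth1M; [exact: smooth1_cst|exact: smooth1_id].
Qed.

Lemma smooth1_comp f g : smooth1 f -> smooth1 g -> smooth1 (f \o g).
Proof.
(* Compositions alone are not stable: (v o g)' is the product of v' o g with the smooth function g',
   so both kinds of generators are taken. *)
move=> sf sg; pose G := [set u | smooth1 u \/ exists2 v, smooth1 v & u = v \o g].
apply: (@ring_gen_smooth1 G); last by apply: ring_gen_in; right; exists f.
move=> u [su|[v sv ->]].
  split; first by move=> x; exact: smooth1_derivable.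
  by apply: ring_gen_in; left; exact: smooth1_derive1.
split.
  by move=> x; apply: ex_derive; apply: is_derive1_comp; apply: derivableP;
    exact: smooth1_derivable.
rewrite (_ : derive1 _ = (fun x => ((derive1 v) \o g) x * (derive1 g) x)); last
    first.
  by apply/funext => x; rewrite derive1_comp//; exact: smooth1_derivable.
apply: ring_gen_mul; apply: ring_gen_in; last by left; exact: smooth1_derive1.
by right; exists (derive1 v) => //; exact: smooth1_derive1.
Qed.

Lemma smooth1_sin_cos : smooth1 sin /\ smooth1 cos.
Proof.
pose G : set (R -> R) := [set u | u = sin \/ u = cos].
have GG g : G g -> (forall x, derivable g x 1) /\ ring_gen G (derive1 g).
  move=> [->|->]; split.
  - by move=> x; exact: derivable_sin.
  - rewrite (_ : derive1 _ = cos); first by apply: ring_gen_in; right.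
    by apply/funext => x; rewrite derive1E derive_val.
  - by move=> x; exact: derivable_cos.
  - rewrite (_ : derive1 _ = (fun x => cst (-1) x * sin x)).
      apply: ring_gen_mul; first exact: ring_gen_cst.
      by apply: ring_gen_in; left.
    by apply/funext => x; rewrite derive1E derive_val mulN1r.
by split; apply: (ring_gen_smooth1 GG); apply: ring_gen_in; [left|right].
Qed.

(* The functions P(1/x) exp(-1/x) for x > 0, extended by 0, form a class stable
   under derivation. *)
Definition flat (P : {poly R}) (x : R) : R :=
  if 0 < x then P.[x^-1] * expR (- x^-1) else 0.

(** Exponential decay beats every polynomial. In the induction on P a factor X is moved into the
    power, so [k] must vary; the constant term uses y^n / n! <= exp y. *)
Lemma flat_bound P k : exists C : R, forall y : R, 1 <= y ->
  `|P.[y] * y ^+ k * expR (- y)| <= C / y.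
Proof.
elim/poly_ind: P k => [|P c IH] k.
  by exists 0 => y _; rewrite horner0 !mul0r normr0.
have [C HC] := IH k.+1; exists (C + `|c| * (k.+1)`!%:R) => y y1.
have y0 : 0 < y by lra.
rewrite hornerMXaddC !mulrDl; apply: (le_trans (ler_normD _ _)); apply: lerD.
  by rewrite -(mulrA P.[y]) -exprS; exact: HC.
rewrite -mulrA normrM -mulrA ler_wpM2l//.
rewrite ger0_norm; last first.
  by rewrite mulr_ge0 ?expR_ge0// exprn_ge0// ltW.
rewrite expRN ler_pdivlMr// mulrAC -exprSr ler_pdivrMr ?expR_gt0//.
have := expR_ge1Dxn k (ltW y0) => /(le_trans _)-/(_ (y ^+ k.+1 / (k.+1)`!%:R)).
rewrite lerDr ler01 => /(_ isT); rewrite ler_pdivrMr ?ltr0n ?fact_gt0//.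
by rewrite mulrC.
Qed.

Lemma is_derive_flat (P : {poly R}) (x : R) :
  is_derive x (1 : R) (flat P) (flat ('X^2 * (P - P^`())) x).
Proof.
have [x0|x0|<-] := ltgtP 0 x.
- apply: (@near_eq_is_derive R R R (fun y : R => P.[y^-1] * expR (- y^-1))).
    near=> y; rewrite /flat ifT//; near: y; exact: lt_nbhsr.
  have xn0 : x != 0 by rewrite gt_eqF.
  have dV : is_derive x 1 (fun y : R => y^-1) (- x ^- 2).
    apply: is_derive_eq; first by apply: is_deriveV => //; exact: xn0.
    by rewrite /= scaler1.
  have dP : is_derive x 1 (fun y => P.[y^-1]) (P^`().[x^-1] * - x ^- 2).
    by apply: is_derive1_comp; exact: is_derive_poly.
  have dE : is_derive x 1 (fun y => expR (- y^-1)) (expR (- x^-1) * x ^- 2).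
    rewrite -[x ^- 2]opprK; apply: (@is_derive1_comp _ expR (fun y => - y^-1)).
  apply: (is_derive_eq (is_deriveM dP dE)).
  rewrite /flat x0 !hornerE/= -!exprVn /GRing.scale/=; ring.
- rewrite /flat ltNge (ltW x0)/=.
  apply: (@near_eq_is_derive R R R (cst 0)).
  by near=> y; rewrite ltNge ltW//; near: y; exact: lt_nbhsl.
(* At 0 the difference quotient for h > 0 is P(y) y exp(-y) with y = 1 / h, hence at most C h in
   absolute value. *)
- have [C HC] := flat_bound P 1.
  have H : h^-1 *: ((flat P \o shift 0) (h *: 1) - flat P 0) @[h --> 0^'] --> (0
      : R).
    apply/cvgr0Pnorm_lt => e e0.
    have C1 : 0 < `|C| + 1 by rewrite ltr_wpDl.
    near=> h.
    have h1 : `|h| < 1.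
      by near: h; apply: dnbhs0_lt.
    have he : `|h| < e / (`|C| + 1).
      by near: h; apply: dnbhs0_lt; exact: divr_gt0.
    rewrite /= addr0 /GRing.scale/= mulr1 /flat ltxx subr0.
    case: ifPn => h0; last by rewrite mulr0 normr0.
    move: h1 he; rewrite gtr0_norm// => h1 he.
    rewrite mulrC mulrAC; apply: (@le_lt_trans _ _ (C * h)).
      have := HC h^-1; rewrite invrK expr1; apply.
      by rewrite -invr1 lef_pV2 ?posrE// ltW.
    move: he; rewrite ltr_pdivlMr//; apply: le_lt_trans.
    rewrite mulrC ler_wpM2l//; first exact: ltW.
    by apply: (le_trans (ler_norm _)); rewrite lerDl.
  apply: DeriveDef; first by apply/cvg_ex; exists 0.
  rewrite /flat ltxx; exact: cvg_lim H.
Unshelve. all: by end_near.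
Qed.
End smooth1.

(** * Smooth cutoff functions *)

Section cutoff.
Context (R : realType).
Implicit Types f g h : R -> R.

Lemma smooth1_flat (P : {poly R}) : smooth1 (flat P).
Proof.
exists (range (@flat R)); first by exists P.
move=> _ [Q _ <-]; split; first by move=> x; have [] := is_derive_flat Q x.
exists ('X^2 * (Q - Q^`())) => //; apply/funext => x.
by rewrite derive1E (@derive_val _ _ _ _ _ _ _ (is_derive_flat Q x)).
Qed.

Definition expinv : R -> R := flat 1.

Lemma smooth1_expinv_affine a b : smooth1 (fun x => expinv (a * x + b)).
Proof. exact: (smooth1_comp (smooth1_flat 1) (smooth1_affine a b)). Qed.

Lemma expinv_le0 x : x <= 0 -> expinv x = 0.
Proof. by move=> x0; rewrite /expinv /flat ltNge x0. Qed.

Lemma expinv_gt0 x : 0 < x -> 0 < expinv x.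
Proof. by move=> x0; rewrite /expinv /flat x0 hornerC mul1r expR_gt0. Qed.

Lemma expinv_ge1 x : 1 <= x -> expinv 1 <= expinv x.
Proof.
move=> x1; have x0 : 0 < x by lra.
rewrite /expinv /flat x0 ltr01 !hornerC !mul1r ler_expR lerN2.
by rewrite lef_pV2 ?posrE.
Qed.

(** A smooth step with constant denominators only, so that sums, products and composition give its
    smoothness. The inner quotient is at least 1 for x <= 0 and is 0 for x >= 1. *)
Definition smooth_step x := expinv (1 - expinv (1 - x) / expinv 1) / expinv 1.

Lemma smooth1_step_affine a b : smooth1 (fun x => smooth_step (a * x + b)).
Proof.
have e1 := expinv_gt0 ltr01.
rewrite (_ : (fun x => _) = (fun x => cst (expinv 1)^-1 x *
    (expinv \o (fun x => - (expinv 1)^-1 * expinv (- a * x + (1 - b)) + 1)) x)).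
  apply: smooth1M; first exact: smooth1_cst.
  apply: smooth1_comp; first exact: smooth1_flat.
  apply: smooth1D; last exact: smooth1_cst.
  by apply: smooth1M; [exact: smooth1_cst|exact: smooth1_expinv_affine].
apply/funext => x /=; rewrite /smooth_step mulrC; congr (_ * expinv _).
rewrite (_ : - a * x + (1 - b) = 1 - (a * x + b)); last by ring.
by rewrite mulNr [LHS]addrC [X in - X + _]mulrC.
Qed.

Lemma smooth_step_le0 x : x <= 0 -> smooth_step x = 0.
Proof.
move=> x0; rewrite /smooth_step expinv_le0 ?mul0r// subr_le0.
rewrite ler_pdivlMr ?mul1r; last exact: expinv_gt0.
by apply: expinv_ge1; lra.
Qed.

Lemma smooth_step_ge1 x : 1 <= x -> smooth_step x = 1.
Proof.
move=> x1; rewrite /smooth_step (expinv_le0 (_ : 1 - x <= 0)) ?subr_le0//.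
by rewrite mul0r subr0 divff// gt_eqF// expinv_gt0.
Qed.

Lemma exists_cutoff (l : R) : exists chi : R -> R, [/\ smooth1 chi,
  forall x, 0 <= x <= l -> chi x = 1 &
  forall x, chi x != 0 -> -1 <= x <= l + 1].
Proof.
exists (fun x => smooth_step (1 * x + 1) * smooth_step (-1 * x + (l + 1))); split.
- by apply: smooth1M; exact: smooth1_step_affine.
- by move=> x /andP[x0 xl]; rewrite !smooth_step_ge1 ?mulr1//; lra.
- move=> x; rewrite mulf_eq0 negb_or => /andP[sx sy]; apply/andP; split.
    by apply: contraNT sx; rewrite -ltNge => ?; rewrite smooth_step_le0//; lra.
  by apply: contraNT sy; rewrite -ltNge => ?; rewrite smooth_step_le0//; lra.
Qed.

End cutoff.

(** * Products of one-variable functions *)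

Section product_functions.
Context (R : realType) (n : nat).
Implicit Types (h : 'I_n -> R -> R) (x : 'rV[R]_n).

(** Along the line through x in direction i, the difference quotients of [f] and of [phi] are the
    same function of t. *)
Lemma derive_line (f : 'rV[R]_n -> R) (phi : R -> R) x i :
  (forall t, f (t *: delta_mx ord0 i + x) = phi (t + x ord0 i)) ->
  (derivable f x (delta_mx ord0 i) <-> derivable phi (x ord0 i) 1) /\
  partial i f x = derive1 phi (x ord0 i).
Proof.
move=> fphi.
have fx : f x = phi (x ord0 i).
  by have := fphi 0; rewrite scale0r !add0r.
have E : (fun t : R => t^-1 *: ((f \o shift x) (t *: delta_mx ord0 i) - f x)) =
    (fun t : R => t^-1 *: ((phi \o shift (x ord0 i)) (t *: 1) - phi (x ord0 i))).
  by apply/funext => t; rewrite /= fphi fx /GRing.scale/= mulr1.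
split; first by rewrite /derivable E.
by rewrite /partial derive1E /derive E.
Qed.

Lemma derive1_scale (C : R) (f : R -> R) (x : R) : derivable f x 1 ->
  derivable (fun s => C * f s) x 1 /\
  derive1 (fun s => C * f s) x = C * derive1 f x.
Proof.
move=> df; have dc : derivable (cst C : R -> R) x 1 by exact: derivable_cst.
split; first exact: (derivableM dc df).
rewrite !derive1E (_ : (fun s => C * f s) = (fun s => cst C s * f s))//.
by rewrite (deriveM dc df) derive_cst scaler0 addr0.
Qed.

Definition prodf h x : R := \prod_(k < n) h k (x ord0 k).

Definition derive_factor i h : 'I_n -> R -> R :=
  fun k => if k == i then derive1 (h i) else h k.

Lemma derive_prodf h x i : derivable (h i) (x ord0 i) 1 ->
  derivable (prodf h) x (delta_mx ord0 i) /\
  partial i (prodf h) x = prodf (derive_factor i h) x.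
Proof.
move=> dh; pose C := \prod_(k < n | k != i) h k (x ord0 k).
have [dC eC] := derive1_scale C dh.
have [t|d1 d2] := @derive_line (prodf h) (fun s => C * h i s) x i.
  rewrite /prodf (bigD1 i)//= !mxE !eqxx mulr1 mulrC; congr (_ * _).
  by apply: eq_bigr => k ki; rewrite !mxE (negbTE ki) andbF mulr0 add0r.
split; first exact/d1.
rewrite d2 eC.
rewrite /prodf (bigD1 i)//= {1}/derive_factor eqxx mulrC; congr (_ * _).
by apply: eq_bigr => k ki; rewrite /derive_factor (negbTE ki).
Qed.

Lemma continuous_coord (f : R -> R) (k : 'I_n) :
  continuous f -> continuous (fun x : 'rV[R]_n => f (x ord0 k)).
Proof.
move=> cf x; apply: (@continuous_comp 'rV[R]_n R R (fun x => x ord0 k) f).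
  exact: coord_continuous.
exact: cf.
Qed.

Lemma continuous_prodf h : (forall k, continuous (h k)) -> continuous (prodf h).
Proof.
move=> ch; rewrite /prodf; elim: (index_enum _) => [|k s IH].
  rewrite (_ : (fun _ => _) = cst (1 : R)); first exact: cst_continuous.
  by apply/funext => x; rewrite big_nil.
rewrite (_ : (fun _ => _) = (fun x => h k (x ord0 k) * \prod_(k <- s) h k (x
    ord0 k))).
  by move=> x; apply: continuousM; [exact: continuous_coord|exact: IH].
by apply/funext => x; rewrite big_cons.
Qed.

Lemma smooth1_continuous (f : R -> R) : smooth1 f -> continuous f.
Proof.
move=> sf x; apply: differentiable_continuous; apply/derivable1_diffP.
exact: smooth1_derivable.
Qed.

(** A partial derivative of a product with smooth factors is again such a product, with one factor
    differentiated; so all iterated partials have this form. *)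
Lemma smooth_prodf h : (forall k, smooth1 (h k)) -> smooth (prodf h).
Proof.
move=> sh s.
have [h' sh' ->] : exists2 h', (forall k, smooth1 (h' k)) &
    iter_partial s (prodf h) = prodf h'.
  elim: s => [|i s [h' sh' IH]] /=; first by exists h.
  exists (derive_factor i h').
    by move=> k; rewrite /derive_factor; case: ifP => // _; exact: smooth1_derive1.
  rewrite IH; apply/funext => x; apply: (derive_prodf _).2.
  exact: smooth1_derivable.
split; first by apply: continuous_prodf => k; exact: smooth1_continuous.
by move=> i x; apply: (derive_prodf _).1; exact: smooth1_derivable.
Qed.

Lemma compact_box (a b : 'I_n -> R) :
  compact [set x : 'rV[R]_n | forall k, a k <= x ord0 k <= b k].
Proof.
have := @rV_compact R n (fun k => `[a k, b k]%classic) (fun k =>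
    @segment_compact R _ _).
by congr compact; apply/seteqP; split=> x /= H k; have := H k; rewrite /= in_itv/=.
Qed.

Lemma closed_box (a b : 'I_n -> R) :
  closed [set x : 'rV[R]_n | forall k, a k <= x ord0 k <= b k].
Proof. by apply: compact_closed; [exact: norm_hausdorff|exact: compact_box]. Qed.

Lemma tsupport_prodf h (a b : 'I_n -> R) :
  (forall k s, h k s != 0 -> a k <= s <= b k) ->
  tsupport (prodf h) `<=` [set x | forall k, a k <= x ord0 k <= b k].
Proof.
move=> hab; rewrite /tsupport.
rewrite [X in _ `<=` X](closure_id _).1; last exact: closed_box.
apply: closure_subset => x /= px k; apply: hab.
by apply: contraNN px => hk; rewrite /prodf (bigD1 k)//= (eqP hk) mul0r.
Qed.

Lemma test_fun_prodf h (a b : 'I_n -> R) (U : set 'rV[R]_n) :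
  (forall k, smooth1 (h k)) ->
  (forall k s, h k s != 0 -> a k <= s <= b k) ->
  [set x : 'rV[R]_n | forall k, a k <= x ord0 k <= b k] `<=` U ->
  test_fun U (prodf h).
Proof.
move=> sh hab abU; split; first exact: smooth_prodf.
  apply: (subclosed_compact _ (@compact_box a b)); first exact: closed_closure.
  exact: tsupport_prodf.
by apply: subset_trans abU; exact: tsupport_prodf.
Qed.

End product_functions.

(** * Integration by parts on boxes *)

Section rV_topology.
Context (R : realType) (n : nat).

Lemma continuous_rV (T : topologicalType) (g : T -> 'rV[R]_n) :
  (forall i, continuous (fun t => g t ord0 i)) -> continuous g.
Proof.
move=> cg t A [P nP PA].
have : \forall s \near t, forall i, P ord0 i (g s ord0 i).
  by apply: filter_forall => i; exact: (cg i t _ (nP ord0 i)).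
apply: filterS => s Ps; apply: PA => /= i j; rewrite ord1; exact: Ps.
Qed.

(** The sigma-algebra is generated by the coordinates and not by the topology; an open set is the
    countable union of the rational boxes that it contains. *)
Lemma open_measurable_rV (U : set 'rV[R]_n) : open U -> measurable U.
Proof.
move=> oU; pose box (q : 'rV[(rat * rat)%type]_n) := [set x : 'rV[R]_n |
  forall i, [set` `]ratr (q ord0 i).1, ratr (q ord0 i).2[] (x ord0 i)].
(* Integers that encode no box, or a box not contained in [U], contribute the empty set. *)
pose F m := if unpickle m is Some q then
  (if `[< box q `<=` U >] then box q else set0) else set0.
suff -> : U = \bigcup_m F m.
  apply: bigcup_measurable => m _; rewrite /F.
  case: unpickle => // q; case: ifPn => // _.
  exact: (measurable_rV_box
    (A := fun i => [set` `]ratr (q ord0 i).1, ratr (q ord0 i).2[])).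
apply/seteqP; split=> [x Ux|x [m _]]; last first.
  by rewrite /F; case: unpickle => // q; case: ifPn => // /asboolP; apply.
have [P nP PU] : nbhs x U by exact: open_nbhs_nbhs.
have H i : exists q : rat * rat, ratr q.1 < x ord0 i < ratr q.2 /\
    [set` `]ratr q.1, ratr q.2[%R] `<=` P ord0 i.
  have /nbhs_ballP[e /= e0 eP] := nP ord0 i.
  have /rat_in_itvoo[q1] : x ord0 i - e < x ord0 i by rewrite ltrBlDr ltrDl.
  rewrite in_itv/= => /andP[q1a q1b].
  have /rat_in_itvoo[q2] : x ord0 i < x ord0 i + e by rewrite ltrDl.
  rewrite in_itv/= => /andP[q2a q2b].
  exists (q1, q2); split; first by rewrite q1b q2a.
  move=> y /=; rewrite in_itv/= => /andP[y1 y2]; apply: eP.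
  rewrite /ball/= ltr_norml; apply/andP; split; lra.
have [q Hq] := choice H.
exists (pickle (\row_i q i)) => //; rewrite /F pickleK ifT.
  by move=> i; rewrite /= in_itv/= mxE; exact: (Hq i).1.
apply/asboolP => y boxy; apply: PU => i j; rewrite ord1.
by apply: (Hq j).2; have := boxy j; rewrite mxE.
Qed.

Lemma continuous_measurable_rV (f : 'rV[R]_n -> R) :
  continuous f -> measurable_fun [set: 'rV[R]_n] f.
Proof.
move=> cf; apply: (measurability _ (RGenOInfty.measurableE R)).
move=> /= _ [_ [a ->] <-]; rewrite setTI; apply: open_measurable_rV.
by move/continuousP : cf; apply; exact: interval_open.
Qed.

Definition box (l : 'I_n -> R) := [set x : 'rV[R]_n | forall k, 0 < x ord0 k < l k].

Lemma measurable_box l : measurable (box l).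
Proof.
have := measurable_rV_box (fun i => (measurable_itv `]0, l i[ : measurable [set`
    _])).
by congr measurable; apply/seteqP; split=> x /= H k; have := H k; rewrite in_itv.
Qed.

Lemma lebesgue_box_fin l : (lebesgue_rV R n (box l) < +oo)%E.
Proof.
rewrite (_ : box l = [set x : 'rV[R]_n | forall i, `]0, l i[%classic (x ord0 i)]).
  rewrite (@lebesgue_rV_box R n (fun i => `]0, l i[%classic))//.
  rewrite (eq_bigr (fun i => (if 0 < l i then l i else 0)%:E)) ?prodEFin ?ltry//.
  move=> i _; rewrite lebesgue_measure_itv/= lte_fin; case: ifPn => // _.
  by rewrite oppr0 addr0.
by apply/seteqP; split=> x /= H k; have := H k; rewrite /= in_itv.
Qed.

Lemma continuous_bounded_box l (f : 'rV[R]_n -> R) : continuous f ->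
  exists M : R, forall x, box l x -> `|f x| <= M.
Proof.
move=> cf.
have cK := @compact_box R n (fun=> 0) l.
have /compact_bounded[M [_ HM]] := continuous_compact (continuous_subspaceT cf) cK.
exists (M + 1) => x lx; apply: (HM (M + 1)); first by rewrite ltrDl.
by exists x => // k; have /andP[? ?] := lx k; rewrite !ltW.
Qed.

Lemma continuous_integrable_box l (f : 'rV[R]_n -> R) : continuous f ->
  (lebesgue_rV R n).-integrable (box l) (EFin \o f).
Proof.
move=> cf; apply: measurable_bounded_integrable.
- exact: measurable_box.
- exact: lebesgue_box_fin.
- by apply: measurable_funTS; exact: continuous_measurable_rV.
- have [M HM] := continuous_bounded_box l cf.
  by exists M; split => [|N MN]; [exact: num_real|move=> x lx /=; rewrite
      (le_trans (HM x lx))// ltW].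
Qed.

Lemma continuous_sq_integrable l (f : 'rV[R]_n -> R) : continuous f ->
  sq_integrable (lebesgue_rV R n) (box l) f.
Proof.
move=> cf; split; first by apply: measurable_funTS; exact: continuous_measurable_rV.
apply: continuous_integrable_box => x; apply: (@continuous_comp _ _ _ f (fun y
    => y ^+ 2)).
  exact: cf.
exact: exprn_continuous.
Qed.

End rV_topology.

Section integration_by_parts.
Context (R : realType).

Lemma rV_cons_shift0 n t s (y : 'rV[R]_n) :
  t *: delta_mx ord0 ord0 + rV_cons (s, y) = rV_cons (t + s, y).
Proof.
apply/rowP => k; rewrite !mxE; case: unliftP => [j ->|->] /=.
  by rewrite mulr0 add0r.
by rewrite mulr1.
Qed.

Lemma rV_cons_shift n t (j : 'I_n) s (y : 'rV[R]_n) :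
  t *: delta_mx ord0 (lift ord0 j) + rV_cons (s, y) =
  rV_cons (s, t *: delta_mx ord0 j + y).
Proof.
apply/rowP => k; rewrite !mxE; case: unliftP => [i ->|->] /=.
  by rewrite !mxE (inj_eq lift_inj).
by rewrite mulr0 add0r.
Qed.

Lemma rV_cons0 n s (y : 'rV[R]_n) : rV_cons (s, y) ord0 ord0 = s.
Proof. by rewrite mxE unlift_none. Qed.

Lemma rV_consS n s (y : 'rV[R]_n) j : rV_cons (s, y) ord0 (lift ord0 j) = y ord0 j.
Proof. by rewrite mxE liftK. Qed.

Lemma continuous_rV_cons1 n (y : 'rV[R]_n) :
  continuous (fun t : R => rV_cons (t, y) : 'rV[R]_n.+1).
Proof.
apply: continuous_rV => i.
have [j ->|->] := unliftP ord0 i.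
  by under eq_fun do rewrite rV_consS; exact: cst_continuous.
by under eq_fun do rewrite rV_cons0; move=> x; exact: cvg_id.
Qed.

Lemma continuous_rV_cons2 n (t : R) :
  continuous (fun y : 'rV[R]_n => rV_cons (t, y) : 'rV[R]_n.+1).
Proof.
apply: continuous_rV => i.
have [j ->|->] := unliftP ord0 i.
  by under eq_fun do rewrite rV_consS; exact: coord_continuous.
by under eq_fun do rewrite rV_cons0; exact: cst_continuous.
Qed.

Lemma box_rV_cons n (l : 'I_n.+1 -> R) s (y : 'rV[R]_n) :
  box l (rV_cons (s, y)) <-> 0 < s < l ord0 /\ box (l \o lift ord0) y.
Proof.
split=> [H|[H1 H2] k]; last first.
  by have [j ->|->] := unliftP ord0 k; rewrite ?rV_consS ?rV_cons0.
by split=> [|j]; [have := H ord0; rewrite rV_cons0|have := H (lift ord0 j);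
    rewrite rV_consS].
Qed.

Lemma derive_slice0 n (H : 'rV[R]_n.+1 -> R) s (y : 'rV[R]_n) :
  (derivable H (rV_cons (s, y)) (delta_mx ord0 ord0) <->
   derivable (fun t => H (rV_cons (t, y))) s 1) /\
  partial ord0 H (rV_cons (s, y)) = derive1 (fun t => H (rV_cons (t, y))) s.
Proof.
have := @derive_line R _ H (fun t => H (rV_cons (t, y))) (rV_cons (s, y)) ord0.
by rewrite rV_cons0; apply => t; rewrite rV_cons_shift0.
Qed.

Lemma derive_slice n (H : 'rV[R]_n.+1 -> R) s (y : 'rV[R]_n) j :
  (derivable H (rV_cons (s, y)) (delta_mx ord0 (lift ord0 j)) <->
   derivable (fun z => H (rV_cons (s, z))) y (delta_mx ord0 j)) /\
  partial (lift ord0 j) H (rV_cons (s, y)) = partial j (fun z => H (rV_cons (s,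
      z))) y.
Proof.
have E : (fun t : R => t^-1 *: ((H \o shift (rV_cons (s, y))) (t *: delta_mx
    ord0 (lift ord0 j)) -
    H (rV_cons (s, y)))) =
  (fun t : R => t^-1 *: (((fun z => H (rV_cons (s, z))) \o shift y)
    (t *: delta_mx ord0 j) - H (rV_cons (s, y)))).
  by apply/funext => t /=; rewrite rV_cons_shift.
split; first by rewrite /derivable E.
by rewrite /partial /derive E.
Qed.

Lemma integral_derive1_eq0 (phi : R -> R) (l : R) : 0 < l ->
  (forall x, derivable phi x 1) -> continuous (derive1 phi) ->
  phi 0 = 0 -> phi l = 0 ->
  (\int[lebesgue_measure]_(x in `]0%R, l[) (derive1 phi x)%:E = 0)%E.
Proof.
move=> l0 dphi cphi p0 pl.
have cp : continuous phi.
  by move=> x; apply: differentiable_continuous; apply/derivable1_diffP.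
have mf D : measurable_fun D (EFin \o derive1 phi).
  by apply/measurable_EFinP; apply: measurable_funTS; exact:
      continuous_measurable_fun.
rewrite integral_itv_bndo_bndc; last exact: mf.
rewrite integral_itv_obnd_cbnd; last exact: mf.
have cp0 : phi x @[x --> 0^'+] --> phi 0 by apply: cvg_at_right_filter; exact: cp.
have cpl : phi x @[x --> l^'-] --> phi l by apply: cvg_at_left_filter; exact: cp.
have phi0l : derivable_oo_LRcontinuous phi 0 l by split=> // x _; exact: dphi.
rewrite (continuous_FTC2 l0 (continuous_subspaceT cphi) phi0l (fun x _ => erefl _)).
by rewrite p0 pl subee.
Qed.

(** Change of variables to the product measure. The function is extended by 0 to the whole product,
    so that Fubini applies in either order. *)
Lemma integral_lebesgue_rVS n (l : 'I_n.+1 -> R) (f : 'rV[R]_n.+1 -> R) :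
  continuous f ->
  let F := (EFin \o (f \o @rV_cons R n)) \_ (@rV_cons R n @^-1` box l) in
  ((lebesgue_measure \x lebesgue_rV R n)%E.-integrable setT F /\
  \int[lebesgue_rV R n.+1]_(x in box l) (f x)%:E =
  \int[lebesgue_measure \x lebesgue_rV R n]_p F p)%E.
Proof.
move=> cf F.
have mp : measurable (@rV_cons R n @^-1` box l).
  by rewrite -[X in measurable X]setTI; apply: measurable_rV_cons => //; exact:
      measurable_box.
have mf : measurable_fun setT f by exact: continuous_measurable_rV.
have intF : (lebesgue_measure \x lebesgue_rV R n)%E.-integrable
    (@rV_cons R n @^-1` box l) (EFin \o (f \o @rV_cons R n)).
  apply: measurable_bounded_integrable => //.
  - exact: (lebesgue_box_fin l).
  - apply: measurable_funTS; apply: measurableT_comp => //.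
    exact: measurable_rV_cons.
  - have [M HM] := continuous_bounded_box l cf.
    exists M; split=> [|N MN]; [exact: num_real|move=> x lx /=].
    by rewrite (le_trans (HM _ lx))// ltW.
split; first by rewrite -integrable_mkcond.
rewrite -integral_mkcond.
apply: (@integral_pushforward _ _ _ _ R (@rV_cons R n)) => //.
- exact: measurable_rV_cons.
- by apply/measurable_EFinP.
- exact: measurable_box.
Qed.

(** Induction on the dimension. If i is the first coordinate, it is integrated first and the
    fundamental theorem of calculus applies; otherwise the other coordinates are integrated first,
    by induction on each slice. Only the relative interiors of the two faces matter, which is where
    the boundary conditions are available. *)
Lemma integral_partial_box n (l : 'I_n -> R) (i : 'I_n) (H : 'rV[R]_n -> R) :
  (forall k, 0 < l k) ->
  (forall x, derivable H x (delta_mx ord0 i)) -> continuous (partial i H) ->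
  (forall x : 'rV[R]_n, (forall k, k != i -> 0 < x ord0 k < l k) ->
     x ord0 i = 0 \/ x ord0 i = l i -> H x = 0) ->
  (\int[lebesgue_rV R n]_(x in box l) (partial i H x)%:E = 0)%E.
Proof.
elim: n l i H => [|n IH] l i H l0 dH cH bH; first by case: i {dH cH bH}.
have [intF ->] := integral_lebesgue_rVS l cH.
have [j ij|i0] := unliftP ord0 i.
  rewrite -(integral12_prod_meas1 intF) integral0_eq// => s _.
  rewrite /fubini_F; have [s0|s0] := boolP (0 < s < l ord0).
    rewrite -[RHS](IH (l \o lift ord0) j (fun z => H (rV_cons (s, z)))).
    - rewrite [RHS]integral_mkcond; apply: eq_integral => y _.
      rewrite !patchE; have [yl|yl] := pselect (box (l \o lift ord0) y).
        rewrite !mem_set//=; last by apply/box_rV_cons.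
        by rewrite ij (derive_slice H s y j).2.
      by rewrite !memNset// => /box_rV_cons[].
    - by move=> k; exact: l0.
    - by move=> y; apply: (derive_slice H s y j).1.1; rewrite -ij; exact: dH.
    - rewrite (_ : partial _ _ = (fun y => partial i H (rV_cons (s, y)))).
        move=> y; apply: (@continuous_comp _ _ _ (fun y : 'rV[R]_n => rV_cons
            (s, y) : 'rV[R]_n.+1) (partial i H)).
          exact: continuous_rV_cons2.
        exact: cH.
      by apply/funext => y; rewrite ij (derive_slice _ _ _ _).2.
    - move=> y yk yj; apply: bH => [k|]; last by rewrite ij rV_consS.
      rewrite ij; have [k' ->|->] := unliftP ord0 k; last by rewrite rV_cons0.
      by rewrite (inj_eq lift_inj) rV_consS; exact: yk.
  rewrite integral0_eq// => y _; rewrite patchE memNset// => /box_rV_cons[].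
  by rewrite (negbTE s0).
rewrite -(integral21_prod_meas1 intF) integral0_eq// => y _.
rewrite /fubini_G; have [yl|yl] := pselect (box (l \o lift ord0) y).
  rewrite -[RHS](@integral_derive1_eq0 (fun t => H (rV_cons (t, y))) (l ord0))//.
  - rewrite [RHS]integral_mkcond; apply: eq_integral => s _.
    rewrite !patchE; have [s0|s0] := boolP (0 < s < l ord0).
      rewrite !mem_set//=; last by apply/box_rV_cons.
      by rewrite i0 (derive_slice0 H s y).2.
    rewrite !memNset//=; first by rewrite in_itv/= (negbTE s0).
    by move=> /box_rV_cons[]; rewrite (negbTE s0).
  - by move=> s; apply: (derive_slice0 H s y).1.1; rewrite -i0; exact: dH.
  - rewrite (_ : derive1 _ = (fun s => partial i H (rV_cons (s, y)))).
      move=> s; apply: (@continuous_comp _ _ _ (fun s : R => rV_cons (s, y) :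
          'rV[R]_n.+1) (partial i H)).
        exact: continuous_rV_cons1.
      exact: cH.
    by apply/funext => s; rewrite i0 (derive_slice0 _ _ _).2.
  - apply: bH => [k|]; last by left; rewrite i0 rV_cons0.
    by rewrite i0; have [k' -> _|->] := unliftP ord0 k; rewrite ?eqxx//
        rV_consS; exact: yl.
  - apply: bH => [k|]; last by right; rewrite i0 rV_cons0.
    by rewrite i0; have [k' -> _|->] := unliftP ord0 k; rewrite ?eqxx//
        rV_consS; exact: yl.
by rewrite integral0_eq// => s _; rewrite patchE memNset// => /box_rV_cons[].
Qed.

End integration_by_parts.

Section L2_square_integrable.
Context (R : realType) (n : nat) (U : set 'rV[R]_n) (mU : measurable U).
Local Notation mu := (lebesgue_rV R n).

(** Passes from the extension by 0, with a norm defined by real powers, to the integral of the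
    square over [U]. *)
Lemma L2E (f : 'rV[R]_n -> R) : L2 U f <-> sq_integrable mu U f.
Proof.
rewrite /L2/=; split=> [fL|[mf intf]].
  have := Lfun2_integrable_sqr fL.
  move: fL; rewrite inE => /andP[/[!inE]/= mf _] intf; split.
    by apply/(measurable_restrictT _ mU).
  apply/(integrable_mkcond _ mU); move: intf; congr (_.-integrable _ _).
  apply/funext => x; rewrite /= !patchE.
  by case: ifP => // _; rewrite expr0n.
rewrite inE; apply/andP; split; rewrite inE/=.
  by apply/(measurable_restrictT _ mU).
have /integrableP[_] := (integrable_mkcond _ mU).1 intf.
rewrite /finite_norm unlock => intfoo; apply: poweR_lty.
apply: le_lt_trans intfoo; rewrite le_eqVlt; apply/orP; left; apply/eqP.
apply: eq_integral => x _; rewrite /= !patchE; case: ifPn => _ /=.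
  by rewrite powR_mulrn// -normrX.
by rewrite normr0 powR0// abse0.
Qed.

End L2_square_integrable.

(** * The inner product of vector fields *)

Section vector_L2.
Context (R : realType) (d : nat) (U : set 'rV[R]_d.+1) (mU : measurable U).
Local Notation mu := (lebesgue_rV R d.+1).
Implicit Types u v w : vfun R d.

Local Notation vL2 := (vL2 U).
Local Notation inner := (inner U).

Lemma vL2P u : vL2 u <-> forall k, sq_integrable mu U (component u k).
Proof. by split=> uL k; have /(L2E mU) := uL k. Qed.

Lemma eq_vL2 u v : {in U, u =1 v} -> vL2 u -> vL2 v.
Proof.
move=> uv /vL2P uL; apply/vL2P => k; apply: (eq_sq_integrable mU _ (uL k)).
by move=> x Ux; rewrite /component uv.
Qed.

Lemma vL2D u v : vL2 u -> vL2 v -> vL2 (u + v).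
Proof.
move=> /vL2P uL /vL2P vL; apply/vL2P => k.
rewrite (_ : component _ _ = (fun x => component u k x + component v k x)).
  exact: sq_integrableD.
by apply/funext => x; rewrite /component !mxE.
Qed.

Lemma vL2Z (s : R) u : vL2 u -> vL2 (s *: u).
Proof.
move=> /vL2P uL; apply/vL2P => k.
rewrite (_ : component _ _ = (fun x => s * component u k x)).
  exact: sq_integrableZ.
by apply/funext => x; rewrite /component !mxE.
Qed.

Lemma vL2B u v : vL2 u -> vL2 v -> vL2 (u - v).
Proof. by move=> uL vL; rewrite -scaleN1r; apply: vL2D => //; exact: vL2Z. Qed.

Lemma Rintegral_sum (I : Type) (s : seq I) (f : I -> 'rV[R]_d.+1 -> R) :
  (forall i, mu.-integrable U (EFin \o f i)) ->
  mu.-integrable U (EFin \o (fun x => \sum_(i <- s) f i x)) /\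
  \int[mu]_(x in U) (\sum_(i <- s) f i x) = \sum_(i <- s) \int[mu]_(x in U) f i x.
Proof.
move=> fi; elim: s => [|i s [IH1 IH2]].
  under eq_fun do rewrite big_nil; split; first exact: integrable0.
  by rewrite big_nil Rintegral_cst// mul0r.
under eq_fun do rewrite big_cons; split; first exact: integrable_EFinD.
by rewrite big_cons -IH2 -RintegralD.
Qed.

Lemma innerE u v : vL2 u -> vL2 v ->
  inner u v = \sum_(k < d.+1) ip mu U (component u k) (component v k).
Proof.
move=> /vL2P uL /vL2P vL; rewrite /inner (Rintegral_sum _ _).2//.
by move=> k; exact: (sq_integrableM mU (uL k) (vL k)).
Qed.

Lemma eq_inner u u' v v' : {in U, u =1 u'} -> {in U, v =1 v'} ->
  inner u v = inner u' v'.
Proof.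
by move=> uu vv; apply: eq_Rintegral => x Ux; rewrite uu// vv.
Qed.

Lemma innerC u v : inner u v = inner v u.
Proof. by apply: eq_Rintegral => x _; apply: eq_bigr => k _; rewrite mulrC. Qed.

Lemma inner_ge0 u : 0 <= inner u u.
Proof.
by apply: Rintegral_ge0 => x _; apply: sumr_ge0 => k _; rewrite -expr2 sqr_ge0.
Qed.

Lemma innerDl u v w : vL2 u -> vL2 v -> vL2 w ->
  inner (u + v) w = inner u w + inner v w.
Proof.
move=> uL vL wL; rewrite !innerE//; last exact: vL2D.
rewrite -big_split/=; apply: eq_bigr => k _.
move/vL2P : uL => uL; move/vL2P : vL => vL; move/vL2P : wL => wL.
rewrite -ipDl//; congr ip.
by apply/funext => x; rewrite /component !mxE.
Qed.

Lemma innerZl (s : R) u v : vL2 u -> vL2 v -> inner (s *: u) v = s * inner u v.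
Proof.
move=> uL vL; rewrite !innerE//; last exact: vL2Z.
rewrite mulr_sumr; apply: eq_bigr => k _.
move/vL2P : uL => uL; move/vL2P : vL => vL.
rewrite -ipZl//; congr ip.
by apply/funext => x; rewrite /component !mxE.
Qed.

Lemma innerDr u v w : vL2 u -> vL2 v -> vL2 w ->
  inner u (v + w) = inner u v + inner u w.
Proof. by move=> uL vL wL; rewrite innerC innerDl// (innerC v) (innerC w). Qed.

Lemma innerZr (s : R) u v : vL2 u -> vL2 v -> inner u (s *: v) = s * inner u v.
Proof. by move=> uL vL; rewrite innerC innerZl// (innerC v). Qed.

Lemma innerBl u v w : vL2 u -> vL2 v -> vL2 w ->
  inner (u - v) w = inner u w - inner v w.
Proof.
by move=> uL vL wL; rewrite -scaleN1r innerDl ?innerZl ?mulN1r//; exact: vL2Z.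
Qed.

Lemma innerBr u v w : vL2 u -> vL2 v -> vL2 w ->
  inner u (v - w) = inner u v - inner u w.
Proof. by move=> uL vL wL; rewrite innerC innerBl// (innerC v) (innerC w). Qed.

(** Positivity of the square of s u - t v, for suitable s and t. *)
Lemma CauchySchwarz_inner u v : vL2 u -> vL2 v ->
  inner u v ^+ 2 <= inner u u * inner v v.
Proof.
move=> uL vL.
have H s t : 0 <= s ^+ 2 * inner u u - 2 * s * t * inner u v + t ^+ 2 * inner v v.
  have := inner_ge0 (s *: u - t *: v).
  have [sL tL] := (vL2Z s uL, vL2Z t vL).
  rewrite !(innerBl, innerBr, innerZl, innerZr)//; try exact: vL2B.
  by rewrite (innerC v u) => h; apply: le_trans h _; rewrite le_eqVlt;
      apply/orP; left; apply/eqP; ring.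
have u0 := inner_ge0 u; have v0 := inner_ge0 v.
move: u0 v0 H; set A := inner u u; set B := inner u v; set C := inner v v.
move=> A0 C0 H; rewrite -subr_ge0.
have [C00|Cn0] := eqVneq C 0.
  have [B0|Bn0] := eqVneq B 0; first by rewrite B0 C00 expr0n mulr0 subr0.
  (* With C = 0 the form is affine in t; this value of t would make it -1. *)
  have := H 1 ((A + 1) / (2 * B)); rewrite C00.
  rewrite (_ : 2 * 1 * ((A + 1) / (2 * B)) * B = A + 1); last by field; rewrite Bn0.
  lra.
have Cp : 0 < C by rewrite lt_def Cn0.
have := H C B; rewrite (_ : _ + _ = C * (A * C - B ^+ 2)); last by ring.
by rewrite pmulr_rge0.
Qed.

Lemma normL2E u : normL2 U u ^+ 2 = inner u u.
Proof. by rewrite /normL2 sqr_sqrtr// inner_ge0. Qed.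

Lemma inner_le_normL2 u v : vL2 u -> vL2 v ->
  `|inner u v| <= normL2 U u * normL2 U v.
Proof.
move=> uL vL; rewrite -(@ler_pXn2r _ 2)// ?nnegrE ?mulr_ge0 ?sqrtr_ge0//.
by rewrite exprMn !normL2E real_normK ?num_real// CauchySchwarz_inner.
Qed.

End vector_L2.

Section continuously_differentiable.
Context (R : realType) (n : nat).
Implicit Types f g : 'rV[R]_n -> R.

Definition C1 f := continuous f /\ forall i,
  (forall x, derivable f x (delta_mx ord0 i)) /\ continuous (partial i f).

Lemma smooth_C1 f : smooth f -> C1 f.
Proof.
move=> sf; split; first exact: (sf [::]).1.
by move=> i; split; [exact: (sf [::]).2|exact: (sf [:: i]).1].
Qed.

Lemma partialD f g i : C1 f -> C1 g ->
  partial i (fun x => f x + g x) = (fun x => partial i f x + partial i g x).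
Proof.
move=> [_ df] [_ dg]; apply/funext => x.
exact: (deriveD ((df i).1 x) ((dg i).1 x)).
Qed.

Lemma partialM f g i : C1 f -> C1 g -> partial i (fun x => f x * g x) =
  (fun x => f x * partial i g x + g x * partial i f x).
Proof.
move=> [_ df] [_ dg]; apply/funext => x.
exact: (deriveM ((df i).1 x) ((dg i).1 x)).
Qed.

Lemma partial_cst k i : partial i (cst k : 'rV[R]_n -> R) = cst 0.
Proof. by apply/funext => x; exact: derive_cst. Qed.

Lemma C1_cst k : C1 (cst k).
Proof.
split; first exact: cst_continuous.
move=> i; split; first by move=> x; exact: derivable_cst.
by rewrite partial_cst; exact: cst_continuous.
Qed.

Lemma C1D f g : C1 f -> C1 g -> C1 (fun x => f x + g x).
Proof.
move=> Cf Cg; have [cf df] := Cf; have [cg dg] := Cg; split.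
  by move=> x; apply: continuousD; [exact: cf|exact: cg].
move=> i; split; first by move=> x; exact: (derivableD ((df i).1 x) ((dg i).1 x)).
rewrite partialD// => x.
by apply: continuousD; [exact: (df i).2|exact: (dg i).2].
Qed.

Lemma C1M f g : C1 f -> C1 g -> C1 (fun x => f x * g x).
Proof.
move=> Cf Cg; have [cf df] := Cf; have [cg dg] := Cg; split.
  by move=> x; apply: continuousM; [exact: cf|exact: cg].
move=> i; split; first by move=> x; exact: (derivableM ((df i).1 x) ((dg i).1 x)).
rewrite partialM// => x.
exact: (continuousD (continuousM (cf x) ((dg i).2 x))
  (continuousM (cg x) ((df i).2 x))).
Qed.

Lemma C1_sum (I : Type) (s : seq I) (F : I -> 'rV[R]_n -> R) i :
  (forall j, C1 (F j)) -> C1 (fun x => \sum_(j <- s) F j x) /\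
  partial i (fun x => \sum_(j <- s) F j x) =
  (fun x => \sum_(j <- s) partial i (F j) x).
Proof.
move=> CF; elim: s => [|j s [IH1 IH2]].
  rewrite (_ : (fun x => _) = cst 0); last by apply/funext => x; rewrite big_nil.
  split; first exact: C1_cst.
  by rewrite partial_cst; apply/funext => x; rewrite big_nil.
rewrite (_ : (fun x => _) = (fun x => F j x + \sum_(j <- s) F j x)); last first.
  by apply/funext => x; rewrite big_cons.
split; first exact: C1D.
by rewrite partialD// IH2; apply/funext => x; rewrite big_cons.
Qed.

Lemma C1_coord a k : C1 (fun x => a - x ord0 k) /\ forall i,
  partial i (fun x => a - x ord0 k) = cst (- (i == k)%:R).
Proof.
have H i x : derivable (fun x : 'rV[R]_n => a - x ord0 k) x (delta_mx ord0 i) /\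
    partial i (fun x => a - x ord0 k) x = - (i == k)%:R.
  pose b : R := - (i == k)%:R.
  pose phi (t : R) := b * t + (a - x ord0 k - b * x ord0 i).
  have [t|d1 ->] := @derive_line R n (fun x => a - x ord0 k) phi x i.
    by rewrite /phi !mxE eqxx/= eq_sym /b; ring.
  have sphi : smooth1 phi by exact: smooth1_affine.
  split; first by apply/d1; exact: smooth1_derivable.
  have [dphi ephi] := derive1_scale b (@derivable_id _ _ (x ord0 i) (1 : R)).
  rewrite derive1E /phi.
  rewrite (deriveD dphi (@derivable_cst _ _ _ _ _ _)) derive_cst addr0 -derive1E
      ephi.
  by rewrite derive1E derive_id mulr1.
have E i : partial i (fun x => a - x ord0 k) = cst (- (i == k)%:R).
  by apply/funext => x; exact: (H i x).2.
split=> //; split.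
  move=> x; apply: continuousB; first exact: cst_continuous.
  exact: coord_continuous.
move=> i; split; first by move=> x; exact: (H i x).1.
by rewrite E; exact: cst_continuous.
Qed.

Lemma C1Z k f : C1 f -> C1 (fun x => k * f x) /\
  forall i, partial i (fun x => k * f x) = (fun x => k * partial i f x).
Proof.
move=> Cf; split; first exact: (C1M (C1_cst k) Cf).
move=> i; have := partialM i (C1_cst k) Cf; rewrite partial_cst => ->.
by apply/funext => x; rewrite mulr0 addr0.
Qed.

Lemma integral_partial_C1 (l : 'I_n -> R) i f : (forall k, 0 < l k) -> C1 f ->
  (forall x : 'rV[R]_n, (forall k, k != i -> 0 < x ord0 k < l k) ->
     x ord0 i = 0 \/ x ord0 i = l i -> f x = 0) ->
  \int[lebesgue_rV R n]_(x in box l) partial i f x = 0.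
Proof.
move=> l0 [_ df] bf; rewrite /Rintegral integral_partial_box//.
- exact: (df i).1.
- exact: (df i).2.
Qed.

End continuously_differentiable.

(** * The wave operator and Green's formula *)

Section classical_wave.
Context (R : realType) (d : nat) (c T : R) (a : 'I_d -> R).
Implicit Types (u v F G : vfun R d) (p : 'rV[R]_d.+1).

Definition side (k : 'I_d.+1) : R := oapp a T (unlift ord_max k).

Lemma side_lift i : side (lift ord_max i) = a i.
Proof. by rewrite /side liftK. Qed.

Lemma side_max : side ord_max = T.
Proof. by rewrite /side unlift_none. Qed.

Lemma Omega_box : Omega T a = box side.
Proof.
apply/seteqP; split=> [p [/= Hx Ht] k|p Hp].
  have [i ->|->] := unliftP ord_max k; rewrite ?side_lift ?side_max.
    by have := Hx i; rewrite !mxE.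
  by move: Ht; rewrite in_itv.
split; first by move=> i; rewrite !mxE; have := Hp (lift ord_max i); rewrite
    side_lift.
by rewrite /= in_itv/=; have := Hp ord_max; rewrite side_max.
Qed.

Lemma measurable_Omega : measurable (Omega T a).
Proof. by rewrite Omega_box; exact: measurable_box. Qed.

Definition vC1 F := forall k, C1 (component F k).

Definition classical_wave F : vfun R d := fun p => \row_k
  (partial ord_max (component F k) p - c *
   match unlift ord_max k with
   | Some i => partial (lift ord_max i) (component F ord_max) p
   | None => \sum_(i < d) partial (lift ord_max i) (component F (lift ord_max i)) p
   end).

Lemma classical_wave_lift F i p : classical_wave F p ord0 (lift ord_max i) =
  partial ord_max (component F (lift ord_max i)) p -
  c * partial (lift ord_max i) (component F ord_max) p.
Proof. by rewrite mxE liftK. Qed.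

Lemma classical_wave_max F p : classical_wave F p ord0 ord_max =
  partial ord_max (component F ord_max) p -
  c * \sum_(i < d) partial (lift ord_max i) (component F (lift ord_max i)) p.
Proof. by rewrite mxE unlift_none. Qed.

Lemma continuous_sum_fun (I : Type) (s : seq I) (f : I -> 'rV[R]_d.+1 -> R) :
  (forall i, continuous (f i)) -> continuous (fun p => \sum_(i <- s) f i p).
Proof.
move=> cf; elim: s => [|i s IH].
  under eq_fun do rewrite big_nil; exact: cst_continuous.
under eq_fun do rewrite big_cons.
by move=> x; exact: (continuousD (cf i x) (IH x)).
Qed.

Lemma continuous_classical_wave F : vC1 F ->
  forall k, continuous (component (classical_wave F) k).
Proof.
move=> CF k; have cp j i : continuous (partial j (component F i)).
  by have [_ /(_ j)[]] := CF i.
rewrite /component; have [i ->|->] := unliftP ord_max k.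
  under eq_fun do rewrite classical_wave_lift.
  move=> x; apply: (continuousB (cp _ _ x)).
  exact: (continuousM (@cst_continuous _ _ c x) (cp _ _ x)).
under eq_fun do rewrite classical_wave_max.
move=> x; apply: (continuousB (cp _ _ x)).
apply: (continuousM (@cst_continuous _ _ c x)).
exact: continuous_sum_fun.
Qed.

Lemma continuous_vL2 F : (forall k, continuous (component F k)) -> vL2 (Omega T
    a) F.
Proof.
move=> cF k; apply/L2E; first exact: measurable_Omega.
by rewrite Omega_box; exact: continuous_sq_integrable.
Qed.

Lemma vC1_vL2 F : vC1 F -> vL2 (Omega T a) F.
Proof. by move=> CF; apply: continuous_vL2 => k; have [] := CF k. Qed.

Lemma vL2_classical_wave F : vC1 F -> vL2 (Omega T a) (classical_wave F).
Proof. by move=> CF; apply: continuous_vL2; exact: continuous_classical_wave. Qed.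

(** A has constant symmetric coefficient matrices, so A F . G + F . A G is a space-time
    divergence. *)
Lemma wave_Leibniz F G p : vC1 F -> vC1 G ->
  \sum_k classical_wave F p ord0 k * G p ord0 k +
  \sum_k F p ord0 k * classical_wave G p ord0 k =
  partial ord_max (fun p => \sum_k component F k p * component G k p) p -
  \sum_(i < d) c * partial (lift ord_max i) (fun p =>
     component F ord_max p * component G (lift ord_max i) p +
     component F (lift ord_max i) p * component G ord_max p) p.
Proof.
move=> CF CG.
rewrite (C1_sum (index_enum _) ord_max (fun k => C1M (CF k) (CG k))).2.
have E i : partial (lift ord_max i) (fun p =>
     component F ord_max p * component G (lift ord_max i) p +
     component F (lift ord_max i) p * component G ord_max p) p =
   component F ord_max p * partial (lift ord_max i) (component G (lift ord_max
       i)) p +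
   component G (lift ord_max i) p * partial (lift ord_max i) (component F
       ord_max) p +
   (component F (lift ord_max i) p * partial (lift ord_max i) (component G
       ord_max) p +
   component G ord_max p * partial (lift ord_max i) (component F (lift ord_max
       i)) p).
  by rewrite partialD ?partialM//; exact: C1M.
under [X in _ = _ - X]eq_bigr do rewrite E.
rewrite !(bigD1_ord ord_max)//= !classical_wave_max partialM//.
under eq_bigr do rewrite classical_wave_lift.
have -> : \sum_(i < d) F p ord0 (lift ord_max i) * classical_wave G p ord0 (lift
    ord_max i) =
    \sum_(i < d) F p ord0 (lift ord_max i) *
      (partial ord_max (component G (lift ord_max i)) p -
       c * partial (lift ord_max i) (component G ord_max) p).
  by apply: eq_bigr => i _; rewrite classical_wave_lift.
have -> : \sum_(i < d) partial ord_max (fun x : 'rV_d.+1 =>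
      component F (lift ord_max i) x * component G (lift ord_max i) x) p =
    \sum_(i < d) (component F (lift ord_max i) p * partial ord_max (component G
        (lift ord_max i)) p +
      component G (lift ord_max i) p * partial ord_max (component F (lift
          ord_max i)) p).
  by apply: eq_bigr => i _; rewrite partialM.
rewrite !mulrBl !mulrBr -/(component F ord_max p) -/(component G ord_max p).
set ft := partial _ _ _; set gt := partial _ _ _.
set f := component F ord_max p; set g := component G ord_max p.
rewrite (_ : c * _ * g = \sum_(i < d) c * partial (lift ord_max i) (component F
    (lift ord_max i)) p * g); last first.
  by rewrite mulr_sumr mulr_suml.
rewrite (_ : f * (c * _) = \sum_(i < d) f * (c * partial (lift ord_max i)
    (component G (lift ord_max i)) p)); last first.
  by rewrite !mulr_sumr.
(* All spatial terms are collected under a single sum; the identity then holds for each i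
   separately, by the ring identity [summand]. *)
rewrite [LHS](_ : _ = ft * g + f * gt + \sum_(i < d) (
   (partial ord_max (component F (lift ord_max i)) p -
    c * partial (lift ord_max i) (component F ord_max) p) * G p ord0 (lift
        ord_max i) +
   F p ord0 (lift ord_max i) * (partial ord_max (component G (lift ord_max i)) p -
    c * partial (lift ord_max i) (component G ord_max) p) -
   c * partial (lift ord_max i) (component F (lift ord_max i)) p * g -
   f * (c * partial (lift ord_max i) (component G (lift ord_max i)) p))); last
       first.
  by rewrite !sumrB big_split/=; ring.
rewrite -[RHS]addrA -sumrB; congr (_ + _); first by ring.
have summand ft' fx fi gt' gx gi dF dG :
    (ft' - c * fx) * gi + fi * (gt' - c * gx) - c * dF * g - f * (c * dG) =
    fi * gt' + gi * ft' - c * (f * dG + gi * fx + (fi * gx + g * dF)) by ring.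
by apply: eq_bigr => i _; exact: summand.
Qed.

Hypotheses (T_gt0 : 0 < T) (a_gt0 : forall i, 0 < a i).

Lemma side_gt0 k : 0 < side k.
Proof. by have [i ->|->] := unliftP ord_max k; rewrite ?side_lift ?side_max. Qed.

(** The divergence of [wave_Leibniz] is integrated face by face. The hypotheses concern only the
    fluxes, hence products of F and G: it is enough that one of the two fields vanishes on each time
    face. *)
Lemma Green F G : vC1 F -> vC1 G ->
  (forall p, (forall k, k != ord_max -> 0 < p ord0 k < side k) ->
    p ord0 ord_max = 0 \/ p ord0 ord_max = T ->
    \sum_k F p ord0 k * G p ord0 k = 0) ->
  (forall i p, (forall k, k != lift ord_max i -> 0 < p ord0 k < side k) ->
    p ord0 (lift ord_max i) = 0 \/ p ord0 (lift ord_max i) = a i ->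
    F p ord0 ord_max * G p ord0 (lift ord_max i) +
    F p ord0 (lift ord_max i) * G p ord0 ord_max = 0) ->
  inner (Omega T a) (classical_wave F) G + inner (Omega T a) F (classical_wave
      G) = 0.
Proof.
move=> CF CG bt bs; rewrite Omega_box /inner.
have contM (u v : vfun R d) : (forall k, continuous (component u k)) ->
    (forall k, continuous (component v k)) ->
    (lebesgue_rV R d.+1).-integrable (box side) (EFin \o (fun p => \sum_k u p
        ord0 k * v p ord0 k)).
  move=> cu cv; apply: continuous_integrable_box; apply: continuous_sum_fun => k x.
  exact: (continuousM (cu k x) (cv k x)).
have cF k : continuous (component F k) by have [] := CF k.
have cG k : continuous (component G k) by have [] := CG k.
have mB := measurable_box side.
rewrite -RintegralD//; last 2 first.
- by apply: contM => //; exact: continuous_classical_wave.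
- by apply: contM => //; exact: continuous_classical_wave.
under eq_Rintegral do rewrite wave_Leibniz//.
have CHt : C1 (fun p => \sum_k component F k p * component G k p).
  by apply: (C1_sum _ ord_max (fun k => C1M (CF k) (CG k))).1.
have CHs i : C1 (fun p => component F ord_max p * component G (lift ord_max i) p +
     component F (lift ord_max i) p * component G ord_max p).
  exact: (C1D (C1M (CF _) (CG _)) (C1M (CF _) (CG _))).
have intS i := continuous_integrable_box side ((CHs i).2 (lift ord_max i)).2.
have [intSum eqSum] := Rintegral_sum mB (index_enum 'I_d) (fun i =>
    integrable_EFinZ mB c (intS i)).
rewrite RintegralB//; last exact: (continuous_integrable_box side (CHt.2
    ord_max).2).
rewrite eqSum integral_partial_C1//; last 2 first.
- exact: side_gt0.
- by rewrite side_max; exact: bt.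
rewrite big1 ?subr0// => i _; rewrite RintegralZl//.
rewrite integral_partial_C1 ?mulr0//; first exact: side_gt0.
by rewrite side_lift; exact: bs.
Qed.

End classical_wave.

(** * The density criterion on a box *)

Section span.
Context (X : Type) (R : realType).

Inductive span (G : set (X -> R)) : set (X -> R) :=
| span_in g of G g : span G g
| span_add f g of span G f & span G g : span G (fun x => f x + g x)
| span_scale k f of span G f : span G (fun x => k * f x).

End span.

Section box_density.
Context (R : realType) (n : nat) (l : 'I_n -> R).
Local Notation mu := (lebesgue_rV R n).
Local Notation D := (box l).
Local Notation sqi := (sq_integrable mu D).

Let mD : measurable D := measurable_box l.

Lemma span_sq_integrable (G : set ('rV[R]_n -> R)) : G `<=` sqi -> span G `<=` sqi.
Proof.
move=> Gs f; elim=> {f} [g /Gs//|f g _ sf _ sg|k f _ sf].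
  exact: sq_integrableD.
exact: sq_integrableZ.
Qed.

Lemma span_multiplier (G : set ('rV[R]_n -> R)) (g : 'rV[R]_n -> R) : G `<=` sqi ->
  continuous g -> (forall f, G f -> span G (fun x => g x * f x)) ->
  multiplier mu D (span G) g.
Proof.
move=> Gs cg gG; have Ss := span_sq_integrable Gs.
have [M gM] := continuous_bounded_box l cg.
apply: (multiplier_dense mD Ss _ gM).
  by apply: measurable_funTS; exact: continuous_measurable_rV.
move=> s Ss'; apply: (subset_L2closure mD Ss).
elim: Ss' => {s} [s /gG//|f h _ IH1 _ IH2|k f _ IH].
  rewrite (_ : (fun x => _) = (fun x => g x * f x + g x * h x)); first exact:
      span_add.
  by apply/funext => x; ring.
rewrite (_ : (fun x => _) = (fun x => k * (g x * f x))); first exact: span_scale.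
by apply/funext => x; ring.
Qed.

(** The multiplier condition alone also holds for spaces of functions vanishing on a fixed set; a
    strictly positive element [w] of the closure excludes this. *)
Lemma L2closure_span_full (G : set ('rV[R]_n -> R)) : G `<=` sqi ->
  (forall k s, multiplier mu D (span G) \1_[set x : 'rV[R]_n | s < x ord0 k]) ->
  (exists2 w, L2closure mu D (span G) w & forall x, D x -> 0 < w x) ->
  sqi `<=` L2closure mu D (span G).
Proof.
move=> Gs mG [w cw w0]; have Ss := span_sq_integrable Gs.
have SA := @span_add _ _ G; have SZ := @span_scale _ _ G.
have [s0 sC sU] := sigma_algebra_multiplier mD Ss SA SZ.
(* Two generation arguments: measurable sets come from preimages under coordinates, and measurable
   subsets of the line from open rays. *)
have msig : forall E : set 'rV[R]_n, measurable E -> multiplier mu D (span G) \1_E.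
  apply: smallest_sub; first by split.
  rewrite -bigcup_seq/=; apply: bigcup_sub => i _ _ [B mB <-].
  rewrite /= setTI; move: B mB; rewrite RGenOInfty.measurableE.
  apply: smallest_sub => [|_ [s ->]]; last first.
    rewrite /= (_ : _ @^-1` _ = [set x : 'rV[R]_n | s < x ord0 i]); first exact: mG.
    by apply/seteqP; split=> x /=; rewrite in_itv/= andbT.
  split=> /= [|A mA|F mF]; first by rewrite preimage_set0.
    by have := sC _ mA; rewrite !setTD preimage_setC.
  by rewrite preimage_bigcup; exact: sU.
move=> h sh; exact: (L2closure_full mD Ss SA SZ msig cw w0 sh).
Qed.

End box_density.

(** * Test functions are dense in L^2 of a box *)

Section test_functions_dense.
Context (R : realType) (n : nat) (l : 'I_n -> R).
Local Notation mu := (lebesgue_rV R n).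
Local Notation D := (box l).
Local Notation sqi := (sq_integrable mu D).

Lemma expinv_ge0 (x : R) : 0 <= expinv x.
Proof. by rewrite /expinv /flat; case: ifP => // _; rewrite hornerC mul1r
    expR_ge0. Qed.

Lemma expinv_le1 (x : R) : expinv x <= 1.
Proof.
rewrite /expinv /flat; case: ifPn => // x0; rewrite hornerC mul1r.
by rewrite -[leRHS]expR0 ler_expR oppr_le0 invr_ge0 ltW.
Qed.

(** The common margin [e] keeps the support compact inside the box, and it survives multiplication
    of one factor by a smooth function. *)
Definition bump_product : set ('rV[R]_n -> R) := [set f | exists h : 'I_n -> R -> R,
  [/\ f = prodf h, forall k, smooth1 (h k) &
      exists2 e : R, 0 < e & forall k s, h k s != 0 -> e <= s <= l k - e]].

Lemma test_fun_bump_product : bump_product `<=` test_fun D.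
Proof.
move=> _ [h [-> sh [e e0 he]]].
apply: (@test_fun_prodf _ _ _ (fun=> e) (fun k => l k - e)) => //.
by move=> x hx k; have /andP[? ?] := hx k; apply/andP; split; lra.
Qed.

Let bp_sqi : bump_product `<=` sqi.
Proof.
move=> f /test_fun_bump_product[sf _ _].
exact: continuous_sq_integrable (sf [::]).1.
Qed.

(** Multiplication by x_k - s changes only the k-th factor of a product; the half-space is the set
    where this function is positive. *)
Let multiplier_coord_gt (k : 'I_n) (s : R) :
  multiplier mu D (span bump_product) \1_[set x : 'rV[R]_n | s < x ord0 k].
Proof.
have mD := measurable_box l.
rewrite (_ : [set x : 'rV[R]_n | s < x ord0 k] = [set x : 'rV[R]_n | 0 < 1 * x
    ord0 k + - s]).
  apply: (multiplier_gt0 mD (span_sq_integrable bp_sqi) (@span_add _ _ _)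
      (@span_scale _ _ _)).
  apply: (span_multiplier bp_sqi).
    exact: (@continuous_coord R n (fun t => 1 * t + - s) k (smooth1_continuous
        (smooth1_affine 1 (- s)))).
  move=> _ [h [-> sh [e e0 he]]]; apply: span_in.
  exists (fun j t => (if j == k then 1 * t + - s else 1) * h j t); split.
  - apply/funext => x; rewrite /prodf big_split/=; congr (_ * _).
    by rewrite (bigD1 k)//= eqxx big1 ?mulr1// => j /negbTE ->.
  - move=> j; apply: smooth1M => //; case: (j == k); first exact: smooth1_affine.
    exact: smooth1_cst.
  - by exists e => // j t; rewrite mulf_eq0 negb_or => /andP[_]; exact: he.
by apply/seteqP; split=> x /=; rewrite mul1r subr_gt0.
Qed.

Let bump (e : R) (k : 'I_n) (s : R) : R :=
  expinv (1 * s + - e) * expinv (-1 * s + (l k - e)).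

(** The weight [prodf (bump 0)] is positive on the whole box, so its support reaches the faces; it
    is the limit of the bumps with margin 1 / (m + 1). *)
Let bump_weight :
  exists2 w, L2closure mu D (span bump_product) w & forall x, D x -> 0 < w x.
Proof.
have mD := measurable_box l.
exists (prodf (bump 0)); last first.
  move=> x Dx; apply: prodr_gt0 => k _; have /andP[x0 xl] := Dx k.
  by apply: mulr_gt0; apply: expinv_gt0; lra.
have bumpin e : 0 < e -> bump_product (prodf (bump e)).
  move=> e0; exists (bump e); split => //.
    by move=> k; apply: smooth1M; exact: smooth1_expinv_affine.
  exists e => //.
  move=> k s; rewrite /bump mulf_eq0 negb_or => /andP[h1 h2]; apply/andP; split.
    by apply: contraNT h1; rewrite -ltNge => ?; rewrite expinv_le0//; lra.
  by apply: contraNT h2; rewrite -ltNge => ?; rewrite expinv_le0//; lra.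
apply: (@L2closure_cvg _ _ _ mu D mD _ (span_sq_integrable bp_sqi)
  (fun m => prodf (bump m.+1%:R^-1)) _ (cst 1)).
- move=> m; apply: (subset_L2closure mD (span_sq_integrable bp_sqi)).
  by apply: span_in; apply: bumpin; rewrite invr_gt0 ltr0n.
- by apply: continuous_sq_integrable; exact: cst_continuous.
- move=> m x _; rewrite /= normr1 normr_prod prodr_ile1// => k _.
  rewrite normr_ge0/= normrM !ger0_norm ?expinv_ge0//.
  by rewrite mulr_ile1 ?expinv_ge0 ?expinv_le1.
- move=> x _.
  pose h (k : 'I_n) (e : R) := bump e k (x ord0 k).
  (* For fixed x, the value as a function of the margin e is again a product function, evaluated on
     the diagonal; this gives continuity in e. *)
  have ch : continuous (fun e : R => prodf h (const_mx e)).
    move=> e; apply: (@continuous_comp _ _ _ (fun e : R => const_mx e :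
        'rV[R]_n) (prodf h)).
      apply: continuous_rV => i; under eq_fun do rewrite mxE.
      by move=> ?; exact: cvg_id.
    apply: continuous_prodf => k; apply: smooth1_continuous.
    rewrite (_ : h k = (fun e => expinv (-1 * e + x ord0 k) * expinv (-1 * e +
        (l k - x ord0 k)))).
      by apply: smooth1M; exact: smooth1_expinv_affine.
    by apply/funext => t; rewrite /h /bump; congr (expinv _ * expinv _); ring.
  have E e : prodf (bump e) x = prodf h (const_mx e).
    by apply: eq_bigr => k _; rewrite mxE.
  under eq_fun do rewrite E; rewrite E.
  apply: (@cvg_comp _ _ _ (fun m : nat => m.+1%:R^-1 : R) (fun e => prodf h
      (const_mx e))).
    exact: cvg_harmonic.
  exact: ch.
Qed.

(** Fundamental lemma of the calculus of variations. *)
Lemma test_fun_orthogonal_eq0 g : sqi g ->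
  (forall phi, test_fun D phi -> ip mu D g phi = 0) -> nsq mu D g = 0.
Proof.
move=> sg g0; have mD := measurable_box l.
have Ss := span_sq_integrable bp_sqi.
have ortho s : span bump_product s -> ip mu D g s = 0.
  elim=> {s} [s /test_fun_bump_product/g0//|f h Sf f0 Sh h0|k f Sf f0].
    by rewrite ipC ipDl//; [rewrite ipC f0 ipC h0 addr0|exact: Ss|exact: Ss].
  by rewrite ipC ipZl//; [rewrite ipC f0 mulr0|exact: Ss].
have [_ cg] := L2closure_span_full bp_sqi multiplier_coord_gt bump_weight sg.
(* The precision is |g|^2 itself: for s orthogonal to g, |g - s|^2 = |g|^2 + |s|^2 cannot be
   smaller. *)
apply/eqP; rewrite eq_le ip_ge0 andbT leNgt; apply/negP => /cg[s /[dup] Sp /Ss ss].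
have sgs := sq_integrableB mD sg ss.
rewrite /nsq ipBl// (ipC mu D g) (ipC mu D s) !ipBl// (ipC mu D s g) (ortho s)//.
by rewrite subr0 sub0r opprK ltNge lerDl => /negP; apply; exact: ip_ge0.
Qed.

End test_functions_dense.

(** * The distributional wave operator *)

Section weak_wave.
Context (R : realType) (d : nat) (c T : R) (a : 'I_d -> R).
Hypotheses (T_gt0 : 0 < T) (a_gt0 : forall i, 0 < a i).
Implicit Types (u v g F G : vfun R d) (p : 'rV[R]_d.+1) (phi : 'rV[R]_d.+1 -> R).

Local Notation Om := (Omega T a).
Local Notation mu := (lebesgue_rV R d.+1).
Local Notation inner := (inner Om).
Local Notation vL2 := (vL2 Om).
Local Notation A := (classical_wave c).

Let mOm : measurable Om := measurable_Omega T a.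

(** Turns the scalar tests of each component into tests with vector fields, to which Green's formula
    applies. *)
Definition single (k : 'I_d.+1) phi : vfun R d := fun p => phi p *: delta_mx ord0 k.

Lemma component_single k phi j :
  component (single k phi) j = (fun p => (j == k)%:R * phi p).
Proof. by apply/funext => p; rewrite /component /single !mxE eqxx/= mulrC. Qed.

Lemma vC1_single k phi : C1 phi -> vC1 (single k phi).
Proof. by move=> Cphi j; rewrite component_single; exact: (C1Z _ Cphi).1. Qed.

Lemma partial_single k phi j i : C1 phi ->
  partial i (component (single k phi) j) = (fun p => (j == k)%:R * partial i phi p).
Proof. by move=> Cphi; rewrite component_single (C1Z _ Cphi).2. Qed.

Lemma partial_sqi i phi : C1 phi -> sq_integrable mu Om (partial i phi).
Proof.
by move=> [_ /(_ i)[_ cphi]]; rewrite Omega_box; exact: continuous_sq_integrable.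
Qed.

Lemma ip_eq0r phi psi : (forall p, psi p = 0) -> ip mu Om phi psi = 0.
Proof.
move=> psi0; rewrite /ip; under eq_Rintegral do rewrite psi0 mulr0.
by rewrite Rintegral_cst// mul0r.
Qed.

Lemma inner_single g k phi : vL2 g -> C1 phi ->
  inner g (single k phi) = ip mu Om (component g k) phi.
Proof.
move=> gL Cphi; rewrite innerE//; last exact: (vC1_vL2 _ _ (vC1_single _ Cphi)).
rewrite (bigD1 k)//= big1 ?addr0 => [|j jk].
  by apply: eq_ip => // p _; rewrite component_single eqxx mul1r.
by apply: ip_eq0r => p; rewrite component_single (negbTE jk) mul0r.
Qed.

Lemma regularE f phi : regular Om f phi = ip mu Om f phi.
Proof. by []. Qed.

Lemma inner_split u v : vL2 u -> vL2 v ->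
  inner u v = ip mu Om (component u ord_max) (component v ord_max) +
    \sum_(i < d) ip mu Om (component u (lift ord_max i)) (component v (lift
        ord_max i)).
Proof. by move=> uL vL; rewrite innerE// (bigD1_ord ord_max). Qed.

(** A is formally skew-adjoint, so testing the k-th component of A u with phi amounts to testing u
    with -A (phi e_k). *)
Lemma wave_distributionE u k phi : vL2 u -> C1 phi ->
  wave_distribution c Om u k phi = - inner u (A (single k phi)).
Proof.
move=> uL Cphi; have uS j : sq_integrable mu Om (component u j).
  by move/(vL2P mOm) : uL.
have pS i := partial_sqi i Cphi.
have wL := vL2_classical_wave c T a (vC1_single k Cphi).
have ipZr s j i : ip mu Om (component u j) (fun p => s * partial i phi p) =
    s * ip mu Om (component u j) (partial i phi).
  by rewrite ipC ipZl// ipC.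
rewrite inner_split// /wave_distribution /dpartial.
have [i0 ki|km] := unliftP ord_max k.
  rewrite (_ : component (A (single k phi)) ord_max = (fun p => - c * partial
      (lift ord_max i0) phi p)).
    have -> : \sum_(i < d) ip mu Om (component u (lift ord_max i))
        (component (A (single k phi)) (lift ord_max i)) =
        ip mu Om (component u (lift ord_max i0)) (partial ord_max phi).
      rewrite (bigD1 i0)// big1 => [|i ii0].
        rewrite [LHS]addr0; congr ip; apply/funext => p.
        rewrite /component classical_wave_lift !partial_single// ki eqxx.
        by rewrite eq_liftF mul0r mulr0 subr0 mul1r.
      apply: ip_eq0r => p; move: ii0 => /andP[_ ii0].
      rewrite /component classical_wave_lift !partial_single// ki.
      by rewrite (inj_eq lift_inj) (negbTE ii0) eq_liftF !mul0r mulr0 subrr.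
    rewrite -ki !regularE ipZr.
    by move: (ip _ _ _ _) (ip _ _ _ _) => X Y; ring.
  apply/funext => p; rewrite /component classical_wave_max !partial_single// ki.
  rewrite eq_liftF mul0r sub0r (bigD1 i0)//= partial_single// eqxx mul1r.
  rewrite big1 ?addr0 ?mulNr// => i ii0.
  by rewrite partial_single// (inj_eq lift_inj) (negbTE ii0) mul0r.
rewrite km (_ : component (A _) ord_max = partial ord_max phi).
  rewrite opprD mulr_sumr; congr (_ + _); rewrite -!sumrN; apply: eq_bigr => i _.
  rewrite (_ : component (A _) _ = (fun p => - c * partial (lift ord_max i) phi p)).
    by rewrite ipZr regularE; move: (ip _ _ _ _) => X; ring.
  apply/funext => p; rewrite /component classical_wave_lift !partial_single//.
  by rewrite eqxx lift_eqF mul0r sub0r mul1r mulNr.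
apply/funext => p; rewrite /component classical_wave_max !partial_single// eqxx
    mul1r.
rewrite big1 ?mulr0 ?subr0// => i _.
by rewrite partial_single// lift_eqF mul0r.
Qed.

Lemma is_waveP u g : vL2 u -> is_wave c Om u g <-> vL2 g /\
  forall k phi, test_fun Om phi -> inner g (single k phi) + inner u (A (single k
      phi)) = 0.
Proof.
move=> uL; split=> -[gL H]; split => // k phi tphi; have [/smooth_C1 Cphi _ _]
    := tphi.
  by rewrite inner_single// -regularE -H// wave_distributionE// addNr.
have := H k phi tphi; rewrite inner_single// wave_distributionE//.
by rewrite regularE => /eqP; rewrite addr_eq0 => /eqP ->.
Qed.

Lemma test_fun_out phi p : test_fun Om phi -> ~ Om p -> phi p = 0.
Proof.
move=> [_ _ sphi] nOm; apply/eqP; apply/negP => /negP phip; apply: nOm.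
by apply: sphi; exact: subset_closure.
Qed.

Lemma test_fun_face phi p k : test_fun Om phi ->
  p ord0 k = 0 \/ p ord0 k = side T a k -> phi p = 0.
Proof.
move=> tphi pk; apply: (test_fun_out tphi); rewrite Omega_box => /(_ k).
by case: pk => ->; rewrite ltxx ?andbF.
Qed.

Lemma Green_test F k phi : vC1 F -> test_fun Om phi ->
  inner (A F) (single k phi) + inner F (A (single k phi)) = 0.
Proof.
move=> CF tphi; have [/smooth_C1 Cphi _ _] := tphi.
have s0 p j : phi p = 0 -> single k phi p ord0 j = 0.
  by move=> p0; rewrite /single p0 scale0r mxE.
apply: Green => //; first exact: vC1_single.
- move=> p _ pk; rewrite big1// => j _; rewrite s0 ?mulr0//.
  by apply: (test_fun_face (k := ord_max) tphi); rewrite side_max.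
- move=> i p _ pk; rewrite !s0 ?mulr0 ?addr0//;
  by apply: (test_fun_face (k := lift ord_max i) tphi); rewrite side_lift.
Qed.

Lemma is_wave_classical F : vC1 F -> is_wave c Om F (A F).
Proof.
move=> CF; apply/is_waveP; first exact: vC1_vL2.
split; first exact: vL2_classical_wave.
by move=> k phi tphi; exact: Green_test.
Qed.

Lemma eq_is_wave u v g : {in Om, u =1 v} -> vL2 u -> is_wave c Om u g ->
  is_wave c Om v g.
Proof.
move=> uv uL /is_waveP-/(_ uL)[gL H]; apply/is_waveP; first exact: (eq_vL2 mOm uv).
split=> // k phi /(H k); rewrite (@eq_inner _ _ _ u v (A (single k phi)) (A
    (single k phi)))//.
Qed.

Lemma is_waveB u v g h : vL2 u -> vL2 v -> is_wave c Om u g -> is_wave c Om v h ->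
  is_wave c Om (u - v) (g - h).
Proof.
move=> uL vL /is_waveP-/(_ uL)[gL ug] /is_waveP-/(_ vL)[hL vh].
apply/is_waveP; first exact: vL2B.
split=> [|k phi tphi]; first exact: vL2B.
have [/smooth_C1 Cphi _ _] := tphi; have Cs := vC1_single k Cphi.
have sL := vC1_vL2 T a Cs; have wL := vL2_classical_wave c T a Cs.
rewrite !innerBl// addrACA -opprD ug// vh// subrr//.
Qed.

Lemma is_wave_unique u g h : vL2 u -> is_wave c Om u g -> is_wave c Om u h ->
  inner (g - h) (g - h) = 0.
Proof.
move=> uL /is_waveP-/(_ uL)[gL ug] /is_waveP-/(_ uL)[hL uh].
have ghL : vL2 (g - h) by exact: vL2B.
rewrite innerE// big1// => k _.
have ghS : sq_integrable mu Om (component (g - h) k) by move/(vL2P mOm) : ghL.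
rewrite Omega_box in ghS *; apply: test_fun_orthogonal_eq0 => // phi.
rewrite -Omega_box => tphi; have [/smooth_C1 Cphi _ _] := tphi.
rewrite -inner_single// innerBl//; last exact: (vC1_vL2 T a (vC1_single k Cphi)).
apply/eqP; rewrite subr_eq0; apply/eqP.
by apply: (addIr (inner u (A (single k phi)))); rewrite ug// uh.
Qed.

Lemma is_wave_wave u g : is_wave c Om u g -> is_wave c Om u (wave c Om u).
Proof. by move=> ug; exact: (@xgetPex _ _ [set g | is_wave c Om u g] (ex_intro _
    g ug)). Qed.

(** [wave] is an arbitrary choice among the representatives of A u. Two of them differ by a field of
    norm 0, which Cauchy-Schwarz removes from inner products. *)
Lemma inner_wave u g v : vL2 u -> vL2 v -> is_wave c Om u g ->
  inner (wave c Om u) v = inner g v.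
Proof.
move=> uL vL ug; have uw := is_wave_wave ug; have gL := ug.1; have wL := uw.1.
have w0 := is_wave_unique uL uw ug.
have := CauchySchwarz_inner mOm (vL2B mOm wL gL) vL.
rewrite w0 mul0r innerBl// => h; apply/eqP; rewrite -subr_eq0 -sqrf_eq0.
by rewrite eq_le h sqr_ge0.
Qed.

Lemma normW_le u g (m : R) : vL2 u -> is_wave c Om u g ->
  inner u u + inner g g <= m -> normW c Om u <= Num.sqrt m.
Proof.
move=> uL ug um; rewrite /normW ler_wsqrtr// !normL2E//.
have uw := is_wave_wave ug.
by rewrite (inner_wave uL uw.1 ug) innerC (inner_wave uL ug.1 ug).
Qed.

End weak_wave.

(** * Density of the range *)

Section smooth_linear.
Context (R : realType) (n : nat).
Implicit Types f g : 'rV[R]_n -> R.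

Lemma smoothD f g : smooth f -> smooth g -> smooth (fun x => f x + g x).
Proof.
move=> sf sg s.
have -> : iter_partial s (fun x => f x + g x) =
    (fun x => iter_partial s f x + iter_partial s g x).
  elim: s => //= i s ->; apply/funext => x.
  exact: (deriveD ((sf s).2 i x) ((sg s).2 i x)).
split=> [x|i x]; first exact: (continuousD ((sf s).1 x) ((sg s).1 x)).
exact: (derivableD ((sf s).2 i x) ((sg s).2 i x)).
Qed.

Lemma smoothZ k f : smooth f -> smooth (fun x => k * f x).
Proof.
move=> sf s.
have Z g i x : derivable g x (delta_mx ord0 i) ->
    derivable (fun x => k * g x) x (delta_mx ord0 i) /\
    partial i (fun x => k * g x) x = k * partial i g x.
  move=> dg; have dk : derivable (cst k : 'rV[R]_n -> R) x (delta_mx ord0 i).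
    exact: derivable_cst.
  split; first exact: (derivableM dk dg).
  have := deriveM dk dg; rewrite derive_cst scaler0 addr0; exact.
have -> : iter_partial s (fun x => k * f x) = (fun x => k * iter_partial s f x).
  elim: s => //= i s ->; apply/funext => x.
  exact: (Z _ _ _ ((sf s).2 i x)).2.
split=> [x|i x]; last exact: (Z _ _ _ ((sf s).2 i x)).1.
exact: (continuousM (@cst_continuous _ _ k x) ((sf s).1 x)).
Qed.

Lemma smooth_up_to_boundaryD U f g : smooth_up_to_boundary U f ->
  smooth_up_to_boundary U g -> smooth_up_to_boundary U (fun x => f x + g x).
Proof.
move=> [F [sF cF _] fF] [G [sG cG _] gG].
exists (fun x => F x + G x); last by move=> x Ux; rewrite fF// gG.
split; [exact: smoothD| |by []].
apply: (subclosed_compact _ (compactU cF cG)); first exact: closed_closure.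
rewrite /tsupport -closureU; apply: closure_subset => x /=.
apply: contraPP => /not_orP[/negP/negPn/eqP -> /negP/negPn/eqP ->].
by rewrite addr0 eqxx.
Qed.

Lemma smooth_up_to_boundaryZ U k f : smooth_up_to_boundary U f ->
  smooth_up_to_boundary U (fun x => k * f x).
Proof.
move=> [F [sF cF _] fF].
exists (fun x => k * F x); last by move=> x Ux; rewrite fF.
split; [exact: smoothZ| |by []].
apply: (subclosed_compact _ cF); first exact: closed_closure.
apply: closure_subset => x /=.
by apply: contraNN => /eqP ->; rewrite mulr0.
Qed.

Lemma prodf_scale (h h' : 'I_n -> R -> R) i b (x : 'rV[R]_n) :
  h' i (x ord0 i) = b * h i (x ord0 i) ->
  (forall k, k != i -> h' k (x ord0 k) = h k (x ord0 k)) ->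
  prodf h' x = b * prodf h x.
Proof.
move=> hi hk; rewrite /prodf (bigD1 i)//= [in RHS](bigD1 i)//= mulrA -hi.
by congr (_ * _); apply: eq_bigr => k /hk.
Qed.

Lemma closure_box_sub (l : 'I_n -> R) :
  closure (box l) `<=` [set x : 'rV[R]_n | forall k, 0 <= x ord0 k <= l k].
Proof.
rewrite [X in _ `<=` X]((closure_id _).1 (@closed_box R n (fun=> 0) l)).
by apply: closure_subset => x lx k; have /andP[? ?] := lx k; rewrite !ltW.
Qed.

(** Each factor is multiplied by a cutoff equal to 1 on [0, l_k], which provides the compactly
    supported extension. *)
Lemma smooth_up_to_boundary_prodf (l : 'I_n -> R) (h : 'I_n -> R -> R) :
  (forall k, smooth1 (h k)) -> smooth_up_to_boundary (box l) (prodf h).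
Proof.
move=> sh.
have [chi Hchi] := choice (fun k => exists_cutoff (l k)).
exists (prodf (fun k s => h k s * chi k s)).
  apply: (@test_fun_prodf _ _ _ (fun=> -1) (fun k => l k + 1)) => //.
    by move=> k; apply: smooth1M => //; have [] := Hchi k.
  move=> k s; rewrite mulf_eq0 negb_or => /andP[_]; have [_ _] := Hchi k; exact.
move=> x /set_mem clx; rewrite /prodf; apply: eq_bigr => k _.
have [_ -> //] := Hchi k; first by rewrite mulr1.
exact: (closure_box_sub clx).
Qed.

End smooth_linear.

(** * Modes: divided powers in time, sines and cosines in space *)

Section modes.
Context (R : realType) (d : nat) (c t0 : R).
Implicit Types (kap : 'I_d -> R) (Y : 'I_d.+1 -> R) (F G : vfun R d).

(** Divided powers: derivation lowers p without a factor, and [tau p] vanishes at t0 exactly when p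
    > 0. *)
Definition tau (p : nat) (s : R) : R := (s - t0) ^+ p / p`!%:R.

Lemma smooth1_tau p : smooth1 (tau p).
Proof.
rewrite /tau; under eq_fun do rewrite mulrC.
apply: smooth1M; first exact: smooth1_cst.
elim: p => [|p IH]; first by under eq_fun do rewrite expr0; exact: smooth1_cst.
under eq_fun do rewrite exprS; apply: smooth1M => //.
by have := smooth1_affine 1 (- t0); under eq_fun do rewrite mul1r.
Qed.

Lemma derive1_tau p : derive1 (tau p.+1) = tau p.
Proof.
apply/funext => s; rewrite /tau.
pose q : {poly R} := (p.+1)`!%:R^-1 *: ('X - t0%:P) ^+ p.+1.
rewrite (_ : (fun s : R => _) = horner q); last first.
  by apply/funext => x; rewrite !hornerE/= mulrC.
rewrite derive1E (@derive_val _ _ _ _ _ _ _ (is_derive_poly q s)).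
rewrite /q derivZ deriv_exp derivB derivX derivC subr0 mul1r.
rewrite hornerZ hornerMn !hornerE/= factS natrM invfM -mulr_natr.
have p0 : p.+1%:R != 0 :> R by rewrite pnatr_eq0.
have f0 : p`!%:R != 0 :> R by rewrite pnatr_eq0 -lt0n fact_gt0.
rewrite mul1r -[(s - t0) ^+ p *+ _]mulr_natr; move: p0 f0.
by move: (p.+1%:R) (p`!%:R) => b e b0 e0; field; rewrite b0 e0.
Qed.

Lemma derive1_sincos (k s : R) :
  derive1 (fun s => sin (k * s)) s = k * cos (k * s) /\
  derive1 (fun s => cos (k * s)) s = - k * sin (k * s).
Proof.
have d1 := derive1_scale k (@derivable_id _ _ s (1 : R)).
have E : derive1 (fun s : R => k * s) s = k.
  by rewrite d1.2 derive1E derive_id mulr1.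
have [ss sc] := smooth1_sin_cos R.
split.
  rewrite (@derive1_comp _ (fun s => k * s) sin); [|exact: d1.1|exact:
      smooth1_derivable].
  by rewrite E derive1E derive_val mulrC.
rewrite (@derive1_comp _ (fun s => k * s) cos); [|exact: d1.1|exact:
    smooth1_derivable].
by rewrite E derive1E derive_val mulrC mulrN mulNr.
Qed.

(** Here j is the component that the mode serves. For u_mu all spatial factors are sines, which
    vanish on the lateral faces; for the i-th component of u_q the factor in x_i is a cosine.
    Gradient and divergence exchange these families. *)
Definition mode_factor p kap (j k : 'I_d.+1) : R -> R :=
  if unlift ord_max k is Some i then
    if k == j then fun s => cos (kap i * s) else fun s => sin (kap i * s)
  else tau p.

Definition mode p kap j : 'rV[R]_d.+1 -> R := prodf (mode_factor p kap j).

Lemma mode_factor_max p kap j : mode_factor p kap j ord_max = tau p.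
Proof. by rewrite /mode_factor unlift_none. Qed.

Lemma mode_factor_lift p kap j i : mode_factor p kap j (lift ord_max i) =
  if lift ord_max i == j then fun s => cos (kap i * s) else fun s => sin (kap i
      * s).
Proof. by rewrite /mode_factor liftK. Qed.

Lemma smooth1_mode_factor p kap j k : smooth1 (mode_factor p kap j k).
Proof.
have sl i : smooth1 (fun s : R => kap i * s).
  by apply: smooth1M; [exact: smooth1_cst|exact: smooth1_id].
have [ss sc] := smooth1_sin_cos R.
have [i ->|->] := unliftP ord_max k; rewrite ?mode_factor_lift ?mode_factor_max.
  by case: ifP => _; exact: smooth1_comp.
exact: smooth1_tau.
Qed.

Lemma C1_mode p kap j : C1 (mode p kap j).
Proof. by apply: smooth_C1; apply: smooth_prodf => k; exact:
    smooth1_mode_factor. Qed.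

Let partial_mode p kap j i x : partial i (mode p kap j) x =
  prodf (derive_factor i (mode_factor p kap j)) x.
Proof. by apply: (derive_prodf _).2; apply: smooth1_derivable; exact:
    smooth1_mode_factor. Qed.

Lemma partial_mode_time p kap j : partial ord_max (mode p.+1 kap j) = mode p kap j.
Proof.
apply/funext => x; rewrite partial_mode; apply: eq_bigr => k _.
rewrite /derive_factor; have [i ->|->] := unliftP ord_max k.
  by rewrite lift_eqF !mode_factor_lift.
by rewrite eqxx !mode_factor_max derive1_tau.
Qed.

Lemma partial_mode_max p kap i : partial (lift ord_max i) (mode p kap ord_max) =
  (fun x => kap i * mode p kap (lift ord_max i) x).
Proof.
apply/funext => x; rewrite partial_mode; apply: (prodf_scale (i := lift ord_max i)).
  by rewrite /derive_factor eqxx !mode_factor_lift eqxx lift_eqF (derive1_sincos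
      _ _).1.
move=> k ki; rewrite /derive_factor (negbTE ki); move: ki.
have [j ->|->] := unliftP ord_max k; rewrite ?mode_factor_lift ?mode_factor_max//.
by move=> /negbTE ->; rewrite lift_eqF.
Qed.

Lemma partial_mode_lift p kap i : partial (lift ord_max i) (mode p kap (lift
    ord_max i)) =
  (fun x => - kap i * mode p kap ord_max x).
Proof.
apply/funext => x; rewrite partial_mode; apply: (prodf_scale (i := lift ord_max i)).
  by rewrite /derive_factor eqxx !mode_factor_lift eqxx lift_eqF (derive1_sincos
      _ _).2.
move=> k ki; rewrite /derive_factor (negbTE ki); move: ki.
have [j ->|->] := unliftP ord_max k; rewrite ?mode_factor_lift ?mode_factor_max//.
by move=> /negbTE ->; rewrite lift_eqF.
Qed.

Definition mode_field p kap Y : vfun R d := fun x => \row_k (Y k * mode p kap k x).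

Lemma component_mode_field p kap Y k :
  component (mode_field p kap Y) k = (fun x => Y k * mode p kap k x).
Proof. by apply/funext => x; rewrite /component mxE. Qed.

Lemma vC1_mode_field p kap Y : vC1 (mode_field p kap Y).
Proof. by move=> k; rewrite component_mode_field; exact: (C1Z _ (C1_mode _ _
    _)).1. Qed.

(* The spatial part of the wave operator on the span of the modes of frequency
   [kap]. *)
Definition mode_matrix kap Y : 'I_d.+1 -> R := fun k =>
  if unlift ord_max k is Some i then kap i * Y ord_max
  else - \sum_(i < d) kap i * Y (lift ord_max i).

Lemma classical_wave_mode_field p kap Y : classical_wave c (mode_field p.+1 kap Y) =
  mode_field p kap Y - c *: mode_field p.+1 kap (mode_matrix kap Y).
Proof.
have pE q i k : partial i (component (mode_field q kap Y) k) =
    (fun x => Y k * partial i (mode q kap k) x).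
  by rewrite component_mode_field (C1Z _ (C1_mode _ _ _)).2.
apply/funext => x; apply/rowP => k.
have -> : (mode_field p kap Y - c *: mode_field p.+1 kap (mode_matrix kap Y)) x
    ord0 k =
    Y k * mode p kap k x - c * (mode_matrix kap Y k * mode p.+1 kap k x).
  by rewrite !mxE.
have [i ->|->] := unliftP ord_max k.
  rewrite classical_wave_lift !pE partial_mode_time partial_mode_max.
  by rewrite /mode_matrix liftK; ring.
rewrite classical_wave_max !pE partial_mode_time /mode_matrix unlift_none.
congr (_ - c * _); rewrite -sumrN mulr_suml; apply: eq_bigr => i _.
by rewrite pE partial_mode_lift; ring.
Qed.

End modes.

Section wave_range.
Context (R : realType) (d : nat) (c T : R) (a : 'I_d -> R) (t0 : R).
Hypotheses (T_gt0 : 0 < T) (a_gt0 : forall i, 0 < a i).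
Hypothesis t0E : t0 = 0 \/ t0 = T.
Implicit Types (u v g F G : vfun R d) (x : 'rV[R]_d.+1).
Implicit Types (kap : 'I_d -> R) (Y : 'I_d.+1 -> R).

Local Notation Om := (Omega T a).
Local Notation mu := (lebesgue_rV R d.+1).
Local Notation inner := (inner Om).
Local Notation vL2 := (vL2 Om).
Local Notation A := (classical_wave c).
Local Notation mode := (mode t0).
Local Notation mode_field := (mode_field t0).

Let mOm : measurable Om := measurable_Omega T a.

(* The boundary conditions of calV for t0 = 0, of calVstar for t0 = T, imposed
   on the whole hyperplanes containing the faces. *)
Definition admissible F := [/\ vC1 F,
  forall k, smooth_up_to_boundary Om (component F k),
  forall x, x ord0 ord_max = t0 -> F x = 0 &
  forall x i, x ord0 (lift ord_max i) = 0 \/ x ord0 (lift ord_max i) = a i ->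
    F x ord0 ord_max = 0].

Lemma componentD F G k : component (F + G) k = (fun x => component F k x +
    component G k x).
Proof. by apply/funext => x; rewrite /component !mxE. Qed.

Lemma componentZ s F k : component (s *: F) k = (fun x => s * component F k x).
Proof. by apply/funext => x; rewrite /component !mxE. Qed.

Lemma admissibleD F G : admissible F -> admissible G -> admissible (F + G).
Proof.
move=> [CF SF F0 Fb] [CG SG G0 Gb]; split.
- by move=> k; rewrite componentD; exact: C1D.
- by move=> k; rewrite componentD; exact: smooth_up_to_boundaryD.
- by move=> x xt; rewrite -[LHS]/(F x + G x) F0// G0// addr0.
- by move=> x i xi; rewrite mxE (Fb x i)// (Gb x i)// addr0.
Qed.

Lemma admissibleZ s F : admissible F -> admissible (s *: F).
Proof.
move=> [CF SF F0 Fb]; split.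
- by move=> k; rewrite componentZ; exact: (C1Z _ _).1.
- by move=> k; rewrite componentZ; exact: smooth_up_to_boundaryZ.
- by move=> x xt; rewrite -[LHS]/(s *: F x) F0// scaler0.
- by move=> x i xi; rewrite mxE (Fb x i)// mulr0.
Qed.

Lemma classical_waveD F G : vC1 F -> vC1 G -> A (F + G) = A F + A G.
Proof.
move=> CF CG; have pE i k x : partial i (component (F + G) k) x =
    partial i (component F k) x + partial i (component G k) x.
  by rewrite componentD partialD.
apply/funext => x; apply/rowP => k.
rewrite -[X in _ = X]/((A F x + A G x) ord0 k) [RHS]mxE.
have [i ->|->] := unliftP ord_max k.
  by rewrite !classical_wave_lift !pE; ring.
rewrite !classical_wave_max pE; under eq_bigr do rewrite pE.
by rewrite big_split/=; ring.
Qed.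

Lemma classical_waveZ s F : vC1 F -> A (s *: F) = s *: A F.
Proof.
move=> CF; have pE i k x : partial i (component (s *: F) k) x =
    s * partial i (component F k) x.
  by rewrite componentZ (C1Z _ (CF k)).2.
apply/funext => x; apply/rowP => k.
rewrite -[X in _ = X]/((s *: A F x) ord0 k) [RHS]mxE.
have [i ->|->] := unliftP ord_max k.
  by rewrite !classical_wave_lift !pE; ring.
rewrite !classical_wave_max pE; under eq_bigr do rewrite pE.
by rewrite -mulr_sumr; ring.
Qed.

(** That is, each kap_i is an integer multiple of pi / a_i. *)
Definition resonant kap := forall i, sin (kap i * a i) = 0.

(** The degree in time is [p.+1] so that the field vanishes at t0; resonance makes the sines of u_mu
    vanish on the far faces. *)
Lemma admissible_mode_field p kap Y : resonant kap -> admissible (mode_field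
    p.+1 kap Y).
Proof.
move=> rk; split.
- exact: vC1_mode_field.
- move=> k; rewrite component_mode_field; apply: smooth_up_to_boundaryZ.
  rewrite Omega_box; apply: smooth_up_to_boundary_prodf => j.
  exact: smooth1_mode_factor.
- move=> x xt; apply/rowP => k; rewrite !mxE /mode /prodf (bigD1 ord_max)//=.
  by rewrite mode_factor_max /tau xt subrr exprS !mul0r mulr0.
- move=> x i xi; rewrite mxE /mode /prodf (bigD1 (lift ord_max i))//=.
  rewrite mode_factor_lift lift_eqF.
  by case: xi => ->; rewrite ?rk ?mulr0 ?sin0 !mul0r ?mulr0.
Qed.

Lemma innerD_le u v : vL2 u -> vL2 v ->
  inner (u + v) (u + v) <= 2 * inner u u + 2 * inner v v.
Proof.
move=> uL vL; have uvL := vL2D mOm uL vL.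
have := inner_ge0 Om (u - v).
rewrite !(innerBl, innerBr, innerDl, innerDr)//; try exact: vL2B.
rewrite (innerC _ v u); move: (inner u u) (inner u v) (inner v v) => X Y Z; lra.
Qed.

Lemma lt_of_halves (x y z e : R) :
  z <= 2 * x + 2 * y -> x < e / 4 -> y < e / 4 -> z < e.
Proof. by move=> *; lra. Qed.

Definition range_closure : set (vfun R d) := [set f | vL2 f /\
  forall e, 0 < e -> exists2 F, admissible F & inner (f - A F) (f - A F) < e].

Lemma admissible_vL2_wave F : admissible F -> vL2 (A F).
Proof. by move=> [CF _ _ _]; exact: vL2_classical_wave. Qed.

Lemma range_closureD f g : range_closure f -> range_closure g -> range_closure
    (f + g).
Proof.
move=> [fL cf] [gL cg]; split; first exact: vL2D.
move=> e e0; have e4 : 0 < e / 4 by lra.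
have [F aF Fe] := cf _ e4; have [G aG Ge] := cg _ e4.
exists (F + G); first exact: admissibleD.
have [CF _ _ _] := aF; have [CG _ _ _] := aG.
rewrite classical_waveD// opprD addrACA.
have H := innerD_le (vL2B mOm fL (admissible_vL2_wave aF)) (vL2B mOm gL
    (admissible_vL2_wave aG)).
exact: (lt_of_halves H Fe Ge).
Qed.

Lemma range_closureZ s f : range_closure f -> range_closure (s *: f).
Proof.
move=> [fL cf]; split; first exact: vL2Z.
move=> e e0; have k1 : 0 < s ^+ 2 + 1 by have := sqr_ge0 s; lra.
have [F aF Fe] := cf _ (divr_gt0 e0 k1).
exists (s *: F); first exact: admissibleZ.
have [CF _ _ _] := aF; have wL := vL2B mOm fL (admissible_vL2_wave aF).
rewrite classical_waveZ// -scalerBr innerZl ?innerZr//; last exact: vL2Z.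
move: Fe; rewrite ltr_pdivlMr// => Fe; apply: le_lt_trans Fe.
have := inner_ge0 Om (f - A F); move: (inner (f - A F) (f - A F)) => X X0.
rewrite mulrA -expr2; nra.
Qed.

Lemma range_closure_closed f : vL2 f ->
  (forall e, 0 < e -> exists2 h, range_closure h & inner (f - h) (f - h) < e) ->
  range_closure f.
Proof.
move=> fL H; split => // e e0; have e4 : 0 < e / 4 by lra.
have [h [hL ch] he] := H _ e4; have [F aF Fe] := ch _ e4; exists F => //.
have -> : f - A F = (f - h) + (h - A F) by rewrite addrA subrK.
have hle := innerD_le (vL2B mOm fL hL) (vL2B mOm hL (admissible_vL2_wave aF)).
exact: (lt_of_halves hle he Fe).
Qed.

Lemma time_dist x : Om x -> `|x ord0 ord_max - t0| <= T.
Proof.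
rewrite Omega_box => /(_ ord_max); rewrite side_max => /andP[x0 xT].
by rewrite ler_norml; apply/andP; case: t0E => ->; split; lra.
Qed.

Lemma mode_le p kap j x : Om x -> `|mode p kap j x| <= T ^+ p / p`!%:R.
Proof.
move=> Ox; rewrite /mode /prodf (bigD1 ord_max)//= normrM -[leRHS]mulr1.
apply: ler_pM => //.
  rewrite mode_factor_max /tau normrM normrX normfV normr_nat.
  rewrite ler_wpM2r ?invr_ge0// lerXn2r ?nnegrE//; first exact: ltW.
  exact: time_dist.
rewrite normr_prod prodr_ile1// => k; have [i ->|->] := unliftP ord_max k; last
    by rewrite eqxx.
rewrite normr_ge0/= mode_factor_lift => _; rewrite ler_norml.
by case: ifP => _; rewrite ?cos_le1 ?cos_geN1 ?sin_le1 ?sin_geN1.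
Qed.

Let vol : R := fine (mu Om).

Lemma inner_mode_field_le p kap Y (B : R) : (forall k, `|Y k| <= B) ->
  inner (mode_field p kap Y) (mode_field p kap Y) <=
  d.+1%:R * vol * (B * (T ^+ p / p`!%:R)) ^+ 2.
Proof.
move=> YB; have fL := vC1_vL2 T a (vC1_mode_field t0 p kap Y).
pose b := (B * (T ^+ p / p`!%:R)) ^+ 2.
have -> : d.+1%:R * vol * b = \int[mu]_(x in Om) (cst (d.+1%:R * b) x).
  by rewrite Rintegral_cst//; rewrite /vol; ring.
have cf k : continuous (component (mode_field p kap Y) k).
  by have [] := vC1_mode_field t0 p kap Y k.
rewrite /inner; apply: le_Rintegral => //.
- rewrite Omega_box; apply: continuous_integrable_box; apply: continuous_sum_fun
    => k x.
  exact: (continuousM (cf k x) (cf k x)).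
- by rewrite Omega_box; apply: continuous_integrable_box; exact: cst_continuous.
- move=> x Ox; rewrite /= -[d.+1 in leRHS]card_ord mulr_natl -sumr_const.
  apply: ler_sum => k _; rewrite mxE -expr2 -(real_normK (num_real (_ * _))).
  have B0 : 0 <= B := le_trans (normr_ge0 _) (YB k).
  have Tp : 0 <= T ^+ p / p`!%:R by rewrite divr_ge0// exprn_ge0// ltW.
  rewrite normrM /b lerXn2r ?nnegrE ?(mulr_ge0 B0 Tp) ?mulr_ge0//.
  by apply: ler_pM => //; exact: mode_le.
Qed.

Lemma mode_matrix_le kap Y (B : R) k : (forall k, `|Y k| <= B) ->
  `|mode_matrix kap Y k| <= (\sum_i `|kap i|) * B.
Proof.
move=> YB; rewrite /mode_matrix; case: unliftP => [i _|_].
  rewrite normrM ler_pM// (bigD1 i)//= lerDl.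
  by apply: sumr_ge0.
rewrite normrN mulr_suml; apply: (le_trans (ler_norm_sum _ _ _)).
by apply: ler_sum => i _; rewrite normrM ler_wpM2l.
Qed.

(* Neumann series: modulo the range of [A], a mode of time degree p equals
   c times a mode of the same frequency and time degree p + 1. *)
Lemma mode_field_iter p kap Y N : resonant kap -> exists2 F, admissible F &
  mode_field p kap Y - A F =
  c ^+ N *: mode_field (p + N) kap (iter N (mode_matrix kap) Y).
Proof.
move=> rk; elim: N => [|N [F aF FE]].
  (* The zero field, written so that its admissibility is inherited. *)
  exists (0 *: mode_field 1 kap Y); first by apply: admissibleZ; exact:
      admissible_mode_field.
  rewrite classical_waveZ; last exact: vC1_mode_field.
  by rewrite scale0r subr0 expr0 scale1r addn0.
set YN := iter N (mode_matrix kap) Y in FE *.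
have aN : admissible (mode_field (p + N).+1 kap YN) by exact: admissible_mode_field.
exists (F + c ^+ N *: mode_field (p + N).+1 kap YN).
  by apply: admissibleD => //; exact: admissibleZ.
have [CF _ _ _] := aF; have CN := vC1_mode_field t0 (p + N).+1 kap YN.
rewrite classical_waveD//; last by have [] := admissibleZ (c ^+ N) aN.
rewrite classical_waveZ// classical_wave_mode_field opprD addrA FE.
by rewrite -scalerBr opprB addrCA subrr addr0 scalerA -exprSr addnS.
Qed.

(** Brings the size of the Neumann remainder to the form Z^(p + N) / (p + N)!, a term of one
    exponential series. Adding 1 to each base makes it at least 1, so the exponent N can be raised
    to p + N. *)
Lemma neumann_term_le (x K B t f : R) p N :
  0 <= x -> 0 <= K -> 0 <= B -> 0 <= t -> 0 <= f ->
  x ^+ N * (K ^+ N * B * (t ^+ (p + N) / f)) <=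
  B * (((x * K + 1) * (t + 1)) ^+ (p + N) / f).
Proof.
move=> x0 K0 B0 tge0 f0; have xK : 0 <= x * K by rewrite mulr_ge0.
rewrite (_ : x ^+ N * _ = B * ((x * K) ^+ N * t ^+ (p + N) / f)); last first.
  by rewrite exprMn; ring.
rewrite ler_wpM2l// ler_wpM2r ?invr_ge0// [leRHS]exprMn ler_pM ?exprn_ge0//;
    last first.
  by rewrite lerXn2r ?nnegrE ?addr_ge0// lerDl.
apply: (@le_trans _ _ ((x * K + 1) ^+ N)).
  by rewrite lerXn2r ?nnegrE ?addr_ge0// lerDl.
by rewrite exprD ler_peMl ?exprn_ge0 ?addr_ge0// exprn_ege1// lerDr.
Qed.

Lemma range_closure_mode_field p kap Y : resonant kap ->
  range_closure (mode_field p kap Y).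
Proof.
move=> rk; split; first exact: (vC1_vL2 T a (vC1_mode_field t0 p kap Y)).
pose B : R := \sum_k `|Y k|; pose K : R := \sum_i `|kap i|.
have YB k : `|Y k| <= B.
  by rewrite /B (bigD1 k)//= lerDl; apply: sumr_ge0.
have K0 : 0 <= K by apply: sumr_ge0.
have B0 : 0 <= B by apply: sumr_ge0.
have iterB N k : `|iter N (mode_matrix kap) Y k| <= K ^+ N * B.
  elim: N k => [|N IH] k; first by rewrite expr0 mul1r.
  by rewrite iterS exprS -mulrA; exact: mode_matrix_le.
pose Z : R := (`|c| * K + 1) * (T + 1).
have cK : 0 <= `|c| * K by rewrite mulr_ge0.
have Z0 : 0 <= Z by rewrite /Z mulr_ge0 ?addr_ge0// ltW.
(* The terms of the convergent exponential series tend to 0; here n stands for p + N. *)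
have cZ : (fun n => d.+1%:R * vol * (B * exp_coeff Z n) ^+ 2) @ \oo --> (0 : R).
  have e0 := cvg_series_cvg_0 (is_cvg_series_exp_coeff Z).
  have -> : 0 = d.+1%:R * vol * (B * 0) ^+ 2 :> R by rewrite mulr0 expr0n/= mulr0.
  have e1 : (fun n => B * exp_coeff Z n) @ \oo --> B * 0.
    by apply: cvgM; [exact: cvg_cst|exact: e0].
  rewrite expr2; under eq_fun do rewrite expr2.
  by apply: cvgM; [exact: cvg_cst|apply: cvgM; exact: e1].
move=> e e0; have /cvgr0Pnorm_lt/(_ e e0)[N _ HN] := cZ.
have [F aF FE] := mode_field_iter p Y N rk; exists F => //; rewrite FE.
have fL := vC1_vL2 T a (vC1_mode_field t0 (p + N) kap (iter N (mode_matrix kap) Y)).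
rewrite innerZl// ?innerZr//; last exact: vL2Z.
rewrite mulrA -expr2.
have := inner_mode_field_le (p + N) kap (iterB N).
move: (inner _ _) => X XB.
have := HN (p + N)%N (leq_addl _ _).
apply: le_lt_trans; apply: le_trans (ler_norm _).
apply: (le_trans (ler_wpM2l (sqr_ge0 _) XB)).
rewrite mulrCA; apply: ler_wpM2l; first by rewrite mulr_ge0// /vol fine_ge0.
rewrite -exprMn -[leLHS]real_normK ?num_real// lerXn2r ?nnegrE//.
  by rewrite mulr_ge0// /exp_coeff/= divr_ge0// exprn_ge0.
have Tp : 0 <= T ^+ (p + N) / (p + N)`!%:R by rewrite divr_ge0// exprn_ge0// ltW.
rewrite normrM normrX (ger0_norm (mulr_ge0 (mulr_ge0 (exprn_ge0 _ K0) B0) Tp)).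
exact: (neumann_term_le p N (normr_ge0 c) K0 B0 (ltW T_gt0) (ler0n _ _)).
Qed.

End wave_range.

(** * Completeness of the modes *)

Section wave_range_dense.
Context (R : realType) (d : nat) (c T : R) (a : 'I_d -> R) (t0 : R).
Hypotheses (T_gt0 : 0 < T) (a_gt0 : forall i, 0 < a i).
Hypothesis t0E : t0 = 0 \/ t0 = T.
Implicit Types (kap : 'I_d -> R) (j : 'I_d.+1) (f : 'rV[R]_d.+1 -> R).

Local Notation Om := (Omega T a).
Local Notation mu := (lebesgue_rV R d.+1).
Local Notation inner := (inner Om).
Local Notation vL2 := (vL2 Om).
Local Notation mode := (mode t0).
Local Notation D := (box (side T a)).
Local Notation RC := (range_closure c T a t0).

Let mOm : measurable Om := measurable_Omega T a.
Let mD : measurable D := measurable_box (side T a).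

Definition modes j : set ('rV[R]_d.+1 -> R) :=
  [set f | exists p kap, resonant a kap /\ f = mode p kap j].

Let modes_sqi j : modes j `<=` sq_integrable mu D.
Proof.
by move=> _ [p [kap [_ ->]]]; apply: continuous_sq_integrable; have [] :=
    C1_mode t0 p kap j.
Qed.

Let multD j := multiplierD mD (span_sq_integrable (@modes_sqi j)) (@span_add _ _ _).
Let mult_cst j := multiplier_cst mD (span_sq_integrable (@modes_sqi j))
    (@span_scale _ _ (modes j)).
Let multZ j := multiplierZ mD (span_sq_integrable (@modes_sqi j)) (@span_scale _
    _ (modes j)).
Let mult_gt0 j := multiplier_gt0 mD (span_sq_integrable (@modes_sqi j))
  (@span_add _ _ _) (@span_scale _ _ (modes j)).

(** Multiplication by t - t0 maps [tau p] to (p + 1) [tau p.+1]; the constant t0 - s then moves the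
    threshold to s. *)
Let multiplier_time j s :
  multiplier mu D (span (modes j)) \1_[set x : 'rV[R]_d.+1 | s < x ord0 ord_max].
Proof.
rewrite (_ : [set x : 'rV[R]_d.+1 | _] =
    [set x : 'rV[R]_d.+1 | 0 < (1 * x ord0 ord_max + - t0) + cst (t0 - s) x]).
  apply: mult_gt0; apply: multD; last exact: mult_cst.
  apply: (span_multiplier (@modes_sqi j)).
    exact: (@continuous_coord R _ (fun t => 1 * t + - t0) ord_max
      (smooth1_continuous (smooth1_affine 1 (- t0)))).
  move=> _ [p [kap [rk ->]]].
  rewrite (_ : (fun x => _) = (fun x => p.+1%:R * mode p.+1 kap j x)).
    by apply: span_scale; apply: span_in; exists p.+1, kap.
  have p0 : p.+1%:R != 0 :> R by rewrite pnatr_eq0.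
  apply/funext => x; apply/esym; rewrite /mode.
  rewrite (@prodf_scale _ _ (mode_factor t0 p kap j) _ ord_max (p.+1%:R^-1 * (1
      * x ord0 ord_max + - t0))).
  - by rewrite mulrA mulVKf.
  - rewrite !mode_factor_max /tau exprS factS natrM invfM mul1r; ring.
  - move=> k; have [i ->|->] := unliftP ord_max k; last by rewrite eqxx.
    by rewrite !mode_factor_lift.
by apply/seteqP; split=> x /=; rewrite mul1r => H; lra.
Qed.

Let shift_freq kap i (s : R) : 'I_d -> R :=
  fun k => if k == i then kap k + s * (pi / a i) else kap k.

Let resonant_shift kap i s : s = 1 \/ s = -1 -> resonant a kap ->
  resonant a (shift_freq kap i s).
Proof.
move=> s1 rk k; rewrite /shift_freq; case: eqVneq => [->|_]; last exact: rk.
have ai0 : a i != 0 by rewrite gt_eqF.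
rewrite mulrDl -mulrA divfK// sinD rk mul0r add0r.
by case: s1 => ->; rewrite ?mul1r ?mulN1r ?sinN sinpi ?oppr0 mulr0.
Qed.

(** By the product formulas, the product is half the sum of the modes with frequencies kap_i + pi /
    a_i and kap_i - pi / a_i, both resonant. *)
Let multiplier_cos j i :
  multiplier mu D (span (modes j)) (fun x => cos (pi / a i * x ord0 (lift
      ord_max i))).
Proof.
apply: (span_multiplier (@modes_sqi j)).
  apply: (@continuous_coord R _ (fun t => cos (pi / a i * t)) (lift ord_max i)).
  apply: smooth1_continuous; apply: smooth1_comp; first exact: (smooth1_sin_cos
      R).2.
  by apply: smooth1M; [exact: smooth1_cst|exact: smooth1_id].
move=> _ [p [kap [rk ->]]].
rewrite (_ : (fun x => _) = (fun x => 2^-1 * mode p (shift_freq kap i 1) j x +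
    2^-1 * mode p (shift_freq kap i (-1)) j x)).
  apply: span_add; apply: span_scale; apply: span_in.
    by exists p, (shift_freq kap i 1); split => //; apply: resonant_shift => //;
        left.
  by exists p, (shift_freq kap i (-1)); split => //; apply: resonant_shift =>
      //; right.
apply/funext => x; set y := x ord0 (lift ord_max i).
have E s : mode p (shift_freq kap i s) j x =
    mode_factor t0 p (shift_freq kap i s) j (lift ord_max i) y *
    \prod_(k < d.+1 | k != lift ord_max i) mode_factor t0 p kap j k (x ord0 k).
  rewrite /mode /prodf (bigD1 (lift ord_max i))//=; congr (_ * _).
  apply: eq_bigr => k; have [k' ->|->] := unliftP ord_max k.
    rewrite (inj_eq lift_inj) => /negbTE ki.
    by rewrite !mode_factor_lift /shift_freq ki.
  by rewrite !mode_factor_max.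
rewrite !E /mode /prodf (bigD1 (lift ord_max i))//= -/y !mode_factor_lift
    /shift_freq eqxx.
set P := \prod_(_ < _ | _) _.
have E1 : (kap i + 1 * (pi / a i)) * y = kap i * y + pi / a i * y by ring.
have E2 : (kap i + -1 * (pi / a i)) * y = kap i * y - pi / a i * y by ring.
case: ifP => _.
  by rewrite E1 E2 cosD cosB; field.
by rewrite E1 E2 sinD sinB; field.
Qed.

(** For 0 < s < a_i and x in the box, x_i > s means cos(pi x_i / a_i) < cos(pi s / a_i), since
    cosine decreases on [0, pi]. For other s the indicator is constant on the box. *)
Let multiplier_space j i s :
  multiplier mu D (span (modes j)) \1_[set x : 'rV[R]_d.+1 | s < x ord0 (lift
      ord_max i)].
Proof.
have box_i x : D x -> 0 < x ord0 (lift ord_max i) < a i.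
  by move=> /(_ (lift ord_max i)); rewrite side_lift.
have [s0|s0] := leP s 0.
  apply: (@eq_multiplier _ _ _ mu D mD _ (cst 1)); last exact: mult_cst.
  move=> x /set_mem/box_i/andP[x0 _]; rewrite indicE mem_set//=.
  exact: le_lt_trans x0.
have [sa|sa] := leP (a i) s.
  apply: (@eq_multiplier _ _ _ mu D mD _ (cst 0)); last exact: mult_cst.
  move=> x /set_mem/box_i/andP[_ xa]; rewrite indicE memNset//=.
  by apply/negP; rewrite -leNgt (le_trans (ltW xa)).
apply: (@eq_multiplier _ _ _ mu D mD _
  \1_[set x : 'rV[R]_d.+1 | 0 < cst (cos (pi / a i * s)) x +
      (-1) * cos (pi / a i * x ord0 (lift ord_max i))]); last first.
  by apply: mult_gt0; apply: multD; [exact: mult_cst|apply: multZ; exact: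
      multiplier_cos].
move=> x /set_mem/box_i/andP[x0 xa]; rewrite !indicE; congr (nat_of_bool _)%:R.
have w0 : 0 < pi / a i by rewrite divr_gt0// pi_gt0.
have win y : 0 < y < a i -> pi / a i * y \in `[0, pi].
  move=> /andP[y0 ya]; rewrite in_itv/= mulr_ge0 ?(ltW w0) ?(ltW y0)//=.
  by rewrite mulrAC ler_pdivrMr// ler_wpM2l ?pi_ge0// ltW.
apply/idP/idP => /set_mem H; apply/mem_set; move: H;
  by rewrite /= mulN1r subr_gt0 ltr_cos ?win ?x0 ?s0// ltr_pM2l.
Qed.

(** The lowest mode is positive: frequency 0 in the cosine direction, pi / a_i in the sine
    directions, degree 0 in time. *)
Let weight j :
  exists2 w, L2closure mu D (span (modes j)) w & forall x, D x -> 0 < w x.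
Proof.
pose kap i : R := if lift ord_max i == j then 0 else pi / a i.
exists (mode 0 kap j).
  apply: (subset_L2closure mD (span_sq_integrable (@modes_sqi j))); apply: span_in.
  exists 0%N, kap; split => // i; rewrite /kap; case: ifP => _; first by rewrite
      mul0r sin0.
  by rewrite divfK ?sinpi// gt_eqF.
move=> x Dx; apply: prodr_gt0 => k _; move: (Dx k); have [i ->|->] := unliftP
    ord_max k.
  rewrite side_lift => /andP[x0 xa]; rewrite mode_factor_lift /kap.
  case: (lift ord_max i == j) => /=; first by rewrite mul0r cos0.
  apply: sin_gt0_pi; rewrite mulr_gt0 ?divr_gt0 ?pi_gt0//=.
  by rewrite mulrAC ltr_pdivrMr// ltr_pM2l ?pi_gt0.
by rewrite mode_factor_max /tau expr0 fact0 invr1 mulr1.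
Qed.

Lemma L2closure_modes j : sq_integrable mu D `<=` L2closure mu D (span (modes j)).
Proof.
apply: L2closure_span_full; [exact: modes_sqi| |exact: weight].
move=> k s; have [i ->|->] := unliftP ord_max k; first exact: multiplier_space.
exact: multiplier_time.
Qed.

Lemma vL2_single j f : sq_integrable mu Om f -> vL2 (single j f).
Proof.
by move=> sf; apply/(vL2P mOm) => k; rewrite component_single; exact:
    sq_integrableZ.
Qed.

Lemma inner_single_single j f g : sq_integrable mu Om f -> sq_integrable mu Om g ->
  inner (single j f) (single j g) = ip mu Om f g.
Proof.
move=> sf sg; rewrite innerE; [|exact: mOm|exact: vL2_single..].
rewrite (bigD1 j)//= [X in _ + X]big1 => [|k kj].
  rewrite [LHS]addr0; apply: eq_ip => x _; rewrite component_single eqxx mul1r//.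
by apply: ip_eq0r => x; rewrite component_single (negbTE kj) mul0r.
Qed.

Lemma range_closure_single j f : sq_integrable mu Om f -> RC (single j f).
Proof.
move=> sf; have := sf; rewrite {1}Omega_box => /(L2closure_modes j)[_ cf].
have span_RC s : span (modes j) s -> RC (single j s).
  elim=> {s} [_ [p [kap [rk ->]]]|s t _ IH1 _ IH2|k s _ IH].
  (* With this amplitude vector the mode field has j as its only nonzero component. *)
  - have := range_closure_mode_field c T_gt0 t0E p (fun k => (k == j)%:R) rk.
    congr (RC _); apply/funext => x; apply/rowP => k.
    by rewrite !mxE eqxx/= mulrC; case: eqVneq => [->|]//; rewrite !mulr0.
  - rewrite (_ : single _ _ = single j s + single j t); first exact: range_closureD.
    by apply/funext => x; rewrite /single scalerDl.
  - rewrite (_ : single _ _ = k *: single j s); first exact: range_closureZ.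
    by apply/funext => x; rewrite /single -scalerA.
apply: range_closure_closed; first exact: vL2_single.
move=> e e0; have [s Ss se] := cf e e0.
have ss : sq_integrable mu Om s.
  by rewrite Omega_box; exact: (span_sq_integrable (@modes_sqi j) Ss).
exists (single j s); first exact: span_RC.
have -> : single j f - single j s = single j (fun x => f x - s x).
  by apply/funext => x; rewrite /single scalerBl.
have sfs := sq_integrableB mOm sf ss.
by rewrite inner_single_single//; move: se; rewrite -Omega_box.
Qed.

Lemma vL2_range_closure (f : vfun R d) : vL2 f -> RC f.
Proof.
move=> fL; have fS k : sq_integrable mu Om (component f k) by move/(vL2P mOm) : fL.
rewrite (_ : f = \sum_k single k (component f k)).
  elim: (index_enum _) => [|k s IH].
    rewrite big_nil -(scale0r (single ord_max (component f ord_max))).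
    by apply: range_closureZ => //; exact: range_closure_single.
  by rewrite big_cons; apply: range_closureD => //; exact: range_closure_single.
apply/funext => x; apply/rowP => k.
have -> : (\sum_k single k (component f k)) x = \sum_k single k (component f k) x.
  by elim: (index_enum _) => [|j s IH]; rewrite ?big_nil ?big_cons// -IH.
rewrite summxE (bigD1 k)//=.
rewrite /single /component !mxE !eqxx/= mulr1 big1 ?addr0// => j jk.
by rewrite !mxE eqxx/= eq_sym (negbTE jk) mulr0.
Qed.

End wave_range_dense.

(** * The energy estimate and the density theorem *)

Section closed_box.
Context (R : realType) (n : nat) (l : 'I_n -> R).
Hypothesis l_gt0 : forall k, 0 < l k.

Lemma open_box : open (box l).
Proof.
rewrite openE => x lx; exists (fun _ j => `]0, l j[%classic).
  move=> i j; rewrite ord1; apply: open_nbhs_nbhs; split; first exact: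
      interval_open.
  by rewrite /= in_itv; exact: lx.
by move=> y /= ly k; have := ly ord0 k; rewrite in_itv.
Qed.

(** A point of the closed box is the limit of points moved slightly towards the centre, which lie in
    the open box. *)
Lemma closure_box : closure (box l) = [set x | forall k, 0 <= x ord0 k <= l k].
Proof.
apply/seteqP; split; first exact: closure_box_sub.
move=> x lx B xB.
pose g (s : R) : 'rV[R]_n := \row_k (x ord0 k + s * (l k / 2 - x ord0 k)).
have cg : continuous g.
  apply: continuous_rV => k; under eq_fun do rewrite mxE.
  apply: smooth1_continuous; under eq_fun do rewrite addrC mulrC.
  exact: smooth1_affine.
have g0 : g 0 = x by apply/rowP => k; rewrite mxE mul0r addr0.
have : nbhs (g 0) B by rewrite g0.
move=> /(cg 0)/nbhs_ballP[e /= e0 eB].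
pose s := Num.min (e / 2) (1 / 2).
have s0 : 0 < s by rewrite lt_min !divr_gt0.
have s1 : s <= 1 / 2 by rewrite ge_min lexx orbT.
exists (g s); split.
  move=> k; rewrite mxE; have /andP[x0 xl] := lx k; have lk := l_gt0 k.
  by apply/andP; split; nra.
apply: eB; rewrite /ball/= sub0r normrN gtr0_norm//.
have : s <= e / 2 by rewrite ge_min lexx.
by move=> /le_lt_trans; apply; lra.
Qed.

End closed_box.

Section density.
Context (R : realType) (d : nat) (c T : R) (a : 'I_d -> R).
Hypotheses (T_gt0 : 0 < T) (a_gt0 : forall i, 0 < a i).
Implicit Types (u v w g F G : vfun R d) (p : 'rV[R]_d.+1).

Local Notation Om := (Omega T a).
Local Notation mu := (lebesgue_rV R d.+1).
Local Notation inner := (inner Om).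
Local Notation vL2 := (vL2 Om).
Local Notation normL2 := (normL2 Om).
Local Notation A := (classical_wave c).
Local Notation side := (side T a).

Let mOm : measurable Om := measurable_Omega T a.

Let Om_sub_closure : Om `<=` closure Om.
Proof. exact: subset_closure. Qed.

Lemma Omega0E : Omega0 a = box a.
Proof. by []. Qed.

Lemma Gamma_b_face p : Gamma_b T a p ->
  exists i, p ord0 (lift ord_max i) = 0 \/ p ord0 (lift ord_max i) = a i.
Proof.
move=> [[]]; rewrite Omega0E closure_box// => px nint _.
apply: contrapT => nex; apply: nint; have := @open_box R d a; rewrite openE; apply.
move=> k; have := px k; rewrite mxE => /andP[p0 pa].
rewrite !lt_neqAle eq_sym p0 pa !andbT; apply/andP.
by split; apply/eqP => E; apply: nex; exists k; auto.
Qed.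

Lemma face_Gamma_b p i : (forall k, k != lift ord_max i -> 0 < p ord0 k < side k) ->
  p ord0 (lift ord_max i) = 0 \/ p ord0 (lift ord_max i) = a i -> Gamma_b T a p.
Proof.
move=> pk pi; split.
  rewrite Omega0E closure_box//; split.
    move=> j; rewrite mxE; have [->|ji] := eqVneq j i.
      by case: pi => ->; rewrite lexx ltW.
    have := pk (lift ord_max j); rewrite (inj_eq lift_inj) side_lift => /(_
        ji)/andP[? ?].
    by rewrite !ltW.
  move=> /interior_subset/(_ i); rewrite mxE.
  by case: pi => ->; rewrite ltxx ?andbF.
have := pk ord_max; rewrite side_max eq_liftF => /(_ isT)/andP[? ?].
by rewrite /= in_itv/= !ltW.
Qed.

Lemma closed_box_closure_Omega p :
  (forall k, 0 <= p ord0 k <= side k) -> closure Om p.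
Proof. by move=> pk; rewrite Omega_box closure_box//; exact: side_gt0. Qed.

(* [calV] for t0 = 0, [calVstar] for t0 = T *)
Definition calV_at t0 : set (vfun R d) :=
  [set u | [/\ forall k, smooth_up_to_boundary Om (component u k),
               forall p, cylinder (Omega0 a) [set t0] p -> u p = 0 &
               forall p, Gamma_b T a p -> u p ord0 ord_max = 0]].

(** Weaker than [admissible]: the conditions hold only on the relative interiors of the faces, which
    is what elements of [calV_at] provide and what Green's formula needs. *)
Definition boundary_conditions t0 F := [/\ vC1 F,
  forall p, (forall k, k != ord_max -> 0 < p ord0 k < side k) ->
    p ord0 ord_max = t0 -> F p = 0 &
  forall i p, (forall k, k != lift ord_max i -> 0 < p ord0 k < side k) ->
    p ord0 (lift ord_max i) = 0 \/ p ord0 (lift ord_max i) = a i ->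
    F p ord0 ord_max = 0].

Lemma admissible_boundary t0 F : admissible T a t0 F -> boundary_conditions t0 F.
Proof.
move=> [CF _ F0 Fb]; split => // [p _|i p _ pi]; first exact: F0.
exact: Fb pi.
Qed.

Lemma admissible_calV t0 F : admissible T a t0 F -> calV_at t0 F.
Proof.
move=> [_ SF F0 Fb]; split => // [p [_ /F0]//|p /Gamma_b_face[i pi]].
exact: Fb pi.
Qed.

(** An element of [calV_at] is arbitrary off the closure, so it is replaced by a C^1 extension. The
    faces lie in the closure, so the boundary values carry over. *)
Lemma calV_extension t0 v : t0 = 0 \/ t0 = T -> calV_at t0 v ->
  exists2 F, boundary_conditions t0 F & {in Om, v =1 F}.
Proof.
move=> t0E [Sv v0 vb].
have H k : exists f, C1 f /\ {in closure Om, component v k =1 f}.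
  by have [f [/smooth_C1 Cf _ _] vf] := Sv k; exists f.
have [f Hf] := choice H.
pose F : vfun R d := fun p => \row_k f k p.
have FE k : component F k = f k by apply/funext => p; rewrite /component mxE.
have vF p : closure Om p -> v p = F p.
  by move=> Op; apply/rowP => k; rewrite mxE -(Hf k).2 ?inE.
exists F; last by move=> p /set_mem Op; apply: vF; exact: Om_sub_closure.
split.
- by move=> k; rewrite FE; exact: (Hf k).1.
- move=> p pk pt; rewrite -vF.
    apply: v0; split => //= i; rewrite mxE.
    by have := pk (lift ord_max i); rewrite lift_eqF side_lift; exact.
  apply: closed_box_closure_Omega => k; have [->|kn] := eqVneq k ord_max.
    by rewrite pt side_max; case: t0E => ->; rewrite lexx ltW.
  by have /andP[? ?] := pk k kn; rewrite !ltW.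
- move=> i p pk pi; rewrite -vF.
    by apply: vb; exact: face_Gamma_b pi.
  apply: closed_box_closure_Omega => k; have [->|kn] := eqVneq k (lift ord_max i).
    by rewrite side_lift; case: pi => ->; rewrite lexx ltW.
  by have /andP[? ?] := pk k kn; rewrite !ltW.
Qed.

(** On each time face one of the two fields vanishes; on the lateral faces both mu components
    vanish, and each flux term contains one of them. *)
Lemma Green_boundary t0 t1 F G :
  (t0 = 0 /\ t1 = T) \/ (t0 = T /\ t1 = 0) ->
  boundary_conditions t0 F -> boundary_conditions t1 G ->
  inner (A F) G + inner F (A G) = 0.
Proof.
move=> t01 [CF F0 Fb] [CG G0 Gb]; apply: Green => // [p pk pt|i p pk pi].
  have [Fp|Gp] : F p = 0 \/ G p = 0.
    by case: t01 => -[t0E t1E]; case: pt => pt;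
      [left; apply: F0|right; apply: G0|right; apply: G0|left; apply: F0];
      rewrite // ?t0E ?t1E.
  - by rewrite big1// => k _; rewrite Fp mxE mul0r.
  - by rewrite big1// => k _; rewrite Gp mxE mulr0.
by rewrite (Fb i p)// (Gb i p)// mul0r mulr0 addr0.
Qed.

(* Green's formula with [G = (t1 - t) F] reads
   [(F, F) = 2 (A F, (t1 - t) F)]. *)
Lemma energy_estimate t0 F : t0 = 0 \/ t0 = T -> boundary_conditions t0 F ->
  inner F F <= 4 * T ^+ 2 * inner (A F) (A F).
Proof.
(* [t1] is the other end of the time interval: the weight s vanishes where F is not known to vanish,
   and |s| <= T on the domain. *)
move=> t0E [CF F0 Fb]; pose t1 := T - t0; pose s p : R := t1 - p ord0 ord_max.
have [Cs ps] := C1_coord t1 (@ord_max d).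
pose G : vfun R d := fun p => s p *: F p.
pose H : vfun R d := fun p => s p *: A F p.
have GE k : component G k = (fun p => s p * component F k p).
  by apply/funext => p; rewrite /component mxE.
have CG : vC1 G by move=> k; rewrite GE; exact: C1M.
have AG : A G = H - F.
  have pE i k p : partial i (component G k) p = s p * partial i (component F k) p +
      component F k p * (- (i == ord_max)%:R).
    by rewrite GE partialM// ps.
  apply/funext => p; apply/rowP => k.
  have -> : (H - F) p ord0 k = s p * A F p ord0 k - F p ord0 k by rewrite !mxE.
  have [i ->|->] := unliftP ord_max k.
    rewrite !classical_wave_lift !pE lift_eqF eqxx mulr0n mulr1n /component; ring.
  rewrite !classical_wave_max pE eqxx mulr1n.
  under eq_bigr do rewrite pE lift_eqF mulr0n oppr0 mulr0 addr0.
  rewrite -mulr_sumr /component; ring.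
have FL := vC1_vL2 T a CF; have GL := vC1_vL2 T a CG.
have AFL := vL2_classical_wave c T a CF.
have HL : vL2 H.
  rewrite (_ : H = A G + F); last by rewrite AG subrK.
  exact: (vL2D mOm (vL2_classical_wave c T a CG) FL).
have green : inner (A F) G + inner F (A G) = 0.
  apply: Green => // [p pk pt|i p pk pi]; last first.
    have Fp := Fb i p pk pi; rewrite Fp mul0r add0r.
    by rewrite [G p _ _]mxE Fp !mulr0.
  rewrite big1// => k _; rewrite [G p _ _]mxE.
  have [->|sp] : F p = 0 \/ s p = 0; last by rewrite sp mul0r mulr0.
    rewrite /s /t1; case: t0E => t0E; case: pt => pt.
    - by left; apply: F0; rewrite ?pt.
    - by right; rewrite pt t0E subr0 subrr.
    - by right; rewrite pt t0E !subrr.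
    - by left; apply: F0; rewrite ?pt.
  by rewrite mxE mul0r.
have HF : inner F H = inner (A F) G.
  apply: eq_Rintegral => p _; apply: eq_bigr => k _.
  by rewrite [H p _ _]mxE [G p _ _]mxE; ring.
have GG : inner G G <= T ^+ 2 * inner F F.
  have cont u k : vC1 u -> continuous (component u k) by move=> /(_ k)[].
  have int u : vC1 u -> mu.-integrable Om (EFin \o (fun p => \sum_k u p ord0 k *
      u p ord0 k)).
    move=> Cu; rewrite Omega_box; apply: continuous_integrable_box.
    by apply: continuous_sum_fun => k x; exact: (continuousM (cont u k Cu x)
        (cont u k Cu x)).
  rewrite /Defs.inner -RintegralZl//; last exact: int.
  apply: le_Rintegral => //; [exact: int|by apply: integrable_EFinZ => //;
      exact: int|].
  move=> p Op; rewrite mulr_sumr; apply: ler_sum => k _.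
  rewrite [G p _ _]mxE.
  have : `|s p| <= T.
    move: Op; rewrite Omega_box => /(_ ord_max); rewrite side_max => /andP[p0 pT].
    by rewrite ler_norml /s /t1; apply/andP; case: t0E => ->; split; lra.
  rewrite ler_norml => /andP[s1 s2]; move: (s p) (F p ord0 k) s1 s2 => x y s1 s2.
  rewrite (_ : x * y * (x * y) = x ^+ 2 * (y * y)); last by ring.
  rewrite ler_wpM2r -?expr2 ?sqr_ge0//; nra.
have := CauchySchwarz_inner mOm AFL GL.
move: green; rewrite AG innerBr// HF.
have := inner_ge0 Om F; have := inner_ge0 Om (A F); move: GG.
move: (inner F F) (inner (A F) (A F)) (inner (A F) G) (inner G G) => x y z g.
move=> gx y0 x0 e zg; have xz : x = 2 * z by lra.
(* With x = 2 z, Cauchy-Schwarz and [gx] give x^2 = 4 z^2 <= 4 T^2 x y; it remains to divide by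
   x. *)
have [x00|xn0] := eqVneq x 0; first by rewrite x00 mulr_ge0// mulr_ge0// sqr_ge0.
have xp : 0 < x by rewrite lt_def xn0.
rewrite -(ler_pM2l xp) -expr2 {1}xz.
have := ler_wpM2l y0 gx; nra.
Qed.

Lemma normL2D u v : vL2 u -> vL2 v -> normL2 (u + v) <= normL2 u + normL2 v.
Proof.
move=> uL vL; have uvL := vL2D mOm uL vL.
rewrite -(@ler_pXn2r _ 2)// ?nnegrE ?addr_ge0 ?sqrtr_ge0//.
rewrite sqrrD !normL2E innerDl// !innerDr// (innerC _ v u).
have := le_trans (ler_norm _) (inner_le_normL2 mOm uL vL).
move: (inner u u) (inner u v) (inner v v) (normL2 u * normL2 v) => x y z t; lra.
Qed.

(* By duality: test with solutions [F] of the adjoint problem, [A F] close to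
   [u]. *)
Lemma weak_energy_estimate t1 u g : t1 = 0 \/ t1 = T -> vL2 u -> vL2 g ->
  (forall F, admissible T a t1 F -> inner g F + inner u (A F) = 0) ->
  inner u u <= 4 * T ^+ 2 * inner g g.
Proof.
move=> t1E uL gL ug.
set X := normL2 u; set Y := normL2 g.
have X0 : 0 <= X by exact: sqrtr_ge0.
have Y0 : 0 <= Y by exact: sqrtr_ge0.
suff XY : X ^+ 2 <= 2 * T * Y * X.
  rewrite -!normL2E -/X -/Y.
  have [->|Xn0] := eqVneq X 0; first by rewrite expr0n; exact: (mulr_ge0
      (mulr_ge0 (ler0n R 4) (sqr_ge0 T)) (sqr_ge0 Y)).
  have Xp : 0 < X by rewrite lt_def Xn0.
  have : X <= 2 * T * Y by rewrite -(ler_pM2r Xp) -expr2.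
  move=> XY'; rewrite (_ : 4 * T ^+ 2 * Y ^+ 2 = (2 * T * Y) ^+ 2); last by ring.
  by rewrite lerXn2r ?nnegrE// ?mulr_ge0// ltW.
apply/ler_addgt0Pr => e e0.
have K1 : 0 < X + 2 * T * Y + 1.
  by rewrite ltr_wpDl// addr_ge0// !mulr_ge0// ltW.
(* The total error below is (X + 2 T Y) h; the added 1 makes the quotient meaningful when X and Y
   vanish. *)
pose h := e / (X + 2 * T * Y + 1); have h0 : 0 < h by exact: divr_gt0.
have [_ /(_ (h ^+ 2) (exprn_gt0 2 h0))[F aF Fh]] := vL2_range_closure c T_gt0
    a_gt0 t1E uL.
have [CF _ _ _] := aF; have FL := vC1_vL2 T a CF; have AFL := vL2_classical_wave
    c T a CF.
have uAL := vL2B mOm uL AFL.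
have Nh : normL2 (u - A F) <= h.
  by rewrite -(@ler_pXn2r _ 2)// ?nnegrE ?sqrtr_ge0 ?normL2E ?ltW.
have NA : normL2 (A F) <= X + h.
  rewrite (_ : A F = u + (-1) *: (u - A F)); last by rewrite scaleN1r opprB
      addrC subrK.
  apply: (le_trans (normL2D uL (vL2Z mOm _ uAL))); rewrite lerD2l.
  apply: le_trans Nh; rewrite /Defs.normL2 innerZl// ?innerZr//; last exact: vL2Z.
  by rewrite mulrA mulN1r opprK mul1r.
have NF : normL2 F <= 2 * T * normL2 (A F).
  rewrite -(@ler_pXn2r _ 2)// ?nnegrE ?sqrtr_ge0 ?mulr_ge0 ?sqrtr_ge0 ?(ltW
      T_gt0)//.
  rewrite exprMn !normL2E (_ : (2 * T) ^+ 2 = 4 * T ^+ 2); last by ring.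
  exact: energy_estimate t1E (admissible_boundary aF).
(* The weak equation replaces (u, A F) by -(g, F), which the estimate for F controls. *)
have E : X ^+ 2 = inner u (u - A F) - inner g F.
  have := ug F aF; rewrite normL2E innerBr//.
  by move: (inner u u) (inner g F) (inner u (A F)) => x y z; lra.
have B1 := le_trans (ler_norm _) (inner_le_normL2 mOm uL uAL).
have B2 := inner_le_normL2 mOm gL FL.
rewrite E -/X -/Y in B1 B2 *.
have C1 : inner u (u - A F) <= X * h by apply: (le_trans B1); rewrite ler_wpM2l.
have C2 : - inner g F <= Y * (2 * T * (X + h)).
  apply: (@le_trans _ _ `|inner g F|); first by rewrite -normrN ler_norm.
  apply: (le_trans B2); rewrite ler_wpM2l//; apply: (le_trans NF).
  by rewrite ler_wpM2l// mulr_ge0// ltW.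
apply: (le_trans (lerD C1 C2)).
have -> : X * h + Y * (2 * T * (X + h)) = 2 * T * Y * X + (X + 2 * T * Y) * h by
    ring.
rewrite lerD2l -[leRHS](divfK (lt0r_neq0 K1)) mulrC -/h ler_wpM2l ?ltW// ltrDl//.
Qed.

(** Green's formula for F makes u - F a weak solution with right-hand side g - A F and the same test
    fields, so the weak estimate bounds it. *)
Lemma dense_of_weak t0 t1 u g e :
  (t0 = 0 /\ t1 = T) \/ (t0 = T /\ t1 = 0) -> vL2 u -> is_wave c Om u g ->
  (forall F, admissible T a t1 F -> inner g F + inner u (A F) = 0) ->
  0 < e -> exists2 v, calV_at t0 v & normW c Om (u - v) < e.
Proof.
move=> t01 uL wug ug e0; have gL := wug.1.
have t0E : t0 = 0 \/ t0 = T by case: t01 => -[-> _]; [left|right].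
have t1E : t1 = 0 \/ t1 = T by case: t01 => -[_ ->]; [right|left].
have K1 : 0 < 4 * T ^+ 2 + 1 by have := sqr_ge0 T; lra.
(* The squared W-norm of u - F is at most (4 T^2 + 1) |g - A F|^2; aiming at e / 2 makes the final
   inequality strict. *)
have h0 : 0 < (e / 2) ^+ 2 / (4 * T ^+ 2 + 1) by rewrite divr_gt0// exprn_gt0//
    divr_gt0.
have [_ /(_ _ h0)[F aF Fe]] := vL2_range_closure c T_gt0 a_gt0 t0E gL.
have [CF _ _ _] := aF; have FL := vC1_vL2 T a CF; have AFL := vL2_classical_wave
    c T a CF.
exists F; first exact: admissible_calV.
have uFw : is_wave c Om (u - F) (g - A F).
  by apply: is_waveB => //; exact: is_wave_classical.
have est : inner (u - F) (u - F) <= 4 * T ^+ 2 * inner (g - A F) (g - A F).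
  apply: (weak_energy_estimate t1E); [exact: vL2B|exact: vL2B|].
  move=> G aG; have [CG _ _ _] := aG.
  have GL := vC1_vL2 T a CG; have AGL := vL2_classical_wave c T a CG.
  rewrite !innerBl// addrACA -opprD ug//.
  by rewrite (Green_boundary t01 (admissible_boundary aF) (admissible_boundary
      aG)) subr0.
apply: (@le_lt_trans _ _ (Num.sqrt ((e / 2) ^+ 2))); last first.
  by rewrite sqrtr_sqr gtr0_norm ?divr_gt0//; lra.
apply: (normW_le (vL2B mOm uL FL) uFw).
move: est Fe; rewrite ltr_pdivlMr//.
by move: (inner _ _) (inner (g - _) _) => x y; lra.
Qed.

End density.

(** * Inclusions, and weak forms of V and V^* *)

Section inclusions.
Context (R : realType) (d : nat) (c T : R) (a : 'I_d -> R).
Hypotheses (T_gt0 : 0 < T) (a_gt0 : forall i, 0 < a i).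
Implicit Types (u v w g F G : vfun R d) (p : 'rV[R]_d.+1).

Local Notation Om := (Omega T a).
Local Notation inner := (inner Om).
Local Notation vL2 := (vL2 Om).
Local Notation A := (classical_wave c).

Let mOm : measurable Om := measurable_Omega T a.

Lemma calV_at_wave t0 v : t0 = 0 \/ t0 = T -> calV_at T a t0 v ->
  vL2 v /\ exists F, [/\ boundary_conditions T a t0 F, {in Om, v =1 F} &
    is_wave c Om v (A F)].
Proof.
move=> t0E /(calV_extension T_gt0 a_gt0 t0E)[F bF vF]; have [CF _ _] := bF.
have Fv : {in Om, F =1 v} by move=> p Op; rewrite vF.
have FL := vC1_vL2 T a CF.
split; first exact: eq_vL2 FL.
by exists F; split => //; apply: (eq_is_wave Fv FL); exact: is_wave_classical.
Qed.

Lemma pairingD_calV v w : calV T a v -> calVstar T a w -> pairingD c Om v w = 0.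
Proof.
move=> /(calV_at_wave (or_introl erefl))[vL [F [bF vF vw]]].
move=> /(calV_at_wave (or_intror erefl))[wL [G [bG wG ww]]].
rewrite /pairingD (inner_wave vL wL vw) (innerC _ v) (inner_wave wL vL ww).
rewrite (innerC _ (A G)).
rewrite -[RHS](Green_boundary c T_gt0 a_gt0 (or_introl (conj erefl erefl)) bF bG).
by congr (_ + _); apply: eq_inner.
Qed.

Lemma calV_sub_V : calV T a `<=` V c T a.
Proof.
move=> v cv; have [vL [F [_ _ vw]]] := calV_at_wave (or_introl erefl) cv.
split; first by split => //; exists (A F).
by move=> w cw; exact: pairingD_calV.
Qed.

Lemma calVstar_sub_Vstar : calVstar T a `<=` Vstar c T a.
Proof.
move=> w cw; have [wL [G [_ _ ww]]] := calV_at_wave (or_intror erefl) cw.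
have wwL := (is_wave_wave ww).1.
(* The adjoint acts as -A, so -A w is the required element of L^2. *)
split=> //; exists (-1 *: wave c Om w); first exact: vL2Z.
move=> u [[uL _] /(_ w cw)]; rewrite /pairingD innerZr//.
by move=> /eqP; rewrite addr_eq0 => /eqP ->; rewrite mulN1r.
Qed.

Lemma V_weak u : V c T a u -> [/\ vL2 u, is_wave c Om u (wave c Om u) &
  forall F, admissible T a T F -> inner (wave c Om u) F + inner u (A F) = 0].
Proof.
move=> [[uL [g ug]] Hu]; have uw := is_wave_wave ug; split => // F aF.
have [CF _ _ _] := aF; have FL := vC1_vL2 T a CF.
have := Hu F (admissible_calV a_gt0 aF); rewrite /pairingD.
by rewrite (innerC _ u (wave _ _ _)) (inner_wave FL uL (is_wave_classical c
    T_gt0 a_gt0 CF)) (innerC _ (A F)).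
Qed.

(** Lets the adjoint relation, stated for elements of V, be read as an equation between
    distributions. *)
Lemma calV_single k phi : test_fun Om phi -> calV T a (single k phi).
Proof.
move=> tphi; have [sphi cphi _] := tphi; split.
- move=> j; rewrite component_single; apply: smooth_up_to_boundaryZ.
  by exists phi.
- move=> p [_ /= p0]; apply/rowP => j; rewrite !mxE (test_fun_out tphi) ?mul0r//.
  by move=> [_]; rewrite /= in_itv/= p0 ltxx.
- move=> p [[_ nint] _]; rewrite mxE (test_fun_out tphi) ?mul0r//.
  by move=> [Op _]; apply: nint; have := @open_box R d a; rewrite openE; apply.
Qed.

(** With l the adjoint value, A w = -l: the relation on V restricts to [calV], which contains both
    the test fields and the admissible fields for t0 = 0. *)
Lemma Vstar_weak w : Vstar c T a w -> exists g, [/\ vL2 w, is_wave c Om w g &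
  forall F, admissible T a 0 F -> inner g F + inner w (A F) = 0].
Proof.
move=> [wL [l lL Hw]]; exists (-1 *: l).
have H F : vC1 F -> calV T a F -> inner (-1 *: l) F + inner w (A F) = 0.
  move=> CF cF; have FL := vC1_vL2 T a CF.
  have := Hw F (calV_sub_V cF).
  rewrite (inner_wave FL wL (is_wave_classical c T_gt0 a_gt0 CF)).
  by rewrite innerZl// (innerC _ (A F)) => ->; rewrite (innerC _ F) mulN1r addNr.
split=> //; last by move=> F aF; apply: H; [case: aF|exact: admissible_calV].
apply/is_waveP => //; split; first exact: vL2Z.
move=> k phi tphi; have [/smooth_C1 Cphi _ _] := tphi.
by apply: H; [exact: vC1_single|exact: calV_single].
Qed.

End inclusions.

Theorem theorem4p1 (R : realType) (d : nat) (c T : R) (a : 'I_d -> R)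
    (d_ge1 : (1 <= d)%N) (c_gt0 : 0 < c) (T_gt0 : 0 < T)
    (a_gt0 : forall i, 0 < a i) :
  denseW c (Omega T a) (calVstar T a) (Vstar c T a) /\
  denseW c (Omega T a) (calV T a) (V c T a).
Proof.
split; split.
- exact: calVstar_sub_Vstar.
- move=> w /(Vstar_weak T_gt0 a_gt0)[g [wL wg H]] e e0.
  (* Approximants vanish at t = T and test fields at t = 0; for V the two ends are exchanged. *)
  exact: (dense_of_weak T_gt0 a_gt0 (or_intror (conj erefl erefl)) wL wg H e0).
- exact: calV_sub_V.
- move=> u /(V_weak T_gt0 a_gt0)[uL uw H] e e0.
  exact: (dense_of_weak T_gt0 a_gt0 (or_introl (conj erefl erefl)) uL uw H e0).
Qed.
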